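(* Let $\pi=(p_1,\dots,p_n)$ be positive integers with $p_1\leqslant\dots\leqslant p_n$, and let $\lambda(u)=(\lambda_1(u),\dots,\lambda_n(u))$ be an $n$-tuple of monic polynomials with complex coefficients, $\lambda_i(u)=(u+\lambda_i^{(1)})\cdots(u+\lambda_i^{(p_i)})$, such that $\lambda_i^{(k)}-\lambda_{i+1}^{(k)}\in\mathbb{Z}_+$ for all $i=1,\dots,n-1$ and $k=1,\dots,p_i$, and $\lambda_i^{(k)}-\lambda_j^{(m)}\notin\mathbb{Z}$ for all $i,j$ and all $k\ne m$ (with $1\leqslant k\leqslant p_i$, $1\leqslant m\leqslant p_j$). Then for every Gelfand--Tsetlin pattern $\Lambda(u)$ associated with $\lambda(u)$, the normalized vectors $\xi_\Lambda\in L(\lambda(u))$ satisfy $$A_r(u)\,\xi_\Lambda=\lambda_{r1}(u)\,\lambda_{r2}(u-1)\cdots\lambda_{rr}(u-r+1)\,\xi_\Lambda$$ for $r=1,\dots,n$, and $$B_r(-l_{ri}^{(k)})\,\xi_\Lambda=-\lambda_{r+1,1}(-l_{ri}^{(k)})\,\lambda_{r+1,2}(-l_{ri}^{(k)}-1)\cdots\lambda_{r+1,r+1}(-l_{ri}^{(k)}-r)\;\xi_{\Lambda+\delta_{ri}^{(k)}},$$ $$C_r(-l_{ri}^{(k)})\,\xi_\Lambda=\lambda_{r-1,1}(-l_{ri}^{(k)})\,\lambda_{r-1,2}(-l_{ri}^{(k)}-1)\cdots\lambda_{r-1,r-1}(-l_{ri}^{(k)}-r+2)\;\xi_{\Lambda-\delta_{ri}^{(k)}}$$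 for $r=1,\dots,n-1$, $i=1,\dots,r$ and $k=1,\dots,p_i$, where $\xi_{\Lambda\pm\delta_{ri}^{(k)}}$ corresponds to the pattern obtained from $\Lambda(u)$ by replacing $\lambda_{ri}^{(k)}$ by $\lambda_{ri}^{(k)}\pm1$, and is understood to be zero if the resulting array is not a pattern.
   Context: All algebras are associative unital algebras over $\mathbb{C}$; $\mathbb{Z}_+$ is the set of nonnegative integers; empty products equal $1$. **Shifted Yangian.** For $\pi=(p_1,\dots,p_n)$ with $p_1\leqslant\dots\leqslant p_n$, $\mathrm{Y}_\pi(\mathfrak{gl}_n)$ is generated by $d_i^{(r)}$ ($1\leqslant i\leqslant n$, $r\geqslant1$), $f_i^{(r)}$ ($1\leqslant i\leqslant n-1$, $r\geqslant 1$), $e_i^{(r)}$ ($1\leqslant i\leqslant n-1$, $r\geqslant p_{i+1}-p_i+1$), subject to the following relations for all admissible indices, where $d_i^{(0)}=1$ and $d_i^{\prime(r)}$ are determined by $\sum_{t=0}^r d_i^{(t)}d_i^{\prime(r-t)}=\delta_{r0}$ for $r\geqslant0$: $[d_i^{(r)},d_j^{(s)}]=0$; $[e_i^{(r)},f_j^{(s)}]=-\delta_{ij}\sum_{t=0}^{r+s-1}d_i^{\prime(t)}d_{i+1}^{(r+s-t-1)}$; $[d_i^{(r)},e_j^{(s)}]=(\delta_{ij}-\delta_{i,j+1})\sum_{t=0}^{r-1}d_i^{(t)}e_j^{(r+s-t-1)}$; $[d_i^{(r)},f_j^{(s)}]=(\delta_{i,j+1}-\delta_{ij})\sum_{t=0}^{r-1}f_j^{(r+s-t-1)}d_i^{(t)}$;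 $[e_i^{(r)},e_i^{(s+1)}]-[e_i^{(r+1)},e_i^{(s)}]=e_i^{(r)}e_i^{(s)}+e_i^{(s)}e_i^{(r)}$; $[f_i^{(r+1)},f_i^{(s)}]-[f_i^{(r)},f_i^{(s+1)}]=f_i^{(r)}f_i^{(s)}+f_i^{(s)}f_i^{(r)}$; $[e_i^{(r)},e_{i+1}^{(s+1)}]-[e_i^{(r+1)},e_{i+1}^{(s)}]=-e_i^{(r)}e_{i+1}^{(s)}$; $[f_i^{(r+1)},f_{i+1}^{(s)}]-[f_i^{(r)},f_{i+1}^{(s+1)}]=-f_{i+1}^{(s)}f_i^{(r)}$; $[e_i^{(r)},e_j^{(s)}]=0=[f_i^{(r)},f_j^{(s)}]$ if $|i-j|>1$; $[e_i^{(r)},[e_i^{(s)},e_j^{(t)}]]+[e_i^{(s)},[e_i^{(r)},e_j^{(t)}]]=0$ and $[f_i^{(r)},[f_i^{(s)},f_j^{(t)}]]+[f_i^{(s)},[f_i^{(r)},f_j^{(t)}]]=0$ if $|i-j|=1$. **Finite $W$-algebra.** $W(\pi)$ is the quotient of $\mathrm{Y}_\pi(\mathfrak{gl}_n)$ by the two-sided ideal generated by all $d_1^{(r)}$ with $r\geqslant p_1+1$; images of elements are denoted by the same symbols. **Series.** $d_i(u)=1+\sum_{r\geqslant1}d_i^{(r)}u^{-r}$, $f_i(u)=\sum_{r\geqslant1}f_i^{(r)}u^{-r}$, $e_i(u)=\sum_{r\geqslant p_{i+1}-p_i+1}e_i^{(r)}u^{-r}$; $a_i(u)=d_1(u)d_2(u-1)\cdots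 d_i(u-i+1)$, $b_i(u)=a_i(u)e_i(u-i+1)$, $c_i(u)=f_i(u-i+1)a_i(u)$. In $W(\pi)$ set $A_i(u)=u^{p_1}(u-1)^{p_2}\cdots(u-i+1)^{p_i}\,a_i(u)$ for $1\leqslant i\leqslant n$, and $B_i(u)=u^{p_1}(u-1)^{p_2}\cdots(u-i+2)^{p_{i-1}}(u-i+1)^{p_{i+1}}\,b_i(u)$, $C_i(u)=u^{p_1}(u-1)^{p_2}\cdots(u-i+1)^{p_i}\,c_i(u)$ for $1\leqslant i\leqslant n-1$. These are polynomials in $u$ with coefficients in $W(\pi)$, so they can be evaluated at complex numbers. One has $[C_i(u),C_i(v)]=0$. **Highest weight representation.** $L(\lambda(u))$ is the irreducible representation of $W(\pi)$ generated by a nonzero vector $\zeta$ (the highest vector) with $B_i(u)\zeta=0$ for $1\leqslant i\leqslant n-1$ and $u^{p_i}d_i(u)\zeta=\lambda_i(u)\zeta$ for $1\leqslant i\leqslant n$. **Patterns.** A Gelfand--Tsetlin pattern $\Lambda(u)$ associated with $\lambda(u)$ is an array of monic polynomials $\lambda_{ri}(u)=(u+\lambda_{ri}^{(1)})\cdots(u+\lambda_{ri}^{(p_i)})$, $1\leqslant i\leqslant r\leqslant n$, with $\lambda_{ni}^{(k)}=\lambda_i^{(k)}$ and $\lambda_{r+1,i}^{(k)}-\lambda_{ri}^{(k)}\in\mathbb{Z}_+$, $\lambda_{ri}^{(k)}-\lambda_{r+1,i+1}^{(k)}\in\mathbb{Z}_+$ for $k=1,\dots,p_i$ and $1\leqslant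 i\leqslant r\leqslant n-1$. Put $l_i^{(k)}=\lambda_i^{(k)}-i+1$ and $l_{ri}^{(k)}=\lambda_{ri}^{(k)}-i+1$. **Vectors $\zeta_\Lambda$.** For a pattern $\Lambda(u)$, $$\zeta_\Lambda=\prod_{i=1,\dots,n-1}^{\longrightarrow}\Big\{P_{n-1,i}\,P_{n-2,i}\cdots P_{i,i}\Big\}\,\zeta,\qquad P_{r,i}=\prod_{k=1}^{p_i}\Big(C_r(-l_{ri}^{(k)}-1)\cdots C_r(-l_i^{(k)}+1)\,C_r(-l_i^{(k)})\Big),$$ where the arrow means that the factor with $i=1$ is leftmost and $i=n-1$ rightmost, and the inner product has $l_i^{(k)}-l_{ri}^{(k)}$ factors. **Normalized vectors.** For a pattern $\Lambda(u)$ put $$N_\Lambda=\prod_{(r,i)}\ \prod_{j=1}^{i-1}\prod_{m=1}^{p_j}\prod_{k=1}^{p_i}(l_j^{(m)}-l_i^{(k)})(l_j^{(m)}-l_i^{(k)}+1)\cdots(l_j^{(m)}-l_{ri}^{(k)}-1)$$ $$\qquad\times\prod_{j=i}^{r-1}\prod_{m=1}^{p_j}\prod_{k=1}^{p_i}(l_{r-1,j}^{(m)}-l_i^{(k)})(l_{r-1,j}^{(m)}-l_i^{(k)}+1)\cdots(l_{r-1,j}^{(m)}-l_{ri}^{(k)}-1),$$ where the outer product is over pairs $(r,i)$ with $1\leqslant i\leqslant r\leqslant n-1$ and applies to both lines; each displayed string has $l_i^{(k)}-l_{ri}^{(k)}$ factors. This constant is nonzero, and $\xi_\Lambda=N_\Lambda^{-1}\zeta_\Lambda$.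 *)

(* Defs.v *)
From HB Require Import structures.
From mathcomp Require Import all_boot all_order all_algebra.
From mathcomp Require Import boolp classical_sets reals.
From mathcomp Require Import complex.
From mathcomp Require Import monalg.

Set Implicit Arguments.
Unset Strict Implicit.
Unset Printing Implicit Defensive.

Import GRing.Theory.
Local Open Scope ring_scope.
Local Open Scope quotient_scope.

(******************************************************************************)
(* Quotient of an associative K-algebra by the two-sided ideal generated by   *)
(* a set S of elements.  MathComp rings occurring in {poly _} and in K-algebra*)
(* structures are non-trivial, hence the properness argument of quot_alg.     *)
(******************************************************************************)

Section QuotientAlgebra.
Variables (K : comNzRingType) (A : algType K).

Inductive ideal_gen (S : A -> Prop) : A -> Prop :=
| ideal_gen0 : ideal_gen S 0
| ideal_gen_mem x : S x -> ideal_gen S x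
| ideal_genD x y : ideal_gen S x -> ideal_gen S y -> ideal_gen S (x + y)
| ideal_genMl a x : ideal_gen S x -> ideal_gen S (a * x)
| ideal_genMr a x : ideal_gen S x -> ideal_gen S (x * a).

Definition ideal_pred (S : A -> Prop) : {pred A} := fun x => `[< ideal_gen S x >].

Lemma ideal_predP S x : reflect (ideal_gen S x) (x \in ideal_pred S).
Proof. exact: asboolP. Qed.

Lemma ideal_pred_zmod_closed S : zmod_closed (ideal_pred S).
Proof.
split=> [|x y /ideal_predP Ix /ideal_predP Iy]; apply/ideal_predP.
  exact: ideal_gen0.
by apply: ideal_genD Ix _; rewrite -mulN1r; apply: ideal_genMl.
Qed.

HB.instance Definition _ S :=
  GRing.isZmodClosed.Build A (ideal_pred S) (ideal_pred_zmod_closed S).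

Definition quot_alg (S : A -> Prop) (S_proper : ~ ideal_gen S 1) : Type :=
  Quotient.quot (ideal_pred S).

Section Structure.
Variables (S : A -> Prop) (S_proper : ~ ideal_gen S 1).
Local Notation Q := (quot_alg S_proper).

HB.instance Definition _ := GRing.Zmodule.on Q.

Definition quot_pi (x : A) : Q := \pi_(Quotient.quot (ideal_pred S)) x.
Definition quot_repr (x : Q) : A := repr (x : Quotient.quot (ideal_pred S)).

Lemma quot_reprK : cancel quot_repr quot_pi.
Proof. exact: reprK. Qed.

Lemma quot_piE x y : quot_pi x = quot_pi y <-> ideal_gen S (x - y).
Proof.
split=> [/eqP|/ideal_predP]; rewrite /quot_pi.
  by rewrite -Quotient.idealrBE => /ideal_predP.
by rewrite Quotient.idealrBE => /eqP.
Qed.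

Lemma quot_pi_ind (P : Q -> Prop) : (forall x, P (quot_pi x)) -> forall x, P x.
Proof. by move=> H x; rewrite -[x]quot_reprK. Qed.

Lemma quot_piB x y : quot_pi (x - y) = quot_pi x - quot_pi y.
Proof. by rewrite /quot_pi !piE. Qed.
HB.instance Definition _ := GRing.isZmodMorphism.Build A Q quot_pi quot_piB.

Lemma quot_repr_pi x : ideal_gen S (quot_repr (quot_pi x) - x).
Proof. by apply/quot_piE; rewrite quot_reprK. Qed.

Definition quot_one : Q := quot_pi 1.
(* Locked, so that comparing two distinct elements does not unfold them. *)
Definition quot_mul : Q -> Q -> Q :=
  locked (fun x y => quot_pi (quot_repr x * quot_repr y)).
Definition quot_scale : K -> Q -> Q :=
  locked (fun k x => quot_pi (k *: quot_repr x)).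

Lemma quot_pi_mul x y : quot_mul (quot_pi x) (quot_pi y) = quot_pi (x * y).
Proof.
rewrite /quot_mul -lock; apply/quot_piE; set x' := quot_repr _; set y' := quot_repr _.
have -> : x' * y' - x * y = (x' - x) * y' + x * (y' - y).
  by rewrite mulrBl mulrBr addrA subrK.
by apply: ideal_genD; [apply: ideal_genMr|apply: ideal_genMl];
  apply: quot_repr_pi.
Qed.

Lemma quot_pi_scale k x : quot_scale k (quot_pi x) = quot_pi (k *: x).
Proof.
rewrite /quot_scale -lock; apply/quot_piE; rewrite -scalerBr -[_ - x]mul1r scalerAl.
exact/ideal_genMl/quot_repr_pi.
Qed.

Lemma quot_mulA : associative quot_mul.
Proof.
elim/quot_pi_ind=> x; elim/quot_pi_ind=> y; elim/quot_pi_ind=> z.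
by rewrite !quot_pi_mul mulrA.
Qed.

Lemma quot_mul1 : left_id quot_one quot_mul.
Proof. by elim/quot_pi_ind=> x; rewrite !quot_pi_mul mul1r. Qed.

Lemma quot_mulr1 : right_id quot_one quot_mul.
Proof. by elim/quot_pi_ind=> x; rewrite !quot_pi_mul mulr1. Qed.

Lemma quot_mulDl : left_distributive quot_mul +%R.
Proof.
elim/quot_pi_ind=> x; elim/quot_pi_ind=> y; elim/quot_pi_ind=> z.
by rewrite -raddfD !quot_pi_mul mulrDl raddfD.
Qed.

Lemma quot_mulDr : right_distributive quot_mul +%R.
Proof.
elim/quot_pi_ind=> x; elim/quot_pi_ind=> y; elim/quot_pi_ind=> z.
by rewrite -raddfD !quot_pi_mul mulrDr raddfD.
Qed.

Lemma quot_one_neq0 : quot_one != 0.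
Proof.
apply/eqP => h; apply: S_proper; rewrite -[1]subr0; apply/quot_piE.
by rewrite raddf0.
Qed.

HB.instance Definition _ := GRing.Zmodule_isNzRing.Build Q
  quot_mulA quot_mul1 quot_mulr1 quot_mulDl quot_mulDr quot_one_neq0.

Lemma quot_scaleA a b x : quot_scale a (quot_scale b x) = quot_scale (a * b) x.
Proof. by elim/quot_pi_ind: x => x; rewrite !quot_pi_scale scalerA. Qed.

Lemma quot_scale1 : left_id 1 quot_scale.
Proof. by elim/quot_pi_ind=> x; rewrite quot_pi_scale scale1r. Qed.

Lemma quot_scaleDr : right_distributive quot_scale +%R.
Proof.
move=> k; elim/quot_pi_ind=> x; elim/quot_pi_ind=> y.
by rewrite -raddfD !quot_pi_scale scalerDr raddfD.
Qed.

Lemma quot_scaleDl x : {morph quot_scale^~ x : a b / a + b}.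
Proof.
by elim/quot_pi_ind: x => x a b; rewrite !quot_pi_scale scalerDl raddfD.
Qed.

HB.instance Definition _ := GRing.Zmodule_isLmodule.Build K Q
  quot_scaleA quot_scale1 quot_scaleDr quot_scaleDl.

Lemma quot_scaleAl k (x y : Q) : k *: (x * y) = (k *: x) * y.
Proof.
elim/quot_pi_ind: x => x; elim/quot_pi_ind: y => y.
rewrite /GRing.scale /GRing.mul /= quot_pi_mul !quot_pi_scale.
by rewrite quot_pi_mul scalerAl.
Qed.
HB.instance Definition _ := GRing.Lmodule_isLalgebra.Build K Q quot_scaleAl.

Lemma quot_scaleAr k (x y : Q) : k *: (x * y) = x * (k *: y).
Proof.
elim/quot_pi_ind: x => x; elim/quot_pi_ind: y => y.
rewrite /GRing.scale /GRing.mul /= quot_pi_mul !quot_pi_scale.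
by rewrite quot_pi_mul scalerAr.
Qed.
HB.instance Definition _ := GRing.Lalgebra_isAlgebra.Build K Q quot_scaleAr.

Lemma quot_pi_monoid_morphism : monoid_morphism quot_pi.
Proof. by split=> // x y; rewrite -quot_pi_mul. Qed.
HB.instance Definition _ :=
  GRing.isMonoidMorphism.Build A Q quot_pi quot_pi_monoid_morphism.

Lemma quot_pi_scalable : scalable quot_pi.
Proof. by move=> k x; rewrite -quot_pi_scale. Qed.
HB.instance Definition _ :=
  GRing.isScalable.Build K A Q *:%R quot_pi quot_pi_scalable.

End Structure.

Section Lift.
Variables (B : nzRingType) (f : {rmorphism A -> B}) (S : A -> Prop).
Hypothesis fS : forall x, S x -> f x = 0.

Lemma ideal_gen_ker x : ideal_gen S x -> f x = 0.
Proof.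
elim=> [|{}x /fS //|{}x y _ fx _ fy|a {}x _ fx|a {}x _ fx].
- exact: rmorph0.
- by rewrite rmorphD fx fy addr0.
- by rewrite rmorphM fx mulr0.
- by rewrite rmorphM fx mul0r.
Qed.

Lemma ideal_gen_proper : ~ ideal_gen S 1.
Proof. by move/ideal_gen_ker/eqP; rewrite rmorph1 oner_eq0. Qed.

Variable S_proper : ~ ideal_gen S 1.
Local Notation Q := (quot_alg S_proper).

Definition quot_lift (_ : forall x, S x -> f x = 0) (x : Q) : B :=
  f (quot_repr x).

Lemma quot_lift_pi x : quot_lift fS (quot_pi S_proper x) = f x.
Proof.
by apply/eqP; rewrite -subr_eq0 -rmorphB; apply/eqP/ideal_gen_ker/quot_repr_pi.
Qed.

Lemma quot_liftB : zmod_morphism (quot_lift fS).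
Proof.
elim/quot_pi_ind=> x; elim/quot_pi_ind=> y.
by rewrite -rmorphB !quot_lift_pi rmorphB.
Qed.

Lemma quot_lift_monoid_morphism : monoid_morphism (quot_lift fS).
Proof.
split=> [|]; first by rewrite -(rmorph1 (quot_pi S_proper)) quot_lift_pi rmorph1.
elim/quot_pi_ind=> x; elim/quot_pi_ind=> y.
by rewrite -rmorphM !quot_lift_pi rmorphM.
Qed.

HB.instance Definition _ :=
  GRing.isZmodMorphism.Build Q B (quot_lift fS) quot_liftB.
HB.instance Definition _ :=
  GRing.isMonoidMorphism.Build Q B (quot_lift fS) quot_lift_monoid_morphism.

End Lift.
End QuotientAlgebra.

(******************************************************************************)
(* The free associative K-algebra on I; {fmonom I} is the free monoid on I.   *)
(* A separate type is needed because the library declares algType instances   *)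
(* for {malg K[M]} only when the monoid M is commutative.                     *)
(******************************************************************************)

Section FreeAlgebra.
Variables (K : comNzRingType) (I : choiceType).

Definition free_alg : Type := {malg K[{fmonom I}]}.
HB.instance Definition _ := GRing.Lalgebra.on free_alg.

Lemma free_alg_scaleAr (c : K) (x y : free_alg) : c *: (x * y) = x * (c *: y).
Proof.
have mulC z : (z : free_alg) * c%:MP = c *: z.
  rewrite -mul_malgC !malgM_def fgmulgU fgmulUg.
  by apply: eq_bigr => m _; rewrite mulm1 mul1m mulrC.
by rewrite -!mulC mulrA.
Qed.
HB.instance Definition _ :=
  GRing.Lalgebra_isAlgebra.Build K free_alg free_alg_scaleAr.

Definition free_gen (x : I) : free_alg := << fmu x >>.

(* The morphism to K sending every generator to 0. *)
Definition free_aug : free_alg -> K := mcoeff (@mone {fmonom I}).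
HB.instance Definition _ := GRing.RMorphism.copy free_aug
  (mcoeff (@mone {fmonom I}) : {malg K[{fmonom I}]} -> K).

Lemma free_aug_gen x : free_aug (free_gen x) = 0.
Proof. by rewrite /free_aug /free_gen mcoeffU1 fmP fmU fm1. Qed.

End FreeAlgebra.

(******************************************************************************)
(* Formal series \sum_(r >= 0) s_r u^(-r) over an algebra A, as functions s.  *)
(******************************************************************************)

Definition lie (A : pzRingType) (x y : A) : A := x * y - y * x.

Section Series.
Variable A : nzRingType.
Implicit Types s t : nat -> A.

Definition ser_one : nat -> A := fun m => (m == 0%N)%:R.

Definition ser_mul s t : nat -> A :=
  fun m => \sum_(r < m.+1) s r * t (m - r)%N.

(* s(u - c): expand (u-c)^(-r) = \sum_(q >= 0) 'C(r+q-1, q) c^q u^(-r-q)     *)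
(* and put m = r + q.                                                         *)
Definition ser_shift (c : nat) s : nat -> A :=
  fun m => \sum_(r < m.+1) s r *+ ('C(m.-1, m - r) * c ^ (m - r)).

(* The inverse of a series with constant term 1; see ser_invP.                *)
Fixpoint ser_inv_rec s (fuel m : nat) : A :=
  (m == 0%N)%:R - (if fuel is fuel'.+1
                   then \sum_(1 <= t < m.+1) s t * ser_inv_rec s fuel' (m - t)%N
                   else 0).
Definition ser_inv s : nat -> A := fun m => ser_inv_rec s m m.

Lemma ser_inv_rec_fuel s fuel m :
  (m <= fuel)%N -> ser_inv_rec s fuel m = ser_inv s m.
Proof.
rewrite /ser_inv; elim/ltn_ind: m fuel => m IH [|fuel] /=.
  by rewrite leqn0 => /eqP->.
case: m IH => [|m] IH le_m /=; first by rewrite big_geq ?subr0.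
congr (_ - _); rewrite big_seq [RHS]big_seq; apply: eq_bigr => t.
rewrite mem_index_iota => /andP[t1 tm].
have lt : (m.+1 - t < m.+1)%N by rewrite ltn_subrL t1.
by rewrite (IH _ lt) ?(IH _ lt m) // -ltnS // (leq_trans lt).
Qed.

Lemma ser_invP s m : s 0%N = 1 ->
  \sum_(t < m.+1) s t * ser_inv s (m - t)%N = (m == 0%N)%:R.
Proof.
move=> s0; rewrite big_ord_recl /= s0 mul1r subn0.
case: m => [|m]; first by rewrite big_ord0 addr0 /ser_inv /= subr0.
rewrite {1}/ser_inv /= sub0r big_add1 /= big_mkord addrC.
apply/eqP; rewrite subr_eq0; apply/eqP; apply: eq_bigr => i _.
by rewrite /bump leq0n add1n ser_inv_rec_fuel // subSS leq_subr.
Qed.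

End Series.

(******************************************************************************)
(* All families indexed in the literature by 1, ..., n or 1, ..., p_i are     *)
(* functions on nat with the same (1-based) indices; only the values at       *)
(* admissible indices are ever used.                                          *)
(******************************************************************************)

(* GD i r, GF i r, GE i r stand for d_i^(r), f_i^(r), e_i^(r). *)
Inductive gsym := GD of nat & nat | GF of nat & nat | GE of nat & nat.
HB.instance Definition _ := gen_eqMixin gsym.
HB.instance Definition _ := gen_choiceMixin gsym.

Section Yangian.
Variables (K : comNzRingType) (n : nat) (p : nat -> nat).

Definition d_ok (i r : nat) : bool := (1 <= i <= n)%N && (1 <= r)%N.
Definition f_ok (i r : nat) : bool := (1 <= i <= n.-1)%N && (1 <= r)%N.
Definition e_ok (i r : nat) : bool :=
  (1 <= i <= n.-1)%N && (p i.+1 - p i + 1 <= r)%N.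

Definition gen_ok (g : gsym) : bool :=
  match g with GD i r => d_ok i r | GF i r => f_ok i r | GE i r => e_ok i r end.

Record ygen : predArgType := YGen { ygen_sym : gsym; _ : gen_ok ygen_sym }.
HB.instance Definition _ := [isSub for ygen_sym].
HB.instance Definition _ := [Choice of ygen by <:].

Local Notation F := (free_alg K ygen).

(* Symbols outside the admissible range are 0, as they are absent from the    *)
(* series d_i(u), f_i(u), e_i(u).                                             *)
Definition gen_elt (g : gsym) : F :=
  if insub g is Some x then free_gen K x else 0.

Definition d0 (i r : nat) : F := if r == 0%N then 1 else gen_elt (GD i r).
Definition f0 (i r : nat) : F := gen_elt (GF i r).
Definition e0 (i r : nat) : F := gen_elt (GE i r).
Definition dinv0 (i : nat) : nat -> F := ser_inv (d0 i).

Local Notation d := d0.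
Local Notation f := f0.
Local Notation e := e0.
Local Notation d' := dinv0.
Local Notation delta i j := ((i == j)%:R : F).

(* yrel lhs rhs: the relation lhs = rhs. *)
Inductive yrel : F -> F -> Prop :=
| yrel_dd i j r s of d_ok i r & d_ok j s :
    yrel (lie (d i r) (d j s)) 0
| yrel_ef i j r s of e_ok i r & f_ok j s :
    yrel (lie (e i r) (f j s))
         (- (delta i j * \sum_(t < r + s) d' i t * d i.+1 (r + s - t - 1)))
| yrel_de i j r s of d_ok i r & e_ok j s :
    yrel (lie (d i r) (e j s))
         ((delta i j - delta i j.+1) *
            \sum_(t < r) d i t * e j (r + s - t - 1))
| yrel_df i j r s of d_ok i r & f_ok j s :
    yrel (lie (d i r) (f j s))
         ((delta i j.+1 - delta i j) *
            \sum_(t < r) f j (r + s - t - 1) * d i t)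
| yrel_ee i r s of e_ok i r & e_ok i s :
    yrel (lie (e i r) (e i s.+1) - lie (e i r.+1) (e i s))
         (e i r * e i s + e i s * e i r)
| yrel_ff i r s of f_ok i r & f_ok i s :
    yrel (lie (f i r.+1) (f i s) - lie (f i r) (f i s.+1))
         (f i r * f i s + f i s * f i r)
| yrel_ee1 i r s of e_ok i r & e_ok i.+1 s :
    yrel (lie (e i r) (e i.+1 s.+1) - lie (e i r.+1) (e i.+1 s))
         (- (e i r * e i.+1 s))
| yrel_ff1 i r s of f_ok i r & f_ok i.+1 s :
    yrel (lie (f i r.+1) (f i.+1 s) - lie (f i r) (f i.+1 s.+1))
         (- (f i.+1 s * f i r))
| yrel_ee0 i j r s of e_ok i r & e_ok j s & (i.+1 < j)%N || (j.+1 < i)%N :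
    yrel (lie (e i r) (e j s)) 0
| yrel_ff0 i j r s of f_ok i r & f_ok j s & (i.+1 < j)%N || (j.+1 < i)%N :
    yrel (lie (f i r) (f j s)) 0
| yrel_eee i j r s t of e_ok i r & e_ok i s & e_ok j t
                      & (j == i.+1) || (i == j.+1) :
    yrel (lie (e i r) (lie (e i s) (e j t))
          + lie (e i s) (lie (e i r) (e j t))) 0
| yrel_fff i j r s t of f_ok i r & f_ok i s & f_ok j t
                      & (j == i.+1) || (i == j.+1) :
    yrel (lie (f i r) (lie (f i s) (f j t))
          + lie (f i s) (lie (f i r) (f j t))) 0.

Definition yrelator (x : F) : Prop :=
  exists lhs rhs, yrel lhs rhs /\ x = lhs - rhs.

Local Notation aug := (@free_aug K ygen).

Lemma aug_gen g : aug (gen_elt g) = 0.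
Proof. by rewrite /gen_elt; case: insub => [x|]; rewrite ?rmorph0 ?free_aug_gen. Qed.

Lemma augD x y : aug (x + y) = aug x + aug y. Proof. exact: rmorphD. Qed.
Lemma augN x : aug (- x) = - aug x. Proof. exact: rmorphN. Qed.
Lemma augB x y : aug (x - y) = aug x - aug y. Proof. exact: rmorphB. Qed.
Lemma augM x y : aug (x * y) = aug x * aug y. Proof. exact: rmorphM. Qed.

Lemma augD0 x y : aug x = 0 -> aug y = 0 -> aug (x + y) = 0.
Proof. by rewrite augD => -> ->; rewrite addr0. Qed.
Lemma augB0 x y : aug x = 0 -> aug y = 0 -> aug (x - y) = 0.
Proof. by rewrite augB => -> ->; rewrite subr0. Qed.
Lemma augN0 x : aug x = 0 -> aug (- x) = 0.
Proof. by rewrite augN => ->; rewrite oppr0. Qed.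
Lemma augM0 x y : aug x = 0 -> aug (x * y) = 0.
Proof. by rewrite augM => ->; rewrite mul0r. Qed.

Lemma aug_lie x y : aug (lie x y) = 0.
Proof.
rewrite /lie augB; apply/eqP; rewrite subr_eq0; apply/eqP.
transitivity (aug x * aug y); first exact: augM.
by transitivity (aug y * aug x); [exact: mulrC|exact/esym/augM].
Qed.

Lemma aug_d i r : aug (d i r) = (r == 0%N)%:R.
Proof. by rewrite /d0; case: eqP => _; rewrite ?rmorph1 ?aug_gen. Qed.

Lemma aug_e i r : aug (e i r) = 0. Proof. exact: aug_gen. Qed.
Lemma aug_f i r : aug (f i r) = 0. Proof. exact: aug_gen. Qed.

Lemma aug_dinv i r : aug (d' i r) = (r == 0%N)%:R.
Proof.
rewrite /dinv0 /ser_inv; case: r => [|r] /=; first by rewrite subr0 rmorph1.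
rewrite sub0r rmorphN rmorph_sum big_seq big1 ?oppr0 // => t.
rewrite mem_index_iota => /andP[t1 _].
by rewrite rmorphM /= aug_d (gtn_eqF t1) mul0r.
Qed.

Lemma aug_yrelator x : yrelator x -> aug x = 0.
Proof.
case=> l [r [rel_lr ->]]; rewrite rmorphB /=.
suff [-> ->] : aug l = 0 /\ aug r = 0 by rewrite subrr.
case: {l r} rel_lr.
- by move=> *; split; [exact: aug_lie|exact: rmorph0].
- move=> i j r s /andP[_ er] /andP[_ s1]; rewrite aug_lie augN augM raddf_sum.
  rewrite big1 ?mulr0 ?oppr0 // => t _; rewrite /= augM aug_dinv aug_d.
  case: eqP => [->|_]; last by rewrite mul0r.
  have r1 : (0 < r)%N by apply: leq_trans er; rewrite addn1.
  suff /negPf-> : (r + s - 0 - 1)%N != 0%N by rewrite mulr0.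
  by rewrite subn0 subn_eq0 -ltnNge -addn1 leq_add.
- move=> i j r s _ _; rewrite aug_lie augM raddf_sum big1 ?mulr0 // => t _.
  by rewrite /= augM aug_e mulr0.
- move=> i j r s _ _; rewrite aug_lie augM raddf_sum big1 ?mulr0 // => t _.
  by rewrite /= augM aug_f mul0r.
- move=> *; split; [exact: augB0 (aug_lie _ _) (aug_lie _ _)|].
  exact: augD0 (augM0 _ (aug_e _ _)) (augM0 _ (aug_e _ _)).
- move=> *; split; [exact: augB0 (aug_lie _ _) (aug_lie _ _)|].
  exact: augD0 (augM0 _ (aug_f _ _)) (augM0 _ (aug_f _ _)).
- move=> *; split; [exact: augB0 (aug_lie _ _) (aug_lie _ _)|].
  exact: augN0 (augM0 _ (aug_e _ _)).
- move=> *; split; [exact: augB0 (aug_lie _ _) (aug_lie _ _)|].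
  exact: augN0 (augM0 _ (aug_f _ _)).
- by move=> *; split; [exact: aug_lie|exact: rmorph0].
- by move=> *; split; [exact: aug_lie|exact: rmorph0].
- move=> *; split; [exact: augD0 (aug_lie _ _) (aug_lie _ _)|exact: rmorph0].
- move=> *; split; [exact: augD0 (aug_lie _ _) (aug_lie _ _)|exact: rmorph0].
Qed.

Definition shifted_yangian_proper : ~ ideal_gen yrelator 1 :=
  ideal_gen_proper (f := aug) aug_yrelator.

Definition shifted_yangian : algType K := quot_alg shifted_yangian_proper.
Local Notation Y := shifted_yangian.

Definition toY (x : F) : Y := quot_pi shifted_yangian_proper x.

Definition w_relator (x : Y) : Prop :=
  exists2 r : nat, (p 1 + 1 <= r)%N & x = toY (d 1 r).

Lemma finite_W_proper : ~ ideal_gen w_relator 1.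
Proof.
pose augY : {rmorphism Y -> K} :=
  @quot_lift _ _ _ aug _ shifted_yangian_proper aug_yrelator.
apply: (ideal_gen_proper (f := augY)) => _ [r r_gt ->].
transitivity (aug (d 1 r)); first exact: quot_lift_pi.
by rewrite aug_d; case: r r_gt => //; rewrite addn1.
Qed.

Definition finite_W : algType K := quot_alg finite_W_proper.
Local Notation W := finite_W.

Definition toW (x : F) : W := quot_pi finite_W_proper (toY x).

Lemma toW_yrel lhs rhs : yrel lhs rhs -> toW lhs = toW rhs.
Proof.
move=> h; rewrite /toW; congr quot_pi; apply/quot_piE/ideal_gen_mem.
by exists lhs, rhs.
Qed.

Lemma toW_d1 r : (p 1 + 1 <= r)%N -> toW (d 1 r) = 0.
Proof.
move=> hr; rewrite -[RHS](raddf0 (quot_pi finite_W_proper)).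
by apply/quot_piE; rewrite subr0; apply: ideal_gen_mem; exists r.
Qed.

(* d_ser i, f_ser i, e_ser i are the series d_i(u), f_i(u), e_i(u), and at    *)
(* the same time the families of generators of W(pi).                         *)
Definition d_ser (i r : nat) : W := toW (d i r).
Definition f_ser (i r : nat) : W := toW (f i r).
Definition e_ser (i r : nat) : W := toW (e i r).

Definition a_ser (i : nat) : nat -> W :=
  \big[@ser_mul W/@ser_one W]_(1 <= j < i.+1) ser_shift j.-1 (d_ser j).
Definition b_ser (i : nat) : nat -> W :=
  ser_mul (a_ser i) (ser_shift i.-1 (e_ser i)).
Definition c_ser (i : nat) : nat -> W :=
  ser_mul (ser_shift i.-1 (f_ser i)) (a_ser i).

(* The polynomial P(u) s(u): the coefficient of u^m in this Laurent series is *)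
(* \sum_(k >= m) P_k s_(k-m).  Only m >= 0 is recorded; for the products A, B,*)
(* C below all coefficients with m < 0 vanish in W(pi), i.e. these products   *)
(* are polynomials in u.                                                      *)
Definition poly_times_ser (P : {poly K}) (s : nat -> W) : {poly W} :=
  \poly_(m < size P) \sum_(m <= k < size P) P`_k *: s (k - m)%N.

(* (u - j + 1) *)
Definition ulin (j : nat) : {poly K} := 'X - (j.-1)%:R%:P.

Definition A_poly (i : nat) : {poly W} :=
  poly_times_ser (\prod_(1 <= j < i.+1) ulin j ^+ p j) (a_ser i).
Definition B_poly (i : nat) : {poly W} :=
  poly_times_ser ((\prod_(1 <= j < i) ulin j ^+ p j) * ulin i ^+ p i.+1)
                 (b_ser i).
Definition C_poly (i : nat) : {poly W} :=
  poly_times_ser (\prod_(1 <= j < i.+1) ulin j ^+ p j) (c_ser i).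

Definition A_at (i : nat) (u : K) : W := (A_poly i).[u%:A].
Definition B_at (i : nat) (u : K) : W := (B_poly i).[u%:A].
Definition C_at (i : nat) (u : K) : W := (C_poly i).[u%:A].

End Yangian.

(******************************************************************************)
(* A representation of W(pi) is a left W(pi)-module V; a scalar c of K acts   *)
(* on V through c%:A.                                                         *)
(******************************************************************************)

(* (u + x_1) ... (u + x_q) *)
Definition root_poly (K : nzRingType) (q : nat) (x : nat -> K) : {poly K} :=
  \prod_(1 <= k < q.+1) ('X + (x k)%:P).

Definition in_Zplus (K : nzRingType) (x : K) : Prop := exists m : nat, x = m%:R.
Definition in_Z (K : nzRingType) (x : K) : Prop := exists m : int, x = m%:~R.

(* The natural number m with x = m (0 if there is none). *)
Definition nat_value (K : nzRingType) (x : K) : nat :=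
  xget 0%N [set m : nat | x = m%:R].

Section Patterns.
Variables (K : fieldType) (n : nat) (p : nat -> nat).
Local Notation W := (finite_W K n p).

(* (V, zeta) is L(lambda(u)) with its highest vector, where                   *)
(* lambda_i(u) = (u + lam i 1) ... (u + lam i (p i)).                         *)
(* hw_d compares the coefficients of u^(p_i - r) in                           *)
(* u^(p_i) d_i(u) zeta = lambda_i(u) zeta.                                    *)
Record highest_weight_irr (lam : nat -> nat -> K) (V : lmodType W) (zeta : V) :
  Prop := {
  hw_neq0 : zeta != 0;
  hw_generated : forall v : V, exists w : W, v = w *: zeta;
  hw_irreducible : forall S : {pred V}, GRing.submod_closed S ->
    (exists2 v, v \in S & v != 0) -> forall v, v \in S;
  hw_B : forall (i : nat) (u : K), (1 <= i <= n.-1)%N ->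
    B_at n p i u *: zeta = 0;
  hw_d : forall i r : nat, (1 <= i <= n)%N ->
    d_ser K n p i r *: zeta =
    (if (r <= p i)%N then (root_poly (p i) (lam i))`_(p i - r) else 0)%:A *: zeta
}.

(* The array L r i k = lambda_(ri)^(k). *)
Record GT_pattern (lam : nat -> nat -> K) (L : nat -> nat -> nat -> K) : Prop := {
  GT_top : forall i k, (1 <= i <= n)%N -> (1 <= k <= p i)%N -> L n i k = lam i k;
  GT_up : forall r i k, (1 <= i <= r)%N -> (r <= n.-1)%N -> (1 <= k <= p i)%N ->
    in_Zplus (L r.+1 i k - L r i k);
  GT_down : forall r i k, (1 <= i <= r)%N -> (r <= n.-1)%N -> (1 <= k <= p i)%N ->
    in_Zplus (L r i k - L r.+1 i.+1 k)
}.

(* l_i^(k) is ell lam i k and l_(ri)^(k) is ell (L r) i k. *)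
Definition ell (x : nat -> nat -> K) (i k : nat) : K := x i k - i%:R + 1.

Section Vectors.
Variables (lam : nat -> nat -> K) (L : nat -> nat -> nat -> K).

Definition steps (r i k : nat) : nat :=
  nat_value (ell lam i k - ell (L r) i k).

(* Here t = 0 gives the leftmost factor C_r(-l_(ri)^(k) - 1) and the last t   *)
(* gives C_r(-l_i^(k)).                                                       *)
Definition P_elt (r i : nat) : W :=
  \prod_(1 <= k < (p i).+1) \prod_(t < steps r i k)
    C_at n p r (- ell (L r) i k - 1 - t%:R).

Definition zeta_pat (V : lmodType W) (zeta : V) : V :=
  (\prod_(1 <= i < n) \prod_(r <- rev (index_iota i n)) P_elt r i) *: zeta.

(* (x - l_i^(k)) (x - l_i^(k) + 1) ... (x - l_(ri)^(k) - 1) *)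
Definition string (x : K) (r i k : nat) : K :=
  \prod_(t < steps r i k) (x - ell lam i k + t%:R).

Definition N_pat : K :=
  \prod_(1 <= r < n) \prod_(1 <= i < r.+1)
    ((\prod_(1 <= j < i) \prod_(1 <= m < (p j).+1) \prod_(1 <= k < (p i).+1)
        string (ell lam j m) r i k) *
     (\prod_(i <= j < r) \prod_(1 <= m < (p j).+1) \prod_(1 <= k < (p i).+1)
        string (ell (L r.-1) j m) r i k)).

Definition xi_pat (V : lmodType W) (zeta : V) : V :=
  (N_pat^-1)%:A *: zeta_pat zeta.

(* xi_Lambda, understood as 0 when the array is not a pattern. *)
Definition xi_or0 (V : lmodType W) (zeta : V) : V :=
  if `[< GT_pattern lam L >] then xi_pat zeta else 0.

End Vectors.

(* Lambda with lambda_(ri)^(k) replaced by lambda_(ri)^(k) + c. *)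
Definition shift_entry (L : nat -> nat -> nat -> K) (r i k : nat) (c : K) :
  nat -> nat -> nat -> K :=
  fun r' i' k' =>
    if [&& r' == r, i' == i & k' == k] then L r i k + c else L r' i' k'.

End Patterns.

(* Main.v *)
(* On functions on the set of integer arrays let operators d, e, f act by the Gelfand-Tsetlin
   formulas: e_r(u) and f_r(u) have simple poles at the entries of the r-th row and move one entry,
   the coefficients are products of differences of entries of adjacent rows, and moves out of the
   set of patterns get coefficient 0.  This model satisfies the relations [d, f] and [e, f]; the
   only delicate case is the diagonal part of [e_r, f_r], which is the partial fraction expansion
   of d_r(u)^-1 d_(r+1)(u).  These relations alone determine how the d's and e's act on words in the
   f's applied to a highest vector, so the pairs (word applied to zeta, same word applied to the
   highest vector of the model) span a space stable under all generators; the Serre relations are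
   not needed.  If (v, 0) lies in this span, the submodule generated by v is a sum of such elements
   and, by a weight argument, does not contain zeta, so v = 0 by irreducibility.  Hence identities
   between vectors of L(lambda(u)) may be checked in the model, and so may the fact that the
   truncated series A, B, C act as polynomials on weight vectors.  The product that defines
   zeta_Lambda passes through patterns only, and each factor C_r contributes one factor of
   N_Lambda. *)

Require Import Defs.
From mathcomp Require Import all_boot all_order all_algebra.
From mathcomp Require Import boolp classical_sets reals complex finmap monalg.
From mathcomp Require Import ring zify.
Set Implicit Arguments.
Unset Strict Implicit.
Unset Printing Implicit Defensive.
Import Order.TTheory GRing.Theory Num.Theory.
Local Open Scope ring_scope.

(** * Expansions of rational functions at infinity *)

(** The pairs form a linear relation between [V] and functions on arrays, and it is shown to be
    single-valued in one direction only: a zero function forces a zero vector. So identities pass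
    from the model to [V], between pairs of equal depth, the number of f's applied. The residues of
    e_r(u) and f_r(u) are read off from the theorem itself. A simple zero of A_r(u) at u = -l
    cancels one pole of f_r(u - r + 1), so C_r(-l) isolates the move of one entry, with coefficient
    the residue times the product of the differences to the other entries of its row. Dividing the
    coefficient in the theorem by that product gives the residue; e_r(u) is treated alike. The poles
    of d_r(u)^-1 d_(r+1)(u) need not be simple before cancellation: two entries of a row may differ
    by 1. Interlacing then blocks both moves and supplies two zeros of the numerator, one from each
    neighbouring row. Fractions are expressed by degree bounds on polynomials, so that the
    truncation built into A, B and C is recognised as lossless. *)

Section SeriesOfFractions.
Variable K : fieldType.
Implicit Types (s t : nat -> K) (P Q R S : {poly K}).

(* The library states [size_mul] with the ring addition of nat, which [lia] does not recognise. *)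
Let size_mulF P Q : P != 0 -> Q != 0 -> size (P * Q)%R = (size P + size Q).-1%N.
Proof. exact: size_mul. Qed.

Let size_mul_leqF P Q : (size (P * Q)%R <= (size P + size Q).-1)%N.
Proof. exact: size_polyMleq. Qed.

Let size_divpF P Q : Q != 0 -> size (P %/ Q) = (size P - (size Q).-1)%N.
Proof. exact: size_divp. Qed.

Let size_polyXF : size ('X : {poly K}) = 2%N.
Proof. exact: size_polyX. Qed.

(* The polynomial part of u^N s(u), where s(u) = \sum_r s_r u^(-r). *)
Definition ser_trunc s N : {poly K} := \poly_(i < N.+1) s (N - i)%N.

(* s(u) is the expansion of Q(u) / P(u) in powers of 1/u. *)
Definition expands P s Q :=
  forall N, (size (P * ser_trunc s N - Q * 'X^N)%R < size P)%N.

Lemma coef_ser_trunc s N i :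
  (ser_trunc s N)`_i = if (i <= N)%N then s (N - i)%N else 0.
Proof. by rewrite coef_poly ltnS. Qed.

Lemma ser_truncS s N : ser_trunc s N.+1 = ser_trunc s N * 'X + (s N.+1)%:P.
Proof.
apply/polyP=> -[|i]; rewrite coefD coefMX coefC !coef_ser_trunc ?add0r //=.
by rewrite ltnS subSS addr0.
Qed.

Lemma ser_trunc0 s : ser_trunc s 0 = (s 0%N)%:P.
Proof. by apply/polyP => -[|i]; rewrite coef_ser_trunc coefC. Qed.

Lemma size_ser_trunc s N : (size (ser_trunc s N) <= N.+1)%N.
Proof. exact: size_poly. Qed.


(** A coefficient of degree at least N in the product of the truncations pairs terms whose indices
    sum to at most N, all of which survive the truncation. Only the degrees below N are
    corrupted. *)
Lemma ser_trunc_mul s t N :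
  (size (ser_trunc s N * ser_trunc t N - ser_trunc (ser_mul s t) N * 'X^N)%R <= N)%N.
Proof.
apply/leq_sizeP => j le_Nj; rewrite coefB coefMXn ltnNge le_Nj /= coef_ser_trunc.
apply/eqP; rewrite subr_eq0; apply/eqP; rewrite coefM.
rewrite -(big_mkord xpredT (fun i => (ser_trunc s N)`_i * (ser_trunc t N)`_(j - i))).
have [lt_j|le_j] := ltnP (N + N) j.
  rewrite leq_subLR leqNgt lt_j /= big1 // => i _; rewrite !coef_ser_trunc.
  have [le_i|_] := leqP i N; last by rewrite mul0r.
  by have [?|_] := leqP (j - i) N; rewrite ?mulr0 //; lia.
rewrite leq_subLR le_j /ser_mul.
rewrite -(big_mkord xpredT (fun r => s r * t (N - (j - N) - r)%N)).
rewrite (@big_cat_nat _ _ _ (j - N)) //=; try lia.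
rewrite [X in X + _]big1_seq ?add0r; last first.
  move=> i /=; rewrite mem_index_iota => /andP[_ lt_i]; rewrite [_`_(j - i)]coef_ser_trunc.
  by case: leqP; rewrite ?mulr0 //; lia.
rewrite (@big_cat_nat _ _ _ N.+1) //=; try lia.
rewrite [X in _ + X]big1_seq ?addr0; last first.
  move=> i /=; rewrite mem_index_iota => /andP[lt_i _]; rewrite coef_ser_trunc.
  by case: leqP; rewrite ?mul0r //; lia.
rewrite -{1}[(j - N)%N]add0n big_addn big_nat_rev /=.
have -> : (N.+1 - (j - N) = (N - (j - N)).+1)%N by lia.
apply: eq_big_nat => r lt_r; rewrite !coef_ser_trunc.
rewrite !ifT; try lia.
by congr (s _ * t _); lia.
Qed.

Lemma expands_size P s Q : expands P s Q -> (size Q <= size P)%N.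
Proof.
move/(_ 0%N); rewrite expr0 mulr1 ser_trunc0 mulrC mul_polyC => h.
have -> : Q = s 0%N *: P - (s 0%N *: P - Q) by ring.
rewrite (leq_trans (size_polyD _ _)) // size_polyN geq_max size_scale_leq.
exact: ltnW.
Qed.

Lemma expands_neq0 P s Q : expands P s Q -> P != 0.
Proof. by move/(_ 0%N); rewrite -size_poly_gt0; apply: leq_ltn_trans. Qed.

Lemma size_mul_lt P Q m n : (size P <= m)%N -> (0 < n)%N -> (size Q < n)%N ->
  (size (P * Q)%R < (m + n).-1)%N \/ P * Q = 0.
Proof.
move=> hP n0 hQ; have [->|P0] := eqVneq P 0; first by right; rewrite mul0r.
have [->|Q0] := eqVneq Q 0; first by right; rewrite mulr0.
left; rewrite size_mulF //; move: P0 Q0; rewrite -!size_poly_gt0. lia.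
Qed.

Lemma expandsM P s Q P' s' Q' : expands P s Q -> expands P' s' Q' ->
  expands (P * P') (ser_mul s s') (Q * Q').
Proof.
move=> h h' N; have P0 := expands_neq0 h; have P'0 := expands_neq0 h'.
have hQ' := expands_size h'; have {h}hN := h N; have {h'}hN' := h' N.
set D := _ - _; have [->|D0] := eqVneq D 0.
  by rewrite size_poly0 size_poly_gt0 mulf_neq0.
(* Multiplied by X^N, the error of the product splits into the errors of the two factors and the
   error of truncation, each of size below [size (P * P') + N]. *)
have eD : D * 'X^N = P * ser_trunc s N * (P' * ser_trunc s' N - Q' * 'X^N)
    + Q' * 'X^N * (P * ser_trunc s N - Q * 'X^N)
    - P * P' * (ser_trunc s N * ser_trunc s' N - ser_trunc (ser_mul s s') N * 'X^N).
  by rewrite /D; ring.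
suff : (size (D * 'X^N)%R < size (P * P')%R + N)%N.
  by rewrite size_mulXn // addnC ltn_add2r.
rewrite eD size_mulF //; move: (size_poly_gt0 P) (size_poly_gt0 P').
rewrite P0 P'0 => sP sP'.
have b1 : (size (P * ser_trunc s N)%R <= size P + N)%N.
  by rewrite (leq_trans (size_mul_leqF _ _)) //; have := size_ser_trunc s N; lia.
have b2 : (size (Q' * 'X^N)%R <= size P' + N)%N.
  by rewrite (leq_trans (size_mul_leqF _ _)) // size_polyXn; lia.
have b3 : (size (P * P')%R <= (size P + size P').-1)%N by exact: size_mul_leqF.
rewrite (leq_ltn_trans (size_polyD _ _)) // gtn_max size_polyN; apply/andP; split.
  rewrite (leq_ltn_trans (size_polyD _ _)) // gtn_max; apply/andP; split.
    by case: (size_mul_lt b1 sP' hN') => [/leq_trans|->]; [apply|rewrite size_poly0]; lia.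
  by case: (size_mul_lt b2 sP hN) => [/leq_trans|->]; [apply|rewrite size_poly0]; lia.
by case: (size_mul_lt b3 (ltn0Sn N) (ser_trunc_mul s s' N)) => [/leq_trans|->]; [apply|rewrite
  size_poly0]; lia.
Qed.

Lemma expands_cancel P s Q R : R != 0 -> expands (P * R) s (Q * R) -> expands P s Q.
Proof.
move=> R0 h N; have := h N; have := expands_neq0 h; rewrite mulf_eq0 negb_or => /andP[P0 _].
have -> : P * R * ser_trunc s N - Q * R * 'X^N = (P * ser_trunc s N - Q * 'X^N) * R by ring.
set D := _ - _; have [->|D0] := eqVneq D 0; first by rewrite size_poly0 size_poly_gt0.
rewrite !size_mulF //; move: D0 P0 R0; rewrite -!size_poly_gt0; lia.
Qed.

Lemma expands_mulr P s Q R : R != 0 -> expands P s Q -> expands (P * R) s (Q * R).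
Proof.
move=> R0 h N; have := h N; have P0 := expands_neq0 h.
have -> : P * R * ser_trunc s N - Q * R * 'X^N = (P * ser_trunc s N - Q * 'X^N) * R by ring.
set D := _ - _; have [->|D0] := eqVneq D 0; first by move=> _; rewrite mul0r size_poly0
  size_poly_gt0 mulf_neq0.
rewrite !size_mulF //; move: D0 P0 R0; rewrite -!size_poly_gt0; lia.
Qed.

Lemma expands_inj P s t Q : expands P s Q -> expands P t Q -> s =1 t.
Proof.
move=> hs ht N; have P0 := expands_neq0 hs.
suff /eqP : ser_trunc s N - ser_trunc t N = 0.
  rewrite subr_eq0 => /eqP/(congr1 (fun q : {poly K} => q`_0)).
  by rewrite !coef_ser_trunc /= subn0.
apply/eqP; apply: contraTT isT => D0.
have : (size (P * (ser_trunc s N - ser_trunc t N))%R < size P)%N.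
  have -> : P * (ser_trunc s N - ser_trunc t N) =
    (P * ser_trunc s N - Q * 'X^N) - (P * ser_trunc t N - Q * 'X^N) by ring.
  by rewrite (leq_ltn_trans (size_polyD _ _)) // gtn_max size_polyN hs ht.
rewrite size_mulF //; move: P0 D0; rewrite -!size_poly_gt0; lia.
Qed.

(** Euclidean division discards exactly the negative powers of u, so the constant term of this
    quotient is the coefficient of u^(-r) in Q / P. *)
Definition fraction_ser P Q : nat -> K := fun r => ((Q * 'X^r) %/ P)`_0.

Lemma fraction_serP P Q : P \is monic -> (size Q <= size P)%N ->
  expands P (fraction_ser P Q) Q.
Proof.
move=> mP sQ N; have P0 := monic_neq0 mP.
have -> : ser_trunc (fraction_ser P Q) N = (Q * 'X^N) %/ P.
  elim: N => [|N IH].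
    rewrite ser_trunc0 /fraction_ser expr0 mulr1; apply/esym/size1_polyC.
    rewrite size_divpF // leq_subLR; move: sQ P0; rewrite -size_poly_gt0; lia.
  rewrite ser_truncS IH /fraction_ser exprSr mulrA.
  set q : {poly K} := _ %/ P; set r : {poly K} := (Q * 'X^N) %% P.
  have e : Q * 'X^N = q * P + r by rewrite -divp_eq.
  have sr : (size r < size P)%N by rewrite ltn_modp.
  rewrite e.
  have -> : (q * P + r) * 'X = q * 'X * P + r * 'X by ring.
  rewrite divpD mulpK // coefD coefMX /= add0r; congr (_ + _).
  apply/esym/size1_polyC; rewrite size_divpF // leq_subLR.
  apply: leq_trans (size_mul_leqF _ _) _; rewrite size_polyXF. move: sr; lia.
rewrite -opprB size_polyN {1}(divp_eq (Q * 'X^N) P) mulrC addrC addKr.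
by rewrite ltn_modp.
Qed.

Lemma expands_one P : P != 0 -> expands P (@ser_one K) P.
Proof.
move=> P0 N; have -> : ser_trunc (@ser_one K) N = 'X^N.
  apply/polyP => i; rewrite coef_ser_trunc coefXn /ser_one subn_eq0.
  by case: (ltngtP i N).
by rewrite subrr size_poly0 size_poly_gt0.
Qed.

(** The expansion t of P / Q is a right inverse of s, because the fraction PQ / PQ expands to 1.
    Since s has constant term 1, a right inverse is determined recursively, so s' and t agree. *)
Lemma expands_inv P s s' Q : s 0%N = 1 -> (forall m, ser_mul s s' m = (m == 0%N)%:R) ->
  Q \is monic -> size P = size Q -> expands P s Q -> expands Q s' P.
Proof.
move=> s0 ss' mQ sPQ h; have P0 := expands_neq0 h.
have hq : expands Q (fraction_ser Q P) P by apply: fraction_serP; rewrite ?sPQ.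
suff e : s' =1 fraction_ser Q P.
  move=> N; suff -> : ser_trunc s' N = ser_trunc (fraction_ser Q P) N by exact: hq.
  by apply: eq_poly => i _; rewrite e.
set t := fraction_ser Q P in hq *.
have st : ser_mul s t =1 (fun m => (m == 0%N)%:R).
  apply: (@expands_inj (P * Q) _ _ (P * Q)); last exact/expands_one/mulf_neq0/monic_neq0.
  by rewrite {2}mulrC; apply: expandsM.
elim/ltn_ind => m IH; have := ss' m; rewrite -st /ser_mul !big_ord_recl /= !subn0 s0 !mul1r.
set a := bigop.body _ _ _; set b := bigop.body _ _ _.
suff -> : a = b by move/addIr.
by apply: eq_bigr => i _; rewrite IH // /bump; have := ltn_ord i; lia.
Qed.

(* Newton's formula u^N = sum_j 'C(N, j) c^(N-j) (u-c)^j. *)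
Lemma ser_trunc_shift (c : nat) s N :
  ser_trunc (ser_shift c s) N =
  \sum_(j < N.+1) ('C(N, j) * c ^ (N - j))%:R *: (ser_trunc s j \Po ('X - c%:R%:P)).
Proof.
elim: N => [|N IH].
  rewrite ser_trunc0 big_ord1 ser_trunc0 comp_polyC bin0 subnn expn0 scale1r.
  by rewrite /ser_shift big_ord1 bin0 expn0.
rewrite ser_truncS IH.
pose T j := ser_trunc s j \Po ('X - c%:R%:P).
have TS j : T j.+1 = T j * ('X - c%:R%:P) + (s j.+1)%:P.
  by rewrite /T ser_truncS comp_polyD comp_polyM comp_polyX comp_polyC.
rewrite -/(T _); under eq_bigr do rewrite -/(T _).
have eqR : \sum_(j < N.+2) ('C(N.+1, j) * c ^ (N.+1 - j))%:R *: T j =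
    c%:R *: (\sum_(j < N.+1) ('C(N, j) * c ^ (N - j))%:R *: T j)
    + \sum_(j < N.+1) ('C(N, j) * c ^ (N - j))%:R *: T j.+1.
  rewrite big_ord_recl /= bin0 mul1n subn0.
  under eq_bigr => i _ do rewrite /bump /= add1n binS subSS mulnDl natrD scalerDl.
  rewrite big_split /= addrA; congr (_ + _).
  rewrite big_ord_recr /= bin_small // mul0n scale0r addr0 scaler_sumr.
  rewrite [RHS]big_ord_recl /= bin0 mul1n subn0 scalerA -natrM -expnS; congr (_ + _).
  apply: eq_bigr => i _; rewrite /bump /= add1n scalerA -natrM mulnCA -expnS.
  by congr ((_ * c ^ _)%:R *: _); have := ltn_ord i; lia.
rewrite eqR scaler_sumr mulr_suml.
have -> : (ser_shift c s N.+1)%:P =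
    \sum_(j < N.+1) ('C(N, j) * c ^ (N - j))%:R *: (s j.+1)%:P.
  rewrite /ser_shift big_ord_recl /= bin_small // mul0n mulr0n add0r rmorph_sum /=.
  apply: eq_bigr => i _; rewrite /bump /= add1n subSS bin_sub; last by rewrite -ltnS.
  by rewrite scaler_nat rmorphMn.
rewrite -!big_split /=; apply: eq_bigr => j _.
by rewrite TS -!mul_polyC; ring.
Qed.

Lemma expands_shift (c : nat) P s Q : expands P s Q ->
  expands (P \Po ('X - c%:R%:P)) (ser_shift c s) (Q \Po ('X - c%:R%:P)).
Proof.
move=> h N; rewrite ser_trunc_shift.
have -> : (P \Po ('X - c%:R%:P)) * (\sum_(j < N.+1) ('C(N, j) * c ^ (N - j))%:R *:
      (ser_trunc s j \Po ('X - c%:R%:P))) - (Q \Po ('X - c%:R%:P)) * 'X^N =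
    \sum_(j < N.+1) ('C(N, j) * c ^ (N - j))%:R *:
      ((P * ser_trunc s j - Q * 'X^j) \Po ('X - c%:R%:P)).
  have -> : 'X^N = \sum_(j < N.+1) ('C(N, j) * c ^ (N - j))%:R *: ('X - c%:R%:P) ^+ j :> {poly K}.
    rewrite -{1}['X](subrK c%:R%:P) addrC exprDn; apply: eq_bigr => i _.
    by rewrite natrM natrX -mul_polyC rmorphM rmorphXn /= !rmorph_nat -mulr_natl mulrA.
  rewrite !mulr_sumr -sumrB; apply: eq_bigr => j _.
  rewrite comp_polyB !comp_polyM comp_Xn_poly scalerBr.
  by rewrite -!scalerAr.
have sP : size (P \Po ('X - c%:R%:P)) = size P.
  by rewrite size_comp_poly2 // size_XsubC.
rewrite sP; apply: (leq_ltn_trans (size_sum _ _ _)).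
have P0 : (0 < size P)%N by rewrite size_poly_gt0 (expands_neq0 h).
rewrite -(prednK P0) ltnS; apply/bigmax_leqP => j _.
rewrite (leq_trans (size_scale_leq _ _)) // size_comp_poly2 ?size_XsubC //.
by rewrite -ltnS prednK.
Qed.

(** The expansion of 1 / (u^k (u - x)); each move of one entry enters e_r(u) and f_r(u) through such
    a series. *)
Definition geom (k : nat) (x : K) : nat -> K :=
  fun r => if (r <= k)%N then 0 else x ^+ (r - k.+1).

Lemma expands_geom k x : expands ('X^k * ('X - x%:P)) (geom k x) 1.
Proof.
move=> N; rewrite mul1r.
have sP : size ('X^k * ('X - x%:P) : {poly K}) = k.+2.
  by rewrite size_monicM ?monicXn ?polyXsubC_eq0 // size_polyXn size_XsubC addn2.
rewrite sP.
elim: N => [|N IH].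
  rewrite ser_trunc0 /geom leq0n mulr0 sub0r size_polyN expr0 size_poly1; lia.
rewrite ser_truncS.
have [lt_Nk|le_kN] := ltnP N k.
  have e M : (M <= k)%N -> ser_trunc (geom k x) M = 0.
    move=> hM; apply/polyP => i; rewrite coef_ser_trunc coef0 /geom.
    by case: ifP => // _; rewrite ifT //; lia.
  by rewrite (e N (ltnW lt_Nk)) mul0r add0r /geom lt_Nk polyC0 mulr0 sub0r size_polyN size_polyXn;
    lia.
have e : 'X^k * ('X - x%:P) * ser_trunc (geom k x) N - 'X^N = - (x ^+ (N - k))%:P * 'X^k.
  rewrite -(subnK le_kN) addnK; move: (N - k)%N => M {IH le_kN}.
  elim: M => [|M IH].
    rewrite add0n (_ : ser_trunc _ _ = 0) ?mulr0 ?sub0r ?expr0 ?mulN1r //.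
    apply/polyP => i; rewrite coef_ser_trunc coef0 /geom; case: ifP => // _.
    by rewrite ifT //; lia.
  rewrite addSn ser_truncS exprSr (_ : geom k x _ = x ^+ M); last first.
    by rewrite /geom ifF ?subSS ?addnK //; apply/negbTE; rewrite -ltnNge; lia.
  rewrite mulrDr mulrA addrAC -mulrBl IH [x ^+ M.+1]exprSr polyCM; ring.
rewrite mulrDr mulrA addrAC [in X in _ - X]exprSr -mulrBl e.
have -> : geom k x N.+1 = x ^+ (N - k) by rewrite /geom ltnNge le_kN subSS.
have -> : - (x ^+ (N - k))%:P * 'X^k * 'X + 'X^k * ('X - x%:P) * (x ^+ (N - k))%:P =
  - (x * x ^+ (N - k)) *: 'X^k by rewrite -mul_polyC polyCN polyCM; ring.
by rewrite (leq_ltn_trans (size_scale_leq _ _)) // size_polyXn.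
Qed.

(** P(u) s(u) is exactly Q, so keeping only its nonnegative powers loses nothing. The left side has
    the shape of [poly_times_ser]. *)
Lemma expands_polypart P s Q : expands P s Q ->
  \poly_(m < size P) (\sum_(m <= k < size P) P`_k * s (k - m)%N) = Q.
Proof.
move=> h; apply/polyP => m; rewrite coef_poly.
case: ltnP => [lt_m|ge_m]; last first.
  by rewrite nth_default // (leq_trans (expands_size h)).
pose N := size P; have /leq_sizeP/(_ (N + m)%N (leq_addr _ _))/eqP := ltnW (h N).
rewrite coefB coefMXn ltnNge leq_addr /= addKn subr_eq0 => /eqP <-.
rewrite coefM -(big_mkord xpredT (fun i => P`_i * (ser_trunc s N)`_(N + m - i))).
rewrite [RHS](@big_cat_nat _ _ _ m) //=; try lia.
rewrite [X in _ = X + _]big1_seq ?add0r; last first.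
  move=> i /=; rewrite mem_index_iota coef_ser_trunc => /andP[_ lt_i].
  by case: leqP; rewrite ?mulr0 //; lia.
rewrite [RHS](@big_cat_nat _ _ _ N) //=; try (rewrite /N; lia).
rewrite [X in _ = _ + X]big1_seq ?addr0; last first.
  by move=> i /=; rewrite mem_index_iota => /andP[le_i _]; rewrite nth_default ?mul0r.
apply: eq_big_nat => k /andP[le_mk lt_kN]; rewrite coef_ser_trunc ifT; last by lia.
by rewrite -/N in lt_kN; congr (_ * s _); lia.
Qed.

Lemma expands_poly (p : nat) s Q : expands 'X^p s Q ->
  forall r, s r = if (r <= p)%N then Q`_(p - r) else 0.
Proof.
move=> h r; have := h r; rewrite size_polyXn ltnS => /leq_sizeP/(_ p (leqnn p))/eqP.
by rewrite coefB mulrC !coefMXn ltnn subnn coef_ser_trunc leq0n subn0 subr_eq0 ltnNge => /eqP->;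
  case: leqP.
Qed.

Lemma expands_sum (I : eqType) (r : seq I) (c : I -> K) P (s : I -> nat -> K) (Q : I -> {poly K}) :
  P != 0 -> (forall i, i \in r -> expands P (s i) (Q i)) ->
  expands P (fun m => \sum_(i <- r) c i * s i m) (\sum_(i <- r) c i *: Q i).
Proof.
move=> P0 h N; have -> : ser_trunc (fun m => \sum_(i <- r) c i * s i m) N =
    \sum_(i <- r) c i *: ser_trunc (s i) N.
  apply/polyP => m; rewrite coef_ser_trunc coef_sum.
  case: leqP => hm; last first.
    by rewrite big1 // => i _; rewrite coefZ coef_ser_trunc leqNgt hm mulr0.
  by apply: eq_bigr => i _; rewrite coefZ coef_ser_trunc hm.
have -> : P * (\sum_(i <- r) c i *: ser_trunc (s i) N) - (\sum_(i <- r) c i *: Q i) * 'X^N =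
    \sum_(i <- r) c i *: (P * ser_trunc (s i) N - Q i * 'X^N).
  rewrite mulr_sumr mulr_suml -sumrB; apply: eq_bigr => i _.
  by rewrite scalerBr scalerAr scalerAl.
apply: (leq_ltn_trans (size_sum _ _ _)).
rewrite -(prednK (n := size P)) ?size_poly_gt0 // ltnS; apply/bigmax_leqP_seq => i ri _.
rewrite (leq_trans (size_scale_leq _ _)) // -ltnS prednK ?size_poly_gt0 //.
exact: h.
Qed.

(* [q x] is the residue of Q / \prod_x (u - x) at x. *)
Lemma expands_residues (k : nat) (zs : seq K) s Q (q : K -> K) :
  uniq zs -> expands ('X^k * \prod_(z <- zs) ('X - z%:P)) s Q ->
  (forall z, z \in zs -> q z * \prod_(z' <- rem z zs) (z - z') = Q.[z]) ->
  forall e, s (e + k.+1)%N = \sum_(z <- zs) q z * z ^+ e.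
Proof.
move=> uz h hq e; pose D := \prod_(z <- zs) ('X - z%:P).
have D0 : D != 0 by apply: monic_neq0; apply: monic_prod_XsubC.
(* t is u^k s with its polynomial part removed. Its fraction R / D has deg R < deg D, hence is a sum
   of simple fractions. *)
pose t r := if r is r'.+1 then s (r' + k.+1)%N else 0.
have ser_trunc_t N : ser_trunc s (N + k) = 'X^N * ser_trunc s k + ser_trunc t N.
  elim: N => [|N IH]; first by rewrite add0n expr0 mul1r ser_trunc0 polyC0 addr0.
  by rewrite addSn !ser_truncS IH exprS /= addnS; ring.
have ht : expands D t (Q - D * ser_trunc s k).
  move=> N; have := h (N + k)%N; rewrite ser_trunc_t.
  have -> : 'X^k * D * ('X^N * ser_trunc s k + ser_trunc t N) - Q * 'X^(N + k) =
    (D * ser_trunc t N - (Q - D * ser_trunc s k) * 'X^N) * 'X^k by rewrite exprD; ring.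
  rewrite -/D; set E := _ - _; have [->|E0] := eqVneq E 0.
    by rewrite size_poly0 size_poly_gt0.
  by rewrite ['X^k * D]mulrC !size_mulXn // ltn_add2l.
set R := Q - _ in ht.
pose Dz z := \prod_(z' <- rem z zs) ('X - z'%:P).
have eD z : z \in zs -> D = ('X - z%:P) * Dz z.
  by move=> zin; rewrite /D (perm_big _ (perm_to_rem zin)) big_cons.
have ht' : expands D (fun m => \sum_(z <- zs) q z * geom 0 z m) (\sum_(z <- zs) q z *: Dz z).
  apply: expands_sum => // z zin; rewrite (eD _ zin) -[X in expands _ _ X]mul1r.
  apply: expands_mulr; first by apply: monic_neq0; apply: monic_prod_XsubC.
  by have := expands_geom 0 z; rewrite expr0 mul1r.
suff eR : R = \sum_(z <- zs) q z *: Dz z.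
  have := expands_inj ht (t := fun m => \sum_(z <- zs) q z * geom 0 z m).
  rewrite eR => /(_ ht' e.+1) /= ->; apply: eq_bigr => z _.
  by rewrite /geom subSS subn0.
(* Lagrange interpolation: both sides have degree below the number of points in [zs] and agree at
   each of them. *)
apply/eqP; rewrite -subr_eq0; apply/eqP; apply: (@roots_geq_poly_eq0 _ _ zs) => //.
  apply/allP => z zin; rewrite rootE /R !(hornerE, horner_sum) -hq //.
  have -> : D.[z] = 0 by apply/eqP; rewrite -/(root D z) root_prod_XsubC.
  rewrite mul0r subr0 (perm_big _ (perm_to_rem zin)) big_cons /= [X in _ - (_ + X)]big1_seq ?addr0.
    rewrite hornerZ horner_prod; rewrite subr_eq0; apply/eqP; congr (_ * _).
    by apply: eq_bigr => z' _; rewrite hornerXsubC.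
  move=> z' /= z'in; have z'zs := mem_rem z'in.
  rewrite hornerZ (_ : (Dz z').[z] = 0) ?mulr0 //; apply/eqP.
  rewrite -/(root _ _) root_prod_XsubC mem_rem_uniq // inE zin andbT.
  by apply: contraTneq z'in => ->; rewrite mem_rem_uniq // inE eqxx.
have sD : size D = (size zs).+1 by rewrite size_prod_XsubC.
rewrite -ltnS -sD (leq_ltn_trans (size_polyD _ _)) // size_polyN gtn_max; apply/andP; split.
  by have := ht 0%N; rewrite ser_trunc0 /= polyC0 mulr0 sub0r expr0 mulr1 size_polyN.
have := ht' 0%N; rewrite ser_trunc0 big1 => [|z _]; last by rewrite /geom mulr0.
by rewrite polyC0 mulr0 sub0r expr0 mulr1 size_polyN.
Qed.

End SeriesOfFractions.

Lemma ser_inv_recl (A : nzRingType) (s : nat -> A) m : s 0%N = 1 ->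
  ser_inv s m = (m == 0%N)%:R - \sum_(t < m) s t.+1 * ser_inv s (m - t.+1)%N.
Proof.
move=> s0; have := ser_invP m s0; rewrite big_ord_recl s0 mul1r subn0 => <-.
by rewrite addrK.
Qed.

Lemma ser_shift_low (A : nzRingType) c (s : nat -> A) q :
  (forall r, (r < q)%N -> s r = 0) -> ser_shift c s q = s q.
Proof.
move=> h; rewrite /ser_shift big_ord_recr /= subnn bin0 expn0 big1 ?add0r // => r _.
by rewrite h ?mul0rn.
Qed.

Lemma ser_shift_mulr (A : nzRingType) c (s : nat -> A) (x : A) q :
  ser_shift c (fun r => s r * x) q = ser_shift c s q * x.
Proof. by rewrite /ser_shift mulr_suml; apply: eq_bigr => r _; rewrite mulrnAl. Qed.

Lemma ser_shift_sum (A : nzRingType) c (I : Type) (r : seq I) (s : I -> nat -> A) q :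
  ser_shift c (fun t => \sum_(i <- r) s i t) q = \sum_(i <- r) ser_shift c (s i) q.
Proof.
rewrite /ser_shift exchange_big /=; apply: eq_bigr => t _; by rewrite sumrMnl.
Qed.

Lemma ser_shift_ext (A : nzRingType) c (s t : nat -> A) q :
  s =1 t -> ser_shift c s q = ser_shift c t q.
Proof. by move=> st; apply: eq_bigr => r _; rewrite st. Qed.

Lemma nat_value_nat (K : numFieldType) (m : nat) : nat_value (m%:R : K) = m.
Proof.
rewrite /nat_value; case: xgetP => [m' _ /= /eqP|/(_ m)]; last by move=> h; case: h.
by rewrite eqr_nat => /eqP.
Qed.

(** * The algebra W(pi) and its modules *)

(** Words grow by left multiplication, the form suited to showing that a subspace of a left module
    is stable ([act_closed]). *)
Lemma free_alg_ind (K : comNzRingType) (I : choiceType) (Q : free_alg K I -> Prop) :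
  Q 0 -> Q 1 -> (forall x y, Q x -> Q y -> Q (x + y)) ->
  (forall (c : K) x, Q x -> Q (c *: x)) ->
  (forall i x, Q x -> Q (free_gen K i * x)) -> forall x, Q x.
Proof.
move=> Q0 Q1 QD QZ QM x; rewrite [x]monalgE; apply: (big_ind Q) => // -[s] _.
set c := x@__; have -> : << c *g FMonom s >> = c *: (<< FMonom s >> : free_alg K I).
  by apply/malgP => k; rewrite mcoeffZ !mcoeffU mulr_natr.
apply: QZ; elim: s {c} => [|i s IH].
  by rewrite (_ : << FMonom [::] >> = 1) // -fmoneE.
rewrite (_ : << FMonom (i :: s) >> = free_gen K i * << FMonom s >>); first exact: QM.
apply/esym; apply: etrans (fgmulUU _ _ _ _) _; rewrite mulr1; congr << _ *g _ >>.
by apply/val_eqP; rewrite /= fmM fmU.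
Qed.

Section WRelations.
Variables (K : fieldType) (n : nat) (p : nat -> nat).
Local Notation W := (finite_W K n p).
Local Notation d := (d_ser K n p).
Local Notation e := (e_ser K n p).
Local Notation f := (f_ser K n p).
Local Notation toW := (@toW K n p).

Lemma toWB x y : toW (x - y) = toW x - toW y.
Proof. by rewrite /Defs.toW /toY !rmorphB. Qed.
Lemma toWD x y : toW (x + y) = toW x + toW y.
Proof. by rewrite /Defs.toW /toY !rmorphD. Qed.
Lemma toWN x : toW (- x) = - toW x.
Proof. by rewrite /Defs.toW /toY !rmorphN. Qed.
Lemma toWM x y : toW (x * y) = toW x * toW y.
Proof. by rewrite /Defs.toW /toY !rmorphM. Qed.
Lemma toW0 : toW 0 = 0.
Proof. by rewrite /Defs.toW /toY !rmorph0. Qed.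
Lemma toW1 : toW 1 = 1.
Proof. by rewrite /Defs.toW /toY !rmorph1. Qed.
Lemma toW_nat m : toW m%:R = m%:R.
Proof. by rewrite /Defs.toW /toY !rmorph_nat. Qed.
Lemma toWZ (c : K) x : toW (c *: x) = c *: toW x.
Proof. by rewrite /Defs.toW /toY !linearZ. Qed.
Lemma toW_sum (I : Type) (r : seq I) F : toW (\sum_(i <- r) F i) = \sum_(i <- r) toW (F i).
Proof. by rewrite (big_morph _ toWD toW0). Qed.

Lemma toW_lie x y : toW (lie x y) = toW x * toW y - toW y * toW x.
Proof. by rewrite /lie toWB toWM toWM. Qed.

Lemma toW_surj (w : W) : exists x, w = toW x.
Proof.
elim/quot_pi_ind: w => y; elim/quot_pi_ind: y => x; by exists x.
Qed.

Lemma d_ser0 i : d i 0 = 1.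
Proof. exact: toW1. Qed.

Lemma gen_elt_out g : ~~ gen_ok n p g -> gen_elt K n p g = 0.
Proof. by rewrite /gen_elt => h; rewrite insubN. Qed.

Lemma f_ser0 i : f i 0 = 0.
Proof. by rewrite /f_ser /f0 gen_elt_out ?toW0 //= /f_ok andbF. Qed.

Lemma e_ser_low i r : (r <= p i.+1 - p i)%N -> e i r = 0.
Proof.
move=> h; rewrite /e_ser /e0 gen_elt_out ?toW0 //= /e_ok negb_and; lia.
Qed.

Lemma toW_ser_inv s m : toW (ser_inv s m) = ser_inv (fun r => toW (s r)) m.
Proof.
have : forall fu m, toW (ser_inv_rec s fu m) = ser_inv_rec (fun r => toW (s r)) fu m.
  elim=> [|fu IH] m' /=; first by rewrite toWB toW_nat toW0.
  rewrite toWB toW_nat toW_sum; congr (_ - _); apply: eq_bigr => t _.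
  by rewrite toWM IH.
exact.
Qed.

Definition dinv i r : W := ser_inv (d i) r.

Lemma toW_dinv i r : toW (dinv0 K n p i r) = dinv i r.
Proof. exact: toW_ser_inv. Qed.

Lemma d_f i j r s : d_ok n i r -> f_ok n j s ->
  d i r * f j s = f j s * d i r +
  ((i == j.+1)%:R - (i == j)%:R) * \sum_(t < r) f j (r + s - t - 1) * d i t.
Proof.
move=> h1 h2; have := toW_yrel (yrel_df K p h1 h2).
rewrite toW_lie toWM toWB toW_nat toW_nat toW_sum.
move/eqP; rewrite subr_eq addrC => /eqP; rewrite /d_ser /f_ser => ->; congr (_ + _ * _).
by apply: eq_bigr => t _; rewrite toWM.
Qed.

Lemma d_e i j r s : d_ok n i r -> e_ok n p j s ->
  d i r * e j s = e j s * d i r +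
  ((i == j)%:R - (i == j.+1)%:R) * \sum_(t < r) d i t * e j (r + s - t - 1).
Proof.
move=> h1 h2; have := toW_yrel (yrel_de K h1 h2).
rewrite toW_lie toWM toWB toW_nat toW_nat toW_sum.
move/eqP; rewrite subr_eq addrC => /eqP; rewrite /d_ser /e_ser => ->; congr (_ + _ * _).
by apply: eq_bigr => t _; rewrite toWM.
Qed.

Lemma e_f i j r s : e_ok n p i r -> f_ok n j s ->
  e i r * f j s = f j s * e i r -
  (i == j)%:R * \sum_(t < r + s) dinv i t * d i.+1 (r + s - t - 1).
Proof.
move=> h1 h2; have := toW_yrel (yrel_ef K h1 h2).
rewrite toW_lie toWN toWM toW_nat toW_sum.
move/eqP; rewrite subr_eq addrC => /eqP; rewrite /e_ser /f_ser => ->; congr (_ - _ * _).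
by apply: eq_bigr => t _; rewrite toWM toW_dinv.
Qed.

End WRelations.

Section Module.
Variables (K : fieldType) (n : nat) (p : nat -> nat).
Local Notation W := (finite_W K n p).
Local Notation d := (d_ser K n p).
Local Notation e := (e_ser K n p).
Local Notation f := (f_ser K n p).
Variable V : lmodType W.
Implicit Types (v : V) (w : W) (c : K).

(** [V] comes only with its W-module structure; its K-linear structure is recovered from the central
    elements [c%:A]. *)
Definition kscale c v : V := (c%:A : W) *: v.
Local Notation "c **: v" := (kscale c v) (at level 40).

Lemma act_kscale w c v : w *: (c **: v) = c **: (w *: v).
Proof. by rewrite /kscale !scalerA mulr_algl mulr_algr. Qed.

Lemma scale_act w c v : (c *: w) *: v = c **: (w *: v).
Proof. by rewrite /kscale scalerA mulr_algl. Qed.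

Lemma kscaleA c c' v : c **: (c' **: v) = (c * c') **: v.
Proof. by rewrite /kscale scalerA mulr_algl scalerA. Qed.

Lemma kscaleDl c c' v : (c + c') **: v = c **: v + c' **: v.
Proof. by rewrite /kscale !scalerDl. Qed.

Lemma kscaleDr c v v' : c **: (v + v') = c **: v + c **: v'.
Proof. exact: scalerDr. Qed.

Lemma kscale1 v : 1 **: v = v.
Proof. by rewrite /kscale !scale1r. Qed.

Lemma kscale0 v : 0 **: v = 0.
Proof. by rewrite /kscale !scale0r. Qed.

Lemma kscaler0 c : c **: 0 = 0.
Proof. exact: scaler0. Qed.

Lemma kscaleNl c v : (- c) **: v = - (c **: v).
Proof. by rewrite /kscale !scaleNr. Qed.

Lemma kscale_eq0 c v : c != 0 -> c **: v = 0 -> v = 0.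
Proof. by move=> c0 h; rewrite -[v]kscale1 -(mulVf c0) -kscaleA h kscaler0. Qed.

Lemma act_closed (P : V -> Prop) :
  P 0 -> (forall v v', P v -> P v' -> P (v + v')) -> (forall c v, P v -> P (c **: v)) ->
  (forall i r v, d_ok n i r -> P v -> P (d i r *: v)) ->
  (forall i r v, f_ok n i r -> P v -> P (f i r *: v)) ->
  (forall i r v, e_ok n p i r -> P v -> P (e i r *: v)) ->
  forall w v, P v -> P (w *: v).
Proof.
move=> P0 PD PZ Pd Pf Pe w; have [x ->] := toW_surj w.
elim/free_alg_ind: x => [v _|v|x y IHx IHy v Pv|c x IH v Pv|[g hg] x IH v Pv].
- by rewrite toW0 scale0r.
- by rewrite toW1 scale1r.
- by rewrite toWD scalerDl; apply: PD; [apply: IHx|apply: IHy].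
- by rewrite toWZ scale_act; apply/PZ/IH.
have eg : free_gen K (YGen hg) = gen_elt K n p g by rewrite /gen_elt insubT.
rewrite toWM -scalerA eg; move/IH: Pv; case: g hg {eg} => i r hg Pv.
- have := Pd i r _ hg Pv; rewrite /d_ser /d0 ifF //.
  by move: hg => /= /andP[_]; case: (r).
- exact: Pf.
- exact: Pe.
Qed.

End Module.

(** * Arrays and patterns *)

Section Model.
Variables (K : numFieldType) (n : nat) (p : nat -> nat) (rho : nat -> K) (z : nat -> nat -> int).

Definition idx (r : nat) : seq (nat * nat) :=
  [seq (i, k) | i <- index_iota 1 r.+1, k <- index_iota 1 (p i).+1].

Lemma mem_idx r i k : ((i, k) \in idx r) = (1 <= i <= r)%N && (1 <= k <= p i)%N.
Proof.
apply/allpairsPdep/idP => [[i' [k' [hi hk [-> ->]]]]|/andP[hi hk]].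
  by move: hi hk; rewrite !mem_index_iota !ltnS => -> ->.
by exists i, k; rewrite !mem_index_iota !ltnS.
Qed.

Lemma uniq_idx r : uniq (idx r).
Proof.
apply: allpairs_uniq_dep => [|i _|[i k] [i' k'] _ _ [-> ->]] //; exact: iota_uniq.
Qed.

(* y r (i, k) stands for l_(ri)^(k) - rho k and z i k for l_i^(k) - rho k, where rho k = l_n^(k). *)
Definition array := nat -> nat * nat -> int.
Implicit Types (y : array) (a b : nat * nat).

Definition top_array : array := fun _ a => z a.1 a.2.

Definition nudge (c : int) r a y : array :=
  fun r' a' => y r' a' + (if (r' == r) && (a' == a) then c else 0).

Definition inner r a := (0 < r < n)%N && (a \in idx r).

(** The second interlacing condition is strict because l_(ri) contains the shift -i + 1. Entries
    that never move (row n and indices out of range) are frozen at [z], so that equality of patterns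
    is equality of functions. *)
Definition pattern y : bool := `[<
  [/\ forall r a, ~~ inner r a -> y r a = z a.1 a.2,
      forall r i k, inner r (i, k) -> y r (i, k) <= y r.+1 (i, k) &
      forall r i k, inner r (i, k) -> y r.+1 (i.+1, k) < y r (i, k)] >].

Lemma patternP y : reflect
  [/\ forall r a, ~~ inner r a -> y r a = z a.1 a.2,
      forall r i k, inner r (i, k) -> y r (i, k) <= y r.+1 (i, k) &
      forall r i k, inner r (i, k) -> y r.+1 (i.+1, k) < y r (i, k)] (pattern y).
Proof. exact: asboolP. Qed.

Lemma nudgeK c r a : cancel (nudge c r a) (nudge (- c) r a).
Proof.
move=> y; apply/funext => r'; apply/funext => a'; rewrite /nudge.
by case: ifP => _; rewrite ?addrK // !addr0.
Qed.

Lemma nudgeVK r a : cancel (nudge (- 1) r a) (nudge 1 r a).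
Proof. by move=> y; rewrite -{1}[1]opprK nudgeK. Qed.

Lemma nudgeC c r a d s b y : nudge c r a (nudge d s b y) = nudge d s b (nudge c r a y).
Proof. by apply/funext => r'; apply/funext => a'; rewrite /nudge addrAC. Qed.

Definition ell_ y r a : K := rho a.2 + (y r a)%:~R.

Lemma ell_nudge c r a y : ell_ (nudge c r a y) r a = ell_ y r a + c%:~R.
Proof. by rewrite /ell_ /nudge !eqxx rmorphD addrA. Qed.

Lemma ell_nudge_neq c r a y s b : (s, b) != (r, a) -> ell_ (nudge c r a y) s b = ell_ y s b.
Proof.
rewrite /ell_ /nudge xpair_eqE => /negPf->.
by rewrite addr0.
Qed.

Lemma ell_nudge_row c r a y s b : s != r -> ell_ (nudge c r a y) s b = ell_ y s b.
Proof. by move=> sr; rewrite ell_nudge_neq // xpair_eqE negb_and sr. Qed.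

Hypothesis p_mono : forall i, (1 <= i <= n.-1)%N -> (p i <= p i.+1)%N.
Hypothesis rho_generic : forall k m, (1 <= k <= p n)%N -> (1 <= m <= p n)%N -> k != m ->
  forall w : int, rho k - rho m != w%:~R.
Hypothesis z_decr : forall i k, (1 <= i <= n.-1)%N -> (1 <= k <= p i)%N -> z i.+1 k < z i k.

Lemma p_le i j : (1 <= i)%N -> (i <= j)%N -> (j <= n)%N -> (p i <= p j)%N.
Proof.
move=> i1 ij; rewrite -(subnKC ij); elim: (j - i)%N => [|m IH] h; first by rewrite addn0.
by rewrite addnS (leq_trans (IH _)) ?p_mono //; lia.
Qed.

Lemma pattern_top : pattern top_array.
Proof.
apply/patternP; split=> // r i k; rewrite /inner mem_idx /top_array /= => h.
by apply: z_decr; lia.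
Qed.

(** Neighbouring entries with the same upper index k are separated by an entry of the row above; in
    row n the decrease of [z] replaces that argument. *)
Lemma pattern_lt y r i j k : pattern y -> (r <= n)%N -> (1 <= i)%N -> (i < j)%N -> (j <= r)%N ->
  (1 <= k <= p i)%N -> y r (j, k) < y r (i, k).
Proof.
move=> /patternP[h0 h1 h2] rn i1 ij jr hk.
have step m : (i <= m)%N -> (m < r)%N -> y r (m.+1, k) < y r (m, k).
  move=> im mr; have hp := @p_le i m i1 im; have hk' : (1 <= k <= p m)%N by lia.
  have [rn'|rn'] := ltnP r n.
    have i1' : inner r (m, k) by rewrite /inner mem_idx; lia.
    have pm : (p m <= p m.+1)%N by apply: p_mono; lia.
    have i2' : inner r (m.+1, k) by rewrite /inner mem_idx; lia.
    exact: le_lt_trans (h1 _ _ _ i2') (h2 _ _ _ i1').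
  rewrite !h0 /inner ?ltnNge ?rn' ?andbF //=.
  by apply: z_decr; lia.
rewrite -(subnKC ij); move: (j - i.+1)%N (subnKC ij) => m e; rewrite -e in jr.
elim: m jr {e ij} => [|m IH] h; first by rewrite addn0 step //; lia.
by rewrite addnS; apply: lt_trans (IH _); [apply: step|]; lia.
Qed.

(* Entries with different upper indices k differ by non-integers. *)
Lemma ell_sub_int y y' r s a b (w : int) : a \in idx r -> b \in idx s -> (r <= n)%N -> (s <= n)%N ->
  ell_ y r a = ell_ y' s b + w%:~R -> a.2 = b.2 /\ y r a = y' s b + w.
Proof.
case: a b => [i k] [j m] /=; rewrite !mem_idx => ha hb hr hs; rewrite /ell_ /= => e.
have km : k = m.
  apply/eqP; apply: contraT => km; have := @p_le i n; have := @p_le j n.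
  move=> pj pi; have : (1 <= k <= p n)%N by lia.
  have : (1 <= m <= p n)%N by lia.
  move=> hm hk; have := rho_generic hk hm km (y' s (j, m) + w - y r (i, k)).
  rewrite rmorphB rmorphD /= => /eqP[]; apply/eqP; rewrite -subr_eq0; apply/eqP.
  transitivity (rho k + (y r (i, k))%:~R - (rho m + (y' s (j, m))%:~R + w%:~R)); first by ring.
  by rewrite e subrr.
split=> //; move: e; rewrite km -addrA => /addrI; rewrite -rmorphD => /eqP.
by rewrite eqr_int => /eqP.
Qed.

Lemma ell_inj y r a b : pattern y -> (r <= n)%N -> a \in idx r -> b \in idx r ->
  ell_ y r a = ell_ y r b -> a = b.
Proof.
move=> py rn ha hb e; have := @ell_sub_int y y r r a b 0 ha hb rn rn; rewrite !addr0.
case/(_ e); move: ha hb; case: a {e} => i k; case: b => j m /=.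
rewrite !mem_idx => /andP[ir kp] /andP[jr kp'] km e; rewrite -{m}km in kp' e *.
have [ij|ji|-> //] := ltngtP i j.
  by have : y r (j, k) < y r (i, k) by [apply: pattern_lt => //; lia]; rewrite e ltxx.
by have : y r (i, k) < y r (j, k) by [apply: pattern_lt => //; lia]; rewrite e ltxx.
Qed.

(** Lowering can break only the two inequalities in which the entry is the larger side; the one with
    row r - 1 exists only for i < r. *)
Lemma pattern_lower y r i k : pattern y -> inner r (i, k) ->
  pattern (nudge (- 1) r (i, k) y) =
  ((i < r)%N ==> (y r.-1 (i, k) < y r (i, k))) && (y r.+1 (i.+1, k) + 1 < y r (i, k)).
Proof.
move=> /patternP[h0 h1 h2] hin; have := hin; rewrite /inner mem_idx => hin'.
apply/patternP/andP => [[g0 g1 g2]|[g1 g2]].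
  split.
    apply/implyP => ir; have i' : inner r.-1 (i, k) by rewrite /inner mem_idx; lia.
    by have := g1 _ _ _ i'; rewrite /nudge prednK ?eqxx /=; [rewrite ifF; lia|lia].
  have := g2 _ _ _ hin; rewrite /nudge !eqxx /= ifF; lia.
split=> [s b hb|s j m hb|s j m hb]; have := hb; rewrite /inner ?mem_idx /nudge => hb'.
- rewrite ifF ?addr0 ?h0 //; apply: contraNF hb => /andP[/eqP-> /eqP->] //.
- have := h1 _ _ _ hb; rewrite !xpair_eqE.
  have [e1|] := eqVneq s r; have [e2|] := eqVneq s.+1 r; have [e3|] := eqVneq j i;
    have [e4|] := eqVneq m k; rewrite /= ?andbT ?andbF; try lia.
  by subst; move: g1; rewrite /= (_ : i < s.+1)%N //=; lia.
- have := h2 _ _ _ hb; rewrite !xpair_eqE.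
  have [e1|] := eqVneq s r; have [e2|] := eqVneq s.+1 r; have [e3|] := eqVneq j i;
    have [e4|] := eqVneq m k; have [e5|] := eqVneq j.+1 i; rewrite /= ?andbT ?andbF; try lia.
  by subst; lia.
Qed.

(** Raising can break only the two inequalities in which the entry is the smaller side. Column i - 1
    may be too short to contain the index k, whence the condition on [p i.-1]. *)
Lemma pattern_raise y r i k : pattern y -> inner r (i, k) ->
  pattern (nudge 1 r (i, k) y) =
  (y r (i, k) < y r.+1 (i, k)) &&
  ((1 < i)%N && (k <= p i.-1)%N ==> (y r (i, k) + 1 < y r.-1 (i.-1, k))).
Proof.
move=> /patternP[h0 h1 h2] hin; have := hin; rewrite /inner mem_idx => hin'.
apply/patternP/andP => [[g0 g1 g2]|[g1 g2]].
  split.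
    have := g1 _ _ _ hin; rewrite /nudge !eqxx /= ifF; lia.
  apply/implyP => ir; have i' : inner r.-1 (i.-1, k) by rewrite /inner mem_idx; lia.
  have := g2 _ _ _ i'; rewrite /nudge !prednK ?eqxx /=; try lia.
  by rewrite ifF; lia.
split=> [s b hb|s j m hb|s j m hb]; have := hb; rewrite /inner ?mem_idx /nudge => hb'.
- rewrite ifF ?addr0 ?h0 //; apply: contraNF hb => /andP[/eqP-> /eqP->] //.
- have := h1 _ _ _ hb; rewrite !xpair_eqE.
  have [e1|] := eqVneq s r; have [e2|] := eqVneq s.+1 r; have [e3|] := eqVneq j i;
    have [e4|] := eqVneq m k; rewrite /= ?andbT ?andbF; try lia.
  by subst; lia.
- have := h2 _ _ _ hb; rewrite !xpair_eqE.
  have [e1|] := eqVneq s r; have [e2|] := eqVneq s.+1 r; have [e3|] := eqVneq j i;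
    have [e4|] := eqVneq m k; have [e5|] := eqVneq j.+1 i; rewrite /= ?andbT ?andbF; try lia.
  by subst; move: g2 => /=; rewrite (_ : (_ && _) = true) /=; lia.
Qed.

(* Each of the interlacing inequalities is either strengthened or weakened by both moves. *)
Lemma pattern_square y r a s b : pattern y -> inner r a -> inner s b -> (r, a) != (s, b) ->
  pattern (nudge 1 s b (nudge (- 1) r a y)) ->
  pattern (nudge (- 1) r a y) /\ pattern (nudge 1 s b y).
Proof.
move=> /patternP[h0 h1 h2] ha hb ab /patternP[g0 g1 g2].
have key (v w : int) (v1 v2 w1 w2 : bool) (c : int) : ~~ (v1 && v2) -> ~~ (w1 && w2) ->
   ~~ (v1 && w1) -> ~~ (v2 && w2) -> v <= w + c ->
   v + (if v1 then - 1 else 0) + (if v2 then 1 else 0) <=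
   w + (if w1 then - 1 else 0) + (if w2 then 1 else 0) + c ->
   v + (if v1 then - 1 else 0) <= w + (if w1 then - 1 else 0) + c /\
   v + (if v2 then 1 else 0) <= w + (if w2 then 1 else 0) + c.
  by case: v1; case: v2; case: w1; case: w2 => //=; lia.
have neq s' b' : ~~ (((s' == r) && (b' == a)) && ((s' == s) && (b' == b))).
  by apply/negP => /andP[/andP[/eqP-> /eqP->] /andP[/eqP rs /eqP e]]; rewrite rs e eqxx in ab.
have neq2 (s1 s2 : nat) (b1 b2 : nat * nat) r' a' : s1 != s2 ->
    ~~ (((s1 == r') && (b1 == a')) && ((s2 == r') && (b2 == a'))).
  by apply: contra => /andP[/andP[/eqP-> _] /andP[/eqP-> _]].
have ss m : m != m.+1 by rewrite neq_ltn ltnSn.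
suff [H1 H2] : (forall r' i k, inner r' (i, k) ->
    nudge (- 1) r a y r' (i, k) <= nudge (- 1) r a y r'.+1 (i, k) /\
    nudge 1 s b y r' (i, k) <= nudge 1 s b y r'.+1 (i, k)) /\
  (forall r' i k, inner r' (i, k) ->
    nudge (- 1) r a y r'.+1 (i.+1, k) < nudge (- 1) r a y r' (i, k) /\
    nudge 1 s b y r'.+1 (i.+1, k) < nudge 1 s b y r' (i, k)).
  split; apply/patternP; split=> [r' a' ha'|r' i k ha'|r' i k ha'];
    try by [case: (H1 _ _ _ ha')|case: (H2 _ _ _ ha')];
    rewrite /nudge ifF ?addr0 ?h0 //; apply: contraNF ha' => /andP[/eqP-> /eqP->] //.
split=> r' i k ha'.
  have := h1 _ _ _ ha'; have := g1 _ _ _ ha'; rewrite /nudge => g h.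
  have := key (y r' (i, k)) (y r'.+1 (i, k)) _ _ _ _ 0 (neq r' (i, k)) (neq r'.+1 (i, k)) (neq2 _ _
    (i, k) (i, k) r a (ss r'))
    (neq2 _ _ (i, k) (i, k) s b (ss r')).
  by rewrite !addr0; apply.
have := h2 _ _ _ ha'; have := g2 _ _ _ ha'; rewrite /nudge => g h.
have lt1 (u v : int) : (u < v) = (u <= v + (- 1)) by lia.
rewrite lt1 in g; rewrite lt1 in h; rewrite !lt1.
have ss' m : m.+1 != m by rewrite eq_sym ss.
exact: key (neq r'.+1 (i.+1, k)) (neq r' (i, k)) (neq2 _ _ (i.+1, k) (i, k) r a (ss' r'))
    (neq2 _ _ (i.+1, k) (i, k) s b (ss' r')) h g.
Qed.

Lemma inner_ltn r a : inner r a -> (0 < r < n)%N. Proof. by case/andP. Qed.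
Lemma inner_idx r a : inner r a -> a \in idx r. Proof. by case/andP. Qed.

(** A blocked move makes an interlacing inequality tight, and the resulting equality is a zero of
    the numerator of d_r(u)^-1 d_(r+1)(u) at the pole of that move. *)
Lemma lower_blocked y r a : pattern y -> inner r a -> ~~ pattern (nudge (- 1) r a y) ->
  (exists2 b, b \in idx r.-1 & ell_ y r.-1 b = ell_ y r a) \/
  (exists2 c, c \in idx r.+1 & ell_ y r.+1 c + 1 = ell_ y r a).
Proof.
case: a => i k py hin; have := hin; rewrite /inner mem_idx => hin'.
rewrite pattern_lower // negb_and negb_imply; case/patternP: py => h0 h1 h2.
case/orP => [/andP[ir]|]; rewrite -leNgt => hle; [left; exists (i, k)|right; exists (i.+1, k)].
- by rewrite mem_idx; lia.
- have i' : inner r.-1 (i, k) by rewrite /inner mem_idx; lia.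
  have := h1 _ _ _ i'; rewrite prednK; last by lia.
  by move=> h; rewrite /ell_ /=; congr (_ + _%:~R); lia.
- by rewrite mem_idx; have := @p_mono i; lia.
- have := h2 _ _ _ hin => h; rewrite /ell_ /= -addrA; congr (_ + _).
  by rewrite -[1]/(1%:~R) -rmorphD /=; congr (_%:~R); lia.
Qed.

Lemma raise_blocked y r a : pattern y -> inner r a -> ~~ pattern (nudge 1 r a y) ->
  (exists2 b, b \in idx r.-1 & ell_ y r.-1 b = ell_ y r a + 1) \/
  (exists2 c, c \in idx r.+1 & ell_ y r.+1 c = ell_ y r a).
Proof.
case: a => i k py hin; have := hin; rewrite /inner mem_idx => hin'.
rewrite pattern_raise // negb_and negb_imply; case/patternP: py => h0 h1 h2.
case/orP => [|/andP[ir]]; rewrite -leNgt => hle; [right; exists (i, k)|left; exists (i.-1, k)].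
- by rewrite mem_idx; lia.
- have := h1 _ _ _ hin => h; rewrite /ell_ /=; congr (_ + _%:~R); lia.
- by rewrite mem_idx; lia.
- have i' : inner r.-1 (i.-1, k) by rewrite /inner mem_idx; lia.
  have := h2 _ _ _ i'; rewrite !prednK; try lia.
  move=> h; rewrite /ell_ /= -addrA; congr (_ + _).
  by rewrite -[1]/(1%:~R) -rmorphD /=; congr (_%:~R); lia.
Qed.

(** Genericity and strict decrease put the two entries in neighbouring columns with the same k.
    Interlacing leaves a single value for the entry of row r - 1 between them, and likewise for that
    of row r + 1, so the double pole they cause meets two zeros. *)
Lemma ell_succ y r a b : pattern y -> inner r a -> inner r b -> ell_ y r a = ell_ y r b + 1 ->
  [/\ ~~ pattern (nudge (- 1) r a y), ~~ pattern (nudge 1 r b y),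
      exists2 c, c \in idx r.-1 & ell_ y r.-1 c = ell_ y r a &
      exists2 c, c \in idx r.+1 & ell_ y r.+1 c + 1 = ell_ y r a].
Proof.
move=> py ha hb e; have rn := ltnW (proj2 (andP (inner_ltn ha))).
have := @ell_sub_int y y r r a b 1 (inner_idx ha) (inner_idx hb) rn rn e.
move: ha hb {e}; case: a => i k; case: b => j m /= ha hb [km e]; rewrite -{m}km in hb e *.
have := ha; have := hb; rewrite /inner !mem_idx => hb' ha'.
have ij : j = i.+1.
  have [lt_ij|lt_ji|//] := ltngtP j i.+1.
    have [ji|ij|e'] := ltngtP j i; [|lia|by move: e; rewrite e'; lia].
    by have := @pattern_lt y r j i k py rn; lia.
  have i1 := @pattern_lt y r i.+1 j k py rn; have := @pattern_lt y r i i.+1 k py rn.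
  have := @p_mono i; lia.
subst j; case/patternP: (py) => h0 h1 h2.
have i' : inner r.-1 (i, k) by rewrite /inner mem_idx; lia.
have := h1 _ _ _ i'; have := h2 _ _ _ i'; rewrite prednK; last by lia.
move=> e1 e2; have e3 := h1 _ _ _ hb; have e4 := h2 _ _ _ ha.
split.
- by rewrite pattern_lower //; lia.
- by rewrite pattern_raise //=; lia.
- exists (i, k); first by rewrite mem_idx; lia.
  by rewrite /ell_ /=; congr (_ + _%:~R); lia.
- exists (i.+1, k); first by rewrite mem_idx; lia.
  rewrite /ell_ /= -addrA; congr (_ + _).
  by rewrite -[1]/(1%:~R) -rmorphD /=; congr (_%:~R); lia.
Qed.

Implicit Types g : array -> K.

(** * The model *)

(** [alpha 0 y r] is the eigenvalue of A_r(u). The constant c shifts the argument; c = i - 1 undoes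
    the substitution u - i + 1 made in a_i(u). *)
Definition alpha (c : K) y r : {poly K} := \prod_(a <- idx r) ('X + (ell_ y r a + c)%:P).

Lemma alpha_monic c y r : alpha c y r \is monic.
Proof. by apply: monic_prod => a _; apply: monicXaddC. Qed.

Lemma alpha_neq0 c y r : alpha c y r != 0.
Proof. exact/monic_neq0/alpha_monic. Qed.

Lemma size_alpha c y r : size (alpha c y r) = (size (idx r)).+1.
Proof.
rewrite /alpha (eq_bigr (fun a => 'X - (- (ell_ y r a + c))%:P)); last first.
  by move=> a _; rewrite polyCN opprK.
by rewrite size_prod_XsubC.
Qed.

Lemma alpha_comp c d y r : alpha c y r \Po ('X - d%:P) = alpha (c - d) y r.
Proof.
rewrite /alpha rmorph_prod; apply: eq_bigr => a _.
by rewrite /= comp_polyD comp_polyX comp_polyC -addrA -polyCN -polyCD; congr (_ + _%:P); ring.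
Qed.

Lemma alpha_row c d r a y s : s != r -> alpha c (nudge d r a y) s = alpha c y s.
Proof. by move=> sr; apply: eq_bigr => b _; rewrite ell_nudge_row. Qed.

Lemma prod_nudge (R : comPzRingType) (F : K -> R) d r a y s : uniq s -> a \in s ->
  \prod_(b <- s) F (ell_ (nudge d r a y) r b) =
  F (ell_ y r a + d%:~R) * \prod_(b <- rem a s) F (ell_ y r b).
Proof.
move=> us ain; rewrite (perm_big _ (perm_to_rem ain)) big_cons ell_nudge; congr (_ * _).
rewrite big_seq [RHS]big_seq; apply: eq_bigr => b; rewrite mem_rem_uniq // inE => /andP[ba _].
by rewrite ell_nudge_neq // xpair_eqE negb_and ba orbT.
Qed.

Lemma alpha_nudge c d r a y : a \in idx r ->
  alpha c (nudge d r a y) r * ('X + (ell_ y r a + c)%:P) =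
  alpha c y r * ('X + (ell_ y r a + d%:~R + c)%:P).
Proof.
move=> ain; rewrite /alpha (prod_nudge (fun x => 'X + (x + c)%:P)) ?uniq_idx //.
rewrite [in RHS](perm_big _ (perm_to_rem ain)) big_cons /=; ring.
Qed.

Lemma idxS r : idx r.+1 = idx r ++ [seq (r.+1, k) | k <- index_iota 1 (p r.+1).+1].
Proof.
rewrite /idx; have -> : index_iota 1 r.+2 = rcons (index_iota 1 r.+1) r.+1.
  by rewrite /index_iota !subSS !subn0 -[in LHS](addn1 r) iotaD add1n cats1.
by rewrite map_rcons flatten_rcons.
Qed.

Lemma size_idxS r : size (idx r.+1) = (size (idx r) + p r.+1)%N.
Proof. by rewrite idxS size_cat size_map size_iota subn1. Qed.

(* The eigenvalue of d_i(u) on the vector indexed by y. *)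
Definition d_eigen y i : nat -> K :=
  fraction_ser ('X^(p i) * alpha (i.-1)%:R y i.-1) (alpha (i.-1)%:R y i).

Lemma size_d_eigen_den y i : (0 < i)%N ->
  size ('X^(p i) * alpha (i.-1)%:R y i.-1) = size (alpha (i.-1)%:R y i).
Proof.
by case: i => // i _ /=; rewrite mulrC size_mulXn ?alpha_neq0 // !size_alpha size_idxS; lia.
Qed.

Lemma d_eigen_den_monic y i : 'X^(p i) * alpha (i.-1)%:R y i.-1 \is monic.
Proof. by rewrite monicMl ?monicXn // alpha_monic. Qed.

Lemma d_eigenP y i : (0 < i)%N ->
  expands ('X^(p i) * alpha (i.-1)%:R y i.-1) (d_eigen y i) (alpha (i.-1)%:R y i).
Proof. by move=> i0; apply: fraction_serP; rewrite ?d_eigen_den_monic // size_d_eigen_den. Qed.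

Lemma expands_lead (P Q : {poly K}) s : P \is monic -> Q \is monic -> size P = size Q ->
  expands P s Q -> s 0%N = 1.
Proof.
move=> mP mQ sPQ /(_ 0%N); rewrite ser_trunc0 expr0 mulr1 mulrC mul_polyC => h.
have P0 : (0 < size P)%N by rewrite size_poly_gt0 monic_neq0.
have /leq_sizeP/(_ (size P).-1) : (size (s 0%N *: P - Q)%R <= (size P).-1)%N by rewrite -ltnS
  prednK.
rewrite leqnn => /(_ isT)/eqP; rewrite coefB coefZ {2}sPQ -!lead_coefE.
by rewrite (eqP mP) (eqP mQ) mulr1 subr_eq0 => /eqP.
Qed.

Lemma d_eigen0 y i : (0 < i)%N -> d_eigen y i 0 = 1.
Proof.
by move=> i0; apply: expands_lead (d_eigenP y i0); rewrite ?d_eigen_den_monic ?alpha_monic //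
  size_d_eigen_den.
Qed.

(** The root of [alpha (r.-1)%:R y r] belonging to the entry a. The substitution of u - r + 1 for u
    turns it into -l, the point at which B_r and C_r are evaluated. *)
Definition pole y r a : K := 1 - r%:R - ell_ y r a.

Lemma pole_nudge d r a y : pole (nudge d r a y) r a = pole y r a - d%:~R.
Proof. by rewrite /pole ell_nudge; ring. Qed.

Lemma pole_nudge_neq d r a y s b : (s, b) != (r, a) -> pole (nudge d r a y) s b = pole y s b.
Proof. by move=> h; rewrite /pole ell_nudge_neq. Qed.

(** This is (u - x + e) / (u - x) = 1 + e / (u - x), the factor by which lowering one entry changes
    an eigenvalue of some d_i(u), with e = -1 or e = 1. *)
Lemma expands_add_geom (e x : K) :
  expands ('X - x%:P) (fun m => @ser_one K m + e * geom 0 x m) ('X - x%:P + e%:P).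
Proof.
have X0 : 'X - x%:P != 0 :> {poly K} by rewrite polyXsubC_eq0.
move=> N; have hg := expands_geom 0 x N; rewrite expr0 !mul1r in hg.
have h1 := expands_one X0 N; have -> : ser_trunc (fun m => @ser_one K m + e * geom 0 x m) N =
    ser_trunc (@ser_one K) N + e%:P * ser_trunc (geom 0 x) N.
  apply/polyP => m; rewrite coefD coefCM !coef_ser_trunc.
  by case: ifP => _; rewrite ?mulr0 ?addr0.
set s1 := ser_trunc _ N in h1 *; set s2 := ser_trunc _ N in hg *.
have -> : ('X - x%:P) * (s1 + e%:P * s2) - ('X - x%:P + e%:P) * 'X^N =
  (('X - x%:P) * s1 - ('X - x%:P) * 'X^N) + e *: (('X - x%:P) * s2 - 'X^N).
  by rewrite -mul_polyC; ring.
rewrite (leq_ltn_trans (size_polyD _ _)) // gtn_max h1 /=.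
by rewrite (leq_ltn_trans (size_scale_leq _ _)).
Qed.

Lemma d_eigen_nudge_row d r a y i : i != r -> i.-1 != r -> d_eigen (nudge d r a y) i = d_eigen y i.
Proof. by move=> h1 h2; rewrite /d_eigen !alpha_row. Qed.

(** With x the pole, the entry gives the factor u - x in the numerator of d_i(u), which becomes u -
    x - 1. In [d_eigen_lower_next] it gives the factor u - x + 1 in the denominator of d_(i+1)(u),
    which becomes u - x. *)
Lemma d_eigen_lower_diag y i a : (0 < i)%N -> a \in idx i ->
  d_eigen (nudge (- 1) i a y) i =1
  ser_mul (d_eigen y i) (fun m => @ser_one K m + (- 1) * geom 0 (pole y i a) m).
Proof.
move=> i0 ha; have hX := expandsM (d_eigenP y i0) (expands_add_geom (- 1) (pole y i a)).
apply: (@expands_inj _ ('X^(p i) * alpha (i.-1)%:R y i.-1) _ _ (alpha (i.-1)%:R (nudge (- 1) i a y)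
  i)).
  have := @d_eigenP (nudge (- 1) i a y) i i0; rewrite [alpha _ _ i.-1]alpha_row //; lia.
have X0 : 'X - (pole y i a)%:P != 0 by rewrite polyXsubC_eq0.
apply: (expands_cancel X0).
have e : ('X + (ell_ y i a + (i.-1)%:R)%:P) = 'X - (pole y i a)%:P.
  rewrite -polyCN; congr (_ + _%:P); rewrite /pole -[in i%:R](prednK i0) -natr1; ring.
rewrite -{2}e alpha_nudge //.
have -> : 'X + (ell_ y i a + (- 1)%:~R + (i.-1)%:R)%:P = 'X - (pole y i a)%:P + (- 1)%:P.
  by rewrite -e -[RHS]addrA -polyCD; congr (_ + _%:P); ring.
exact: hX.
Qed.

Lemma d_eigen_lower_next y i a : a \in idx i ->
  d_eigen (nudge (- 1) i a y) i.+1 =1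
  ser_mul (d_eigen y i.+1) (fun m => @ser_one K m + 1 * geom 0 (pole y i a) m).
Proof.
move=> ha; have hX := expandsM (d_eigenP y (ltn0Sn i)) (expands_add_geom 1 (pole y i a)).
apply: (@expands_inj _ ('X^(p i.+1) * alpha i%:R (nudge (- 1) i a y) i) _ _ (alpha i%:R y i.+1)).
  by have := @d_eigenP (nudge (- 1) i a y) i.+1 (ltn0Sn i); rewrite /= [alpha _ _ i.+1]alpha_row
    //; lia.
have X0 : 'X - (pole y i a)%:P + 1%:P != 0.
  by rewrite -addrA -polyCN -polyCD -[_ + 1]opprK polyCN polyXsubC_eq0.
apply: (expands_cancel X0).
have e : 'X + (ell_ y i a + i%:R)%:P = 'X - (pole y i a)%:P + 1%:P.
  by rewrite -polyCN -[RHS]addrA -polyCD; congr (_ + _%:P); rewrite /pole; ring.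
rewrite -{1}e -mulrA alpha_nudge //.
have -> : 'X + (ell_ y i a + (- 1)%:~R + i%:R)%:P = 'X - (pole y i a)%:P.
  by rewrite -polyCN; congr (_ + _%:P); rewrite /pole; ring.
by rewrite mulrA.
Qed.

(** The coefficient of C_r(-l) in the theorem divided by the value of A_r(u) / (u + l) at u = -l.
    The coefficient of B_r(-l), sign included, gives [cE_val] in the same way. *)
Definition cF_val y r a : K :=
  \prod_(b <- idx r.-1) (ell_ y r.-1 b - ell_ y r a) /
  \prod_(c <- rem a (idx r)) (ell_ y r c - ell_ y r a).

Definition cE_val y r a : K :=
  - \prod_(b <- idx r.+1) (ell_ y r.+1 b - ell_ y r a) /
  \prod_(c <- rem a (idx r)) (ell_ y r c - ell_ y r a).

(* Moves that leave the set of patterns get the coefficient 0; their denominators may vanish. *)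
Definition cF y r a : K := if pattern y && pattern (nudge (- 1) r a y) then cF_val y r a else 0.
Definition cE y r a : K := if pattern y && pattern (nudge 1 r a y) then cE_val y r a else 0.

Lemma cF_val_far c s b y r a : (0 < r)%N -> s != r -> s != r.-1 ->
  cF_val (nudge c s b y) r a = cF_val y r a.
Proof.
move=> r0 h1 h2; rewrite /cF_val; congr (_ / _).
  by apply: eq_bigr => b' _; rewrite !ell_nudge_row // eq_sym.
by apply: eq_bigr => b' _; rewrite !ell_nudge_row // eq_sym.
Qed.

Lemma cE_val_far c s b y r a : s != r -> s != r.+1 ->
  cE_val (nudge c s b y) r a = cE_val y r a.
Proof.
move=> h1 h2; rewrite /cE_val; congr (- _ / _).
  by apply: eq_bigr => b' _; rewrite !ell_nudge_row // eq_sym.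
by apply: eq_bigr => b' _; rewrite !ell_nudge_row // eq_sym.
Qed.

Lemma rem_rem (T : eqType) (x y : T) (s : seq T) : uniq s -> rem x (rem y s) = rem y (rem x s).
Proof.
move=> us; rewrite !rem_filter ?filter_uniq // -!filter_predI.
by apply: eq_filter => u /=; rewrite andbC.
Qed.

(** A raise in row s involves rows s and s + 1, a lowering in row r involves rows r - 1 and r, so
    they interact only for s = r and s = r - 1. In both cases either order of the moves produces the
    same product of the difference of the two entries and its shift by one, up to two changes of
    sign; for s = r this product is in the denominator. *)
Lemma cEcF_comm_val y r a s b : inner r a -> inner s b -> (s, b) != (r, a) ->
  cE_val (nudge (- 1) r a y) s b * cF_val y r a = cF_val (nudge 1 s b y) r a * cE_val y s b.
Proof.
move=> ha hb ab; have r0 : (0 < r)%N by case/andP: (inner_ltn ha).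
have [e|sr] := eqVneq s r.
  subst s; have ba : b != a by move: ab; rewrite xpair_eqE eqxx.
  have [ua ub] : uniq (rem a (idx r)) /\ uniq (rem b (idx r)) by rewrite !rem_uniq // uniq_idx.
  rewrite /cE_val /cF_val.
  have -> : \prod_(b0 <- idx r.+1) (ell_ (nudge (-1) r a y) r.+1 b0 - ell_ (nudge (-1) r a y) r b) =
     \prod_(b0 <- idx r.+1) (ell_ y r.+1 b0 - ell_ y r b).
    by apply: eq_bigr => c _; rewrite !ell_nudge_neq // xpair_eqE; lia.
  have -> : \prod_(b0 <- idx r.-1) (ell_ (nudge 1 r b y) r.-1 b0 - ell_ (nudge 1 r b y) r a) =
     \prod_(b0 <- idx r.-1) (ell_ y r.-1 b0 - ell_ y r a).
    apply: eq_bigr => c _; rewrite !ell_nudge_neq // ?xpair_eqE //; first by rewrite eqxx eq_sym.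
    by rewrite negb_and; lia.
  rewrite [ell_ (nudge (- 1) r a y) r b]ell_nudge_neq // [ell_ (nudge 1 r b y) r a]ell_nudge_neq
    1?eq_sym //.
  rewrite (prod_nudge (fun x => x - ell_ y r b)) ?mem_rem_uniq ?uniq_idx // ?inE ?(eq_sym a) ?ba
    ?(inner_idx ha) ?(inner_idx hb) //.
  rewrite (prod_nudge (fun x => x - ell_ y r a)) ?mem_rem_uniq ?uniq_idx // ?inE ?ba ?(inner_idx
    ha) ?(inner_idx hb) //.
  rewrite [\prod_(c <- rem a (idx r)) (ell_ y r c - _)](perm_big _ (perm_to_rem (x := b) _))
    ?big_cons /=;
    last by rewrite mem_rem_uniq ?uniq_idx // inE ba ?(inner_idx ha) ?(inner_idx hb).
  rewrite [\prod_(c <- rem b (idx r)) (ell_ y r c - _)](perm_big _ (perm_to_rem (x := a) _))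
    ?big_cons /=;
    last by rewrite mem_rem_uniq ?uniq_idx // inE eq_sym ba ?(inner_idx ha) ?(inner_idx hb).
  rewrite (rem_rem a b) ?uniq_idx //.
  have -> : ell_ y r b + 1%:~R - ell_ y r a = - (ell_ y r a + (-1)%:~R - ell_ y r b) by ring.
  have -> : ell_ y r a - ell_ y r b = - (ell_ y r b - ell_ y r a) by ring.
  rewrite !invfM !invrN; ring.
have [e|sr1] := eqVneq s r.-1.
  have {}e : r = s.+1 by lia.
  subst r; rewrite /cE_val /cF_val /=.
  have -> : \prod_(c <- rem b (idx s)) (ell_ (nudge (- 1) s.+1 a y) s c - ell_ (nudge (- 1) s.+1 a
    y) s b) =
     \prod_(c <- rem b (idx s)) (ell_ y s c - ell_ y s b).
    by apply: eq_bigr => c _; rewrite !ell_nudge_row //; lia.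
  have -> : \prod_(c <- rem a (idx s.+1)) (ell_ (nudge 1 s b y) s.+1 c - ell_ (nudge 1 s b y) s.+1
    a) =
     \prod_(c <- rem a (idx s.+1)) (ell_ y s.+1 c - ell_ y s.+1 a).
    by apply: eq_bigr => c _; rewrite !ell_nudge_row //; lia.
  rewrite [ell_ (nudge (- 1) s.+1 a y) s b]ell_nudge_row; last by lia.
  rewrite [ell_ (nudge 1 s b y) s.+1 a]ell_nudge_row; last by lia.
  rewrite (prod_nudge (fun x => x - ell_ y s b)) ?uniq_idx ?(inner_idx ha) ?(inner_idx hb) //.
  rewrite (prod_nudge (fun x => x - ell_ y s.+1 a)) ?uniq_idx ?(inner_idx ha) ?(inner_idx hb) //.
  rewrite [\prod_(c <- idx s.+1) _](perm_big _ (perm_to_rem (inner_idx ha))) big_cons.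
  rewrite [\prod_(c <- idx s) _](perm_big _ (perm_to_rem (inner_idx hb))) big_cons /=.
  ring.
have [e|rs1] := eqVneq r s.+1; first by move: sr1; rewrite e eqxx.
have rs : r != s by rewrite eq_sym.
by rewrite (cE_val_far _ _ _ _ rs rs1) (cF_val_far _ _ _ _ r0 sr sr1) mulrC.
Qed.

Lemma cEcF_comm y r a s b : inner r a -> inner s b -> (s, b) != (r, a) ->
  cE (nudge (- 1) r a y) s b * cF y r a = cF (nudge 1 s b y) r a * cE y s b.
Proof.
move=> ha hb ab; rewrite /cE /cF [nudge (- 1) r a (nudge 1 s b y)]nudgeC.
have [py|_] := boolP (pattern y); last by rewrite /= !mulr0.
have [pt|_] := boolP (pattern (nudge 1 s b (nudge (- 1) r a y))); last by rewrite !andbF mul0r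
  mul0r.
have ab' : (r, a) != (s, b) by rewrite eq_sym.
(* If the array after both moves is a pattern, so are both intermediate arrays; hence the cut-off to
   0 agrees in the two orders. *)
have [-> ->] := pattern_square py ha hb ab' pt.
by rewrite /= cEcF_comm_val.
Qed.

(** * The diagonal part of [e_r, f_r] *)

Definition shift_gap r := (p r.+1 - p r)%N.

(** The eigenvalue of d_r(u)^-1 d_(r+1)(u), whose coefficients form the right side of the relation
    [e_r, f_r]. *)
Definition h_eigen y r := ser_mul (ser_inv (d_eigen y r)) (d_eigen y r.+1).

Lemma d_eigen_inv y r : (0 < r)%N ->
  expands (alpha (r.-1)%:R y r) (ser_inv (d_eigen y r)) ('X^(p r) * alpha (r.-1)%:R y r.-1).
Proof.
move=> r0; apply: expands_inv (d_eigenP y r0); first exact: d_eigen0.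
- by move=> m; apply: ser_invP; apply: d_eigen0.
- exact: alpha_monic.
- exact: size_d_eigen_den.
Qed.

Lemma h_eigenP y r : (0 < r < n)%N ->
  expands ('X^(shift_gap r) * (alpha (r.-1)%:R y r * alpha r%:R y r)) (h_eigen y r)
    (alpha (r.-1)%:R y r.-1 * alpha r%:R y r.+1).
Proof.
move=> hr; have [r0 _] := andP hr; have h := expandsM (d_eigen_inv y r0) (d_eigenP y (ltn0Sn r)).
have X0 : 'X^(p r) != 0 :> {poly K} by rewrite monic_neq0 ?monicXn.
apply: (expands_cancel X0).
have -> : 'X^(shift_gap r) * (alpha (r.-1)%:R y r * alpha r%:R y r) * 'X^(p r) =
    alpha (r.-1)%:R y r * ('X^(p r.+1) * alpha r%:R y r).
  have -> : p r.+1 = (shift_gap r + p r)%N by rewrite subnK // p_mono //; lia.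
  rewrite exprD; ring.
by rewrite [_ * 'X^_]mulrC [X in expands _ _ X]mulrA; exact: h.
Qed.

Lemma alpha_pole y r : (0 < r)%N ->
  alpha (r.-1)%:R y r = \prod_(x <- [seq pole y r a | a <- idx r]) ('X - x%:P).
Proof.
case: r => // r _; rewrite big_map; apply: eq_bigr => a _.
by rewrite -polyCN; congr (_ + _%:P); rewrite /pole /=; ring.
Qed.

Lemma alpha_pole1 y r :
  alpha r%:R y r = \prod_(x <- [seq pole y r a - 1 | a <- idx r]) ('X - x%:P).
Proof.
rewrite big_map; apply: eq_bigr => a _.
by rewrite -polyCN; congr (_ + _%:P); rewrite /pole /=; ring.
Qed.

Lemma prod_rem_perm (T : eqType) (R : comPzRingType) (F : T -> R) (x : T) s s' :
  perm_eq s (x :: s') -> \prod_(u <- rem x s) F u = \prod_(u <- s') F u.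
Proof.
move=> h; apply: perm_big; rewrite -(perm_cons x); apply: (perm_trans _ (h)).
by rewrite perm_sym perm_to_rem // (perm_mem h) mem_head.
Qed.

(* The partial fraction expansion of d_r(u)^-1 d_(r+1)(u); its poles that correspond to moves out of
   the set of patterns are cancelled by zeros of the numerator. *)
Lemma ef_diag y r e : pattern y -> (0 < r < n)%N ->
  \sum_(a <- idx r) pole y r a ^+ e * (cE (nudge (- 1) r a y) r a * cF y r a)
  - \sum_(a <- idx r) (pole y r a - 1) ^+ e * (cF (nudge 1 r a y) r a * cE y r a)
  = - h_eigen y r (e + (shift_gap r).+1).
Proof.
move=> py hr; have [r0 rn] := andP hr.
have inr a : a \in idx r -> inner r a by rewrite /inner hr.
have rle : (r <= n)%N by exact: ltnW.
pose I := idx r; pose gL a := pattern (nudge (- 1) r a y); pose gR a := pattern (nudge 1 r a y).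
pose P0 := pole y r; pose P1 a := pole y r a - 1.
have P0inj : {in I &, injective P0}.
  move=> a b ha hb; rewrite /P0 /pole => /addrI/oppr_inj.
  exact: (ell_inj py rle).
have P1inj : {in I &, injective P1} by move=> a b ha hb /addIr; apply: P0inj.
(* A pole of one family meets one of the other only if two entries differ by 1; both moves are then
   blocked, so the poles of allowed moves are simple. *)
have P01 a b : a \in I -> b \in I -> P0 a = P1 b -> ~~ gL a /\ ~~ gR b.
  move=> ha hb e0; have e1 : ell_ y r a = ell_ y r b + 1.
    transitivity (1 - r%:R - P0 a); first by rewrite /P0 /pole; ring.
    by rewrite e0 /P1 /pole; ring.
  by case: (ell_succ py (inr _ ha) (inr _ hb) e1).
(* [bs] lists the poles of blocked moves, [zs] those of allowed moves, and [tt] the zeros of the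
   numerator. *)
pose bs := [seq P0 a | a <- I & ~~ gL a] ++ [seq P1 a | a <- I & ~~ gR a].
pose zs := [seq P0 a | a <- I & gL a] ++ [seq P1 a | a <- I & gR a].
pose tt := [seq 1 - r%:R - ell_ y r.-1 b | b <- idx r.-1] ++ [seq - r%:R - ell_ y r.+1 c | c <- idx
  r.+1].
have uI : uniq I by exact: uniq_idx.
have subI (q : pred (nat * nat)) a : a \in [seq a <- I | q a] -> a \in I by rewrite mem_filter =>
  /andP[].
have umapF (f : nat * nat -> K) (q : pred (nat * nat)) : {in I &, injective f} -> uniq [seq f a | a
  <- I & q a].
  move=> fi; rewrite map_inj_in_uniq ?filter_uniq // => a b /subI ha /subI hb; exact: fi.
(* [bs] is contained in [tt] with multiplicities. Each half of [bs] is free of repetitions, so a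
   multiplicity is at most 2; when it is 2, [ell_succ] finds one zero in each half of [tt]. *)
have [t0 ht] : {t0 | perm_eq tt (bs ++ t0)}.
  suff /count_subseqP/cid2[s /perm_to_subseq[t0 h1] h2] : forall x, (count_mem x bs <= count_mem x
    tt)%N.
    by exists t0; apply: perm_trans h1 _; rewrite perm_cat2r perm_sym.
  have mem_count (x : K) s : x \in s -> (0 < count_mem x s)%N by rewrite -has_count has_pred1.
  move=> x; rewrite !count_cat (count_uniq_mem x (umapF _ (fun a => ~~ gL a) P0inj)).
  rewrite (count_uniq_mem x (umapF _ (fun a => ~~ gR a) P1inj)).
  case: (boolP (x \in [seq P0 a | a <- I & ~~ gL a])) => [/mapP[a]|_].
    rewrite mem_filter => /andP[nga ha] ea.
    case: (boolP (x \in [seq P1 a | a <- I & ~~ gR a])) => [/mapP[b]|_].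
      rewrite mem_filter => /andP[ngb hb] eb.
      have e1 : ell_ y r a = ell_ y r b + 1.
        transitivity (1 - r%:R - P0 a); first by rewrite /P0 /pole; ring.
        by rewrite -ea eb /P1 /pole; ring.
      have [_ _ [c hc ec] [d hd ed]] := ell_succ py (inr _ ha) (inr _ hb) e1.
      apply: (@leq_add 1 1); apply: mem_count; apply/mapP.
        by exists c => //; rewrite ea ec.
      by exists d => //; rewrite ea /P0 /pole -ed; ring.
    rewrite addn0; case: (lower_blocked py (inr _ ha) nga) => -[c hc ec].
      by apply: leq_trans _ (leq_addr _ _); apply: mem_count; apply/mapP; exists c => //; rewrite
        ea ec.
    by apply: leq_trans _ (leq_addl _ _); apply: mem_count; apply/mapP; exists c => //; rewrite ea
      /P0 /pole -ec; ring.
  case: (boolP (x \in [seq P1 a | a <- I & ~~ gR a])) => [/mapP[a]|_] //.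
  rewrite mem_filter => /andP[nga ha] ea.
  rewrite add0n; case: (raise_blocked py (inr _ ha) nga) => -[c hc ec].
    by apply: leq_trans _ (leq_addr _ _); apply: mem_count; apply/mapP; exists c => //; rewrite ea
      ec /P1 /pole; ring.
  by apply: leq_trans _ (leq_addl _ _); apply: mem_count; apply/mapP; exists c => //; rewrite ea
    /P1 /pole -ec; ring.
pose Q := alpha (r.-1)%:R y r.-1 * alpha r%:R y r.+1.
have eQ : Q = (\prod_(x <- t0) ('X - x%:P)) * \prod_(x <- bs) ('X - x%:P).
  rewrite mulrC -big_cat -(perm_big _ ht) big_cat !big_map; congr (_ * _).
    apply: eq_bigr => a _; rewrite -polyCN; congr (_ + _%:P).
    by rewrite -[in r%:R](prednK r0) -natr1; ring.
  by apply: eq_bigr => a _; rewrite -polyCN; congr (_ + _%:P); ring.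
have pzb : perm_eq (zs ++ bs) ([seq P0 a | a <- I] ++ [seq P1 a | a <- I]).
  have pf f (q : pred (nat * nat)) :
      perm_eq ([seq f a | a <- I & q a] ++ [seq f a | a <- I & ~~ q a]) [seq f a : K | a <- I].
    by rewrite -map_cat perm_map // perm_filterC.
  rewrite /zs /bs perm_catACA; apply: perm_cat; exact: pf.
have h : expands ('X^(shift_gap r) * \prod_(x <- zs) ('X - x%:P)) (h_eigen y r) (\prod_(x <- t0)
  ('X - x%:P)).
  have b0 : \prod_(x <- bs) ('X - x%:P) != 0 by apply/monic_neq0/monic_prod_XsubC.
  apply: (expands_cancel b0); rewrite -eQ -mulrA -big_cat (perm_big _ pzb) big_cat.
  rewrite -(alpha_pole _ r0) -alpha_pole1; exact: h_eigenP.
have zs_bs : {in zs, forall x, x \notin bs}.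
  move=> x; rewrite !mem_cat => hx; apply/negP => hx'; move: hx hx'.
  case/orP => /mapP[a]; rewrite mem_filter => /andP[ga ha] ->;
    case/orP => /mapP[b]; rewrite mem_filter => /andP[gb hb].
  - by move=> /(P0inj _ _ ha hb) eab; rewrite eab (negPf gb) in ga.
  - by case/(P01 _ _ ha hb); rewrite ga.
  - by move/esym/(P01 _ _ hb ha) => [_]; rewrite ga.
  - by move=> /(P1inj _ _ ha hb) eab; rewrite eab (negPf gb) in ga.
have uzs : uniq zs.
  rewrite cat_uniq !umapF //= andbT; apply/hasPn => x /mapP[b]; rewrite mem_filter => /andP[gb hb]
    ->.
  apply/negP => /mapP[a]; rewrite mem_filter => /andP[ga ha] /esym/(P01 _ _ ha hb)[].
  by rewrite ga.
pose q (x : K) := (\prod_(u <- t0) ('X - u%:P)).[x] / \prod_(x' <- rem x zs) (x - x').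
have hq x : x \in zs -> q x * \prod_(x' <- rem x zs) (x - x') = (\prod_(u <- t0) ('X - u%:P)).[x].
  move=> hx; rewrite /q mulfVK // prodf_seq_neq0; apply/allP => x' /=.
  by rewrite mem_rem_uniq // inE => /andP[ne _]; rewrite subr_eq0 eq_sym.
rewrite (expands_residues uzs h hq e).
(* The factors of [bs] do not vanish at the pole of an allowed move, so its residue can be computed
   from the fraction before cancellation. *)
have qE x s' : x \in zs -> perm_eq ([seq P0 a | a <- I] ++ [seq P1 a | a <- I]) (x :: s') ->
    q x = Q.[x] / \prod_(x' <- s') (x - x').
  move=> hx hs; have e1 : rem x (zs ++ bs) = rem x zs ++ bs.
    by elim: (zs) hx => //= u s IH; rewrite inE; case: eqVneq => //= _ /IH->.
  rewrite -(prod_rem_perm _ (perm_trans pzb hs)) e1 big_cat /= eQ hornerM.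
  rewrite [(\prod_(x0 <- bs) _).[x]]horner_prod; under [\prod_(x0 <- bs) _.[_]]eq_bigr do rewrite
    hornerXsubC.
  rewrite -mulf_div divff ?mulr1 // prodf_seq_neq0; apply/allP => x' /= hx'.
  by rewrite subr_eq0; apply: contraNneq (zs_bs _ hx) => ->.
have QE x : Q.[x] = \prod_(b <- idx r.-1) (x + (ell_ y r.-1 b + (r.-1)%:R)) *
    \prod_(b <- idx r.+1) (x + (ell_ y r.+1 b + r%:R)).
  by rewrite hornerM !horner_prod; congr (_ * _); apply: eq_bigr => b _; rewrite hornerD hornerX
    hornerC.
have remI a (f : nat * nat -> K) : a \in I -> perm_eq [seq f c | c <- I] (f a :: [seq f c | c <-
  rem a I]).
  by move=> ha; rewrite -map_cons; apply/perm_map/perm_to_rem.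
have prod_cons (u : K) s (F : K -> K) : \prod_(x <- u :: s) F x = F u * \prod_(x <- s) F x.
  exact: big_cons.
have er : (r.-1)%:R = r%:R - 1 :> K by rewrite -[in RHS](prednK r0) -natr1 addrK.
have neq_rem a c : c \in rem a I -> (r, c) != (r, a).
  by rewrite mem_rem_uniq // inE xpair_eqE eqxx => /andP[].
rewrite /zs big_cat !big_map !big_filter opprD -!sumrN; congr (_ + _).
- rewrite [RHS]big_mkcond big_seq [RHS]big_seq; apply: eq_bigr => a ha.
  rewrite /cF /cE nudgeVK py -/(gL a) andbT /=; case: ifP => ga; last by rewrite !mulr0.
  have hx : P0 a \in zs by rewrite mem_cat map_f // mem_filter ga.
  rewrite (@qE _ ([seq P0 c | c <- rem a I] ++ [seq P1 c | c <- I])) //; last first.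
    by rewrite -cat_cons perm_cat2r remI.
  rewrite big_cat QE /= (perm_big _ (remI a P1 ha)) prod_cons !big_map.
  rewrite /cE_val /cF_val ell_nudge.
  (* The two poles of one entry differ by 1; this difference enters the residues of the two sums
     with opposite signs. *)
  have -> : P0 a - P1 a = 1 by rewrite /P1 /P0; ring.
  have -> : \prod_(b <- idx r.+1) (ell_ (nudge (- 1) r a y) r.+1 b - (ell_ y r a + (- 1)%:~R)) =
     \prod_(b <- idx r.+1) (P0 a + (ell_ y r.+1 b + r%:R)).
    by apply: eq_bigr => b _; rewrite ell_nudge_row ?gtn_eqF // /P0 /pole; ring.
  have -> : \prod_(c <- rem a (idx r)) (ell_ (nudge (- 1) r a y) r c - (ell_ y r a + (- 1)%:~R)) =
     \prod_(c <- rem a I) (P0 a - P1 c).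
    rewrite big_seq [RHS]big_seq; apply: eq_bigr => c /neq_rem hc.
    by rewrite ell_nudge_neq // /P0 /P1 /pole; ring.
  have -> : \prod_(c <- rem a (idx r)) (ell_ y r c - ell_ y r a) = \prod_(c <- rem a I) (P0 a - P0
    c).
    by apply: eq_bigr => c _; rewrite /P0 /pole; ring.
  have -> : \prod_(b <- idx r.-1) (ell_ y r.-1 b - ell_ y r a) =
     \prod_(b <- idx r.-1) (P0 a + (ell_ y r.-1 b + (r.-1)%:R)).
    by apply: eq_bigr => c _; rewrite er /P0 /pole; ring.
  by rewrite mul1r invfM -/(P0 a); ring.
- rewrite [RHS]big_mkcond big_seq [RHS]big_seq; apply: eq_bigr => a ha.
  have nV : nudge (- 1) r a (nudge 1 r a y) = y by exact: nudgeK.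
  rewrite /cF /cE nV py -/(gR a) andbT /=; case: ifP => ga; last by rewrite !mulr0 oppr0.
  have hx : P1 a \in zs by rewrite mem_cat (map_f P1) ?orbT // mem_filter ga.
  rewrite (@qE _ ([seq P1 c | c <- rem a I] ++ [seq P0 c | c <- I])) //; last first.
    by rewrite perm_catC -cat_cons perm_cat2r remI.
  rewrite big_cat QE /= (perm_big _ (remI a P0 ha)) prod_cons !big_map.
  rewrite /cE_val /cF_val ell_nudge.
  have -> : P1 a - P0 a = - 1 by rewrite /P1 /P0; ring.
  have -> : \prod_(b <- idx r.-1) (ell_ (nudge 1 r a y) r.-1 b - (ell_ y r a + 1%:~R)) =
     \prod_(b <- idx r.-1) (P1 a + (ell_ y r.-1 b + (r.-1)%:R)).
    apply: eq_bigr => b _; rewrite ell_nudge_row ?er /P1 /P0 /pole; first by ring.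
    by rewrite ltn_eqF // prednK.
  have -> : \prod_(c <- rem a (idx r)) (ell_ (nudge 1 r a y) r c - (ell_ y r a + 1%:~R)) =
     \prod_(c <- rem a I) (P1 a - P0 c).
    rewrite big_seq [RHS]big_seq; apply: eq_bigr => c /neq_rem hc.
    by rewrite ell_nudge_neq // /P0 /P1 /pole; ring.
  have -> : \prod_(c <- rem a (idx r)) (ell_ y r c - ell_ y r a) = \prod_(c <- rem a I) (P1 a - P1
    c).
    by apply: eq_bigr => c _; rewrite /P1 /pole; ring.
  have -> : \prod_(b <- idx r.+1) (ell_ y r.+1 b - ell_ y r a) =
     \prod_(b <- idx r.+1) (P1 a + (ell_ y r.+1 b + r%:R)).
    by apply: eq_bigr => c _; rewrite /P1 /P0 /pole; ring.
  by rewrite !invfM invrN1 -/(P1 a); ring.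
Qed.

(** * Operators of the model and their relations *)

Definition opD i r g : array -> K := fun y => d_eigen y i r * g y.

(** The value at y collects the arrays from which y is reached, so the sum is finite for every
    function g. In [opF] and in [opE] the pole is taken at the higher of the two arrays, so a move
    and its reverse share their pole. *)
Definition opF j s g : array -> K := fun y => \sum_(a <- idx j)
  geom 0 (pole (nudge 1 j a y) j a) s * cF (nudge 1 j a y) j a * g (nudge 1 j a y).

Definition opE i r g : array -> K := fun y => \sum_(b <- idx i)
  geom (shift_gap i) (pole y i b) r * cE (nudge (- 1) i b y) i b * g (nudge (- 1) i b y).

Lemma ser_mul_one_geom (s : nat -> K) (c x : K) r :
  ser_mul s (fun m => @ser_one K m + c * geom 0 x m) r =
  s r + c * \sum_(t < r) s t * x ^+ (r - t).-1.
Proof.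
rewrite /ser_mul big_ord_recr /= subnn /ser_one /geom /= mulr0 addr0 mulr1 addrC; congr (_ + _).
rewrite mulr_sumr; apply: eq_bigr => t _; have lt := ltn_ord t.
by rewrite leqn0 subn_eq0 leqNgt lt /= add0r mulrCA subn1.
Qed.

Lemma d_eigen_lower y i j a r : (0 < i)%N -> a \in idx j ->
  d_eigen (nudge (- 1) j a y) i r = d_eigen y i r +
  ((i == j.+1)%:R - (i == j)%:R) * \sum_(t < r) d_eigen y i t * pole y j a ^+ (r - t).-1.
Proof.
move=> i0 ha; have [e|ij] := eqVneq i j.
  subst j; rewrite d_eigen_lower_diag // ser_mul_one_geom; congr (_ + _ * _).
  by rewrite (_ : (i == i.+1) = false) ?sub0r //; lia.
have [e|ij1] := eqVneq i j.+1.
  by subst i; rewrite d_eigen_lower_next // ser_mul_one_geom subr0.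
rewrite d_eigen_nudge_row //; last by lia.
by rewrite subrr mul0r addr0.
Qed.

Lemma opD_opF i j r s g y : (0 < i)%N -> (0 < s)%N ->
  opD i r (opF j s g) y = opF j s (opD i r g) y +
  ((i == j.+1)%:R - (i == j)%:R) * \sum_(t < r) opF j (r + s - t - 1) (opD i t g) y.
Proof.
move=> i0 s0; rewrite /opF exchange_big /= mulr_sumr -big_split /= /opD mulr_sumr.
rewrite big_seq [RHS]big_seq; apply: eq_bigr => a ha.
rewrite -{1}(nudgeK 1 j a y) d_eigen_lower // mulrDl; congr (_ + _); first by rewrite mulrCA !mulrA.
rewrite -[LHS]mulrA; congr (_ * _); rewrite mulr_suml; apply: eq_bigr => t _.
have lt := ltn_ord t; rewrite /geom !ifF; try lia.
have -> : (r + s - t - 1 - 1 = (r - t).-1 + (s - 1))%N by lia.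
by rewrite exprD; ring.
Qed.

Lemma opF_supp j s g y : ~~ pattern y -> opF j s g y = 0.
Proof.
move=> ny; apply: big1_seq => a _; rewrite /cF nudgeK (negPf ny) andbF.
by rewrite mulr0 mul0r.
Qed.

Lemma opE_supp i s g y : ~~ pattern y -> opE i s g y = 0.
Proof.
move=> ny; apply: big1_seq => a _; rewrite /cE nudgeVK (negPf ny) andbF.
by rewrite mulr0 mul0r.
Qed.

(** Both compositions are double sums over a raise and a lowering. Moves of different entries
    commute; moves of the same entry return to y and are summed by [ef_diag]. The support condition
    handles arrays that are not patterns, where both compositions vanish but the eigenvalue series
    need not. *)
Lemma opE_opF i j r s g y : (forall y', ~~ pattern y' -> g y' = 0) ->
  (0 < i < n)%N -> (0 < j < n)%N -> (shift_gap i < r)%N -> (0 < s)%N ->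
  opE i r (opF j s g) y = opF j s (opE i r g) y - (i == j)%:R *
    \sum_(t < r + s) ser_inv (d_eigen y i) t * (d_eigen y i.+1 (r + s - t - 1) * g y).
Proof.
move=> gS hi hj hr hs.
have [py|ny] := boolP (pattern y); last first.
  rewrite opE_supp // opF_supp // big1 ?mulr0 ?subr0 // => t _.
  by rewrite gS // !mulr0.
have -> : \sum_(t < r + s) ser_inv (d_eigen y i) t * (d_eigen y i.+1 (r + s - t - 1) * g y) =
    h_eigen y i (r + s).-1 * g y.
  rewrite /h_eigen /ser_mul prednK ?addn_gt0 ?hs ?orbT // mulr_suml.
  by apply: eq_bigr => t _; rewrite mulrA; congr (_ * d_eigen _ _ _ * _); lia.
pose S b a := nudge 1 j a (nudge (- 1) i b y).
pose T1 b a := geom (shift_gap i) (pole y i b) r * cE (nudge (- 1) i b y) i b *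
   (geom 0 (pole (S b a) j a) s * cF (S b a) j a * g (S b a)).
pose T2 b a := geom 0 (pole (nudge 1 j a y) j a) s * cF (nudge 1 j a y) j a *
   (geom (shift_gap i) (pole (nudge 1 j a y) i b) r * cE (S b a) i b * g (S b a)).
have -> : opE i r (opF j s g) y = \sum_(b <- idx i) \sum_(a <- idx j) T1 b a.
  by apply: eq_bigr => b _; rewrite /opF mulr_sumr.
have -> : opF j s (opE i r g) y = \sum_(b <- idx i) \sum_(a <- idx j) T2 b a.
  rewrite exchange_big; apply: eq_bigr => a _; rewrite /opE mulr_sumr; apply: eq_bigr => b _.
  by rewrite /T2 /S nudgeC.
have eqT b a : b \in idx i -> a \in idx j -> (i, b) != (j, a) -> T1 b a = T2 b a.
  move=> hb ha ne; rewrite /T1 /T2.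
  have ib : inner i b by rewrite /inner hi.
  have ja : inner j a by rewrite /inner hj.
  have -> : nudge (- 1) i b y = nudge (- 1) j a (S b a) by rewrite /S nudgeK.
  have e2 : nudge 1 j a y = nudge 1 i b (S b a) by rewrite /S nudgeC nudgeVK.
  have -> : pole y i b = pole (nudge 1 j a y) i b by rewrite pole_nudge_neq.
  have -> : pole (S b a) j a = pole (nudge 1 j a y) j a.
    by rewrite e2 pole_nudge_neq // eq_sym.
  have := cEcF_comm (S b a) ja ib ne; rewrite -e2 => h.
  transitivity (geom (shift_gap i) (pole (nudge 1 j a y) i b) r * geom 0 (pole (nudge 1 j a y) j a)
    s *
    (cE (nudge (- 1) j a (S b a)) i b * cF (S b a) j a) * g (S b a)); first by ring.
  by rewrite h; ring.
have [e|ij] := eqVneq i j; last first.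
  rewrite mul0r subr0 big_seq [RHS]big_seq; apply: eq_bigr => b hb.
  rewrite big_seq [RHS]big_seq; apply: eq_bigr => a ha; apply: eqT => //.
  by rewrite xpair_eqE negb_and ij.
subst j; rewrite mul1r; apply/eqP; rewrite -subr_eq0 opprB addrA addrAC; apply/eqP.
rewrite -sumrB; apply/eqP; rewrite addr_eq0; apply/eqP.
transitivity (\sum_(b <- idx i) (T1 b b - T2 b b)).
  rewrite big_seq [RHS]big_seq; apply: eq_bigr => b hb; rewrite -sumrB.
  rewrite (bigD1_seq b) ?uniq_idx //= big_seq_cond big1 ?addr0 // => a /andP[ha ab].
  by rewrite eqT ?subrr // xpair_eqE eqxx eq_sym.
(* The exponents r - [shift_gap i] - 1 and s - 1 of the two geometric series add up to this
   index. *)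
have e := ef_diag (r + s - (shift_gap i).+2) py hi.
have -> : (r + s).-1 = (r + s - (shift_gap i).+2 + (shift_gap i).+1)%N by lia.
rewrite -mulNr -e sumrB mulrBl; congr (_ - _); rewrite mulr_suml; apply: eq_bigr => b _.
  rewrite /T1 /S nudgeVK /geom !ifF; try lia.
  rewrite (_ : r + s - _ = (r - (shift_gap i).+1) + (s - 1))%N; last by lia.
  by rewrite exprD; ring.
rewrite /T2 /S nudgeVK pole_nudge /geom !ifF; try lia.
rewrite (_ : r + s - _ = (r - (shift_gap i).+1) + (s - 1))%N; last by lia.
by rewrite exprD; ring.
Qed.

(** * Comparison of a highest weight module with the model *)

Hypothesis p_pos : forall i, (1 <= i <= n)%N -> (0 < p i)%N.

Local Notation top := top_array.
Local Notation W := (finite_W K n p).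
Local Notation d := (d_ser K n p).
Local Notation e := (e_ser K n p).
Local Notation f := (f_ser K n p).
Variables (lam : nat -> nat -> K) (V : lmodType W) (zeta : V).
Hypothesis V_zeta : highest_weight_irr lam zeta.
Hypothesis lam_ell : forall i k, (1 <= i <= n)%N -> (1 <= k <= p i)%N ->
  ell lam i k = rho k + (z i k)%:~R.
Local Notation "c **: v" := (@kscale K n p V c v) (at level 40).
Implicit Types v : V.

Lemma d_zeta i r : (1 <= i <= n)%N -> d i r *: zeta = d_eigen top i r **: zeta.
Proof.
move=> hi; rewrite (hw_d V_zeta) //; congr (_%:A *: _).
have i0 : (0 < i)%N by case/andP: hi.
have h := d_eigenP top i0.
have a0 : alpha (i.-1)%:R top i.-1 != 0 by exact: alpha_neq0.
suff /(expands_cancel a0)/expands_poly -> :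
    expands ('X^(p i) * alpha (i.-1)%:R top i.-1) (d_eigen top i)
      (root_poly (p i) (lam i) * alpha (i.-1)%:R top i.-1) by [].
suff <- : alpha (i.-1)%:R top i = root_poly (p i) (lam i) * alpha (i.-1)%:R top i.-1 by [].
rewrite /alpha -{1}(prednK i0) idxS big_cat mulrC; congr (_ * _).
rewrite big_map prednK // /root_poly big_seq [RHS]big_seq; apply: eq_bigr => k.
rewrite mem_index_iota => hk; congr (_ + _%:P).
rewrite /ell_ /top_array /= -lam_ell // /ell -[in i%:R](prednK i0) -natr1; ring.
Qed.

Lemma horner_act (P : {poly W}) u v :
  P.[u%:A] *: v = \sum_(m < size P) u ^+ m **: (P`_m *: v).
Proof.
rewrite horner_coef scaler_suml; apply: eq_bigr => m _.
have -> : (u%:A : W) ^+ m = (u ^+ m)%:A by rewrite exprZn expr1n.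
by rewrite mulr_algr scale_act.
Qed.

(* P(2u) - 2^(N-1) P(u) has lower degree. *)
Lemma vector_poly_eq0 N (v : nat -> V) :
  (forall u : K, \sum_(m < N) u ^+ m **: v m = 0) -> forall m, (m < N)%N -> v m = 0.
Proof.
elim: N v => // N IH v h m lt_m.
have hv m' : (m' < N)%N -> v m' = 0.
  move=> lt'; have c0 : 2 ^+ m' - 2 ^+ N != 0 :> K.
    by rewrite subr_eq0 -!natrX eqr_nat eqn_exp2l // neq_ltn lt'.
  apply: (kscale_eq0 c0); apply: (IH (fun m => (2 ^+ m - 2 ^+ N) **: v m)) => // u.
  transitivity (\sum_(m < N.+1) (2 * u) ^+ m **: v m - 2 ^+ N **: \sum_(m < N.+1) u ^+ m **: v m).
    rewrite !big_ord_recr /= kscaleDr !kscaleA exprMn opprD addrACA subrr addr0.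
    rewrite /kscale scaler_sumr -sumrB; apply: eq_bigr => j _.
    by rewrite -!/(kscale _ _) !kscaleA exprMn -kscaleNl -kscaleDl; congr (_ **: _); ring.
  by rewrite !h kscaler0 subr0.
have := h 1; rewrite big_ord_recr /= big1 ?add0r => [|i _]; last by rewrite hv // kscaler0.
rewrite expr1n kscale1 => hN; move: lt_m; rewrite ltnS leq_eqVlt => /orP[/eqP->|/hv] //.
Qed.

Definition Pden i : {poly K} := \prod_(1 <= j < i.+1) ulin K j ^+ p j.

Lemma ulin_monic j q : ulin K j ^+ q \is monic.
Proof. by apply: monic_exp; apply: monicXsubC. Qed.

Lemma Pden_monic i : Pden i \is monic.
Proof. by apply: monic_prod => j _; apply: ulin_monic. Qed.

Lemma size_ulin j q : size (ulin K j ^+ q) = q.+1.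
Proof. by rewrite /ulin size_exp_XsubC. Qed.

Lemma size_Pden i : size (Pden i) = (size (idx i)).+1.
Proof.
elim: i => [|i IH]; first by rewrite /Pden big_geq ?size_poly1.
rewrite /Pden big_nat_recr //= size_Mmonic ?ulin_monic ?monic_neq0 ?Pden_monic //.
by rewrite IH size_ulin size_idxS; lia.
Qed.

Lemma a_ser0 i : a_ser K n p i 0 = 1.
Proof.
rewrite /a_ser; apply: (big_ind (fun s : nat -> W => s 0%N = 1)) => // [s t hs ht|j _].
  by rewrite /ser_mul big_ord1 hs ht mulr1.
by rewrite ser_shift_low // d_ser0.
Qed.

(** b_i(u) starts with the lowest e_i^(s), and its polynomial prefactor is monic, so this element is
    the top possible coefficient of B_i(u). *)
Lemma e_min_zeta i : (1 <= i <= n.-1)%N -> e i (p i.+1 - p i).+1 *: zeta = 0.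
Proof.
move=> hi; set shift_gap := (p i.+1 - p i)%N.
pose P := Pden i.-1 * ulin K i ^+ p i.+1.
have i0 : (0 < i)%N by case/andP: hi.
have eP : (\prod_(1 <= j < i) ulin K j ^+ p j) * ulin K i ^+ p i.+1 = P by rewrite /P /Pden prednK.
have sP : size P = (size (idx i.-1) + p i.+1).+1.
  by rewrite size_Mmonic ?monic_neq0 ?ulin_monic ?Pden_monic // size_Pden size_ulin; lia.
have mP : P \is monic by rewrite monicMl ?Pden_monic ?ulin_monic.
(* Positivity of p_i enters here; it keeps the subtraction in [m0] from truncating. *)
have hp : (shift_gap < p i.+1)%N.
  by rewrite /shift_gap; have := @p_pos i; have := p_mono hi; lia.
pose N := (size (idx i.-1) + p i.+1)%N; pose m0 := (N - shift_gap.+1)%N.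
have bq q : (q <= shift_gap)%N -> b_ser K n p i q = 0.
  move=> hq; rewrite /b_ser /ser_mul big1 // => r _.
  rewrite (@ser_shift_low _ _ _ (q - r)%N) ?e_ser_low ?mulr0 // => [|r' hr']; last first.
    by apply: e_ser_low; move: hr'; rewrite -/shift_gap; lia.
  by rewrite -/shift_gap; lia.
have b1 : b_ser K n p i shift_gap.+1 = e i shift_gap.+1.
  rewrite /b_ser /ser_mul big_ord_recl /= a_ser0 mul1r subn0 big1 ?addr0 => [|r _].
    by rewrite ser_shift_low // => r hr; apply: e_ser_low; rewrite -/shift_gap; lia.
  have hr : (shift_gap.+1 - fintype.bump 0 r <= shift_gap)%N by rewrite /fintype.bump; lia.
  rewrite ser_shift_low ?e_ser_low ?mulr0 // => r' hr'; apply: e_ser_low; rewrite -/shift_gap; lia.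
have coefB : (B_poly K n p i)`_m0 = e i shift_gap.+1.
  rewrite /B_poly /poly_times_ser eP coef_poly sP ifT; last by rewrite /m0 /N; lia.
  rewrite big_nat_recr /=; last by rewrite /m0 /N; lia.
  rewrite big1_seq ?add0r => [|k /andP[_]].
    have -> : P`_(size (idx i.-1) + p i.+1) = 1.
      by move/monicP: mP; rewrite lead_coefE sP.
    rewrite scale1r -b1; congr (b_ser _ _ _ _ _); rewrite /m0 /N; lia.
  by rewrite mem_index_iota => hk; rewrite bq ?scaler0 //; move: hk; rewrite /m0 /N; lia.
have h := @vector_poly_eq0 (size (B_poly K n p i)) (fun m => (B_poly K n p i)`_m *: zeta) _ m0.
rewrite -coefB; have [lt|ge] := ltnP m0 (size (B_poly K n p i)); last by rewrite nth_default
  ?scale0r.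
by apply: h lt => u; rewrite -horner_act; apply: (hw_B V_zeta).
Qed.

(** [d_i^(2), e_i^(s)] = e_i^(s+1) + d_i^(1) e_i^(s), and [zeta] is an eigenvector of the d's, so
    annihilation propagates upwards from the lowest index. *)
Lemma e_zeta i r : e_ok n p i r -> e i r *: zeta = 0.
Proof.
case/andP=> hi; rewrite addn1 => hr; rewrite -(subnKC hr); elim: (r - _)%N => [|q IH].
  by rewrite addn0; apply: e_min_zeta.
set s := (_ + q)%N in IH *; rewrite addnS -/s.
have d2 : d_ok n i 2 by rewrite /d_ok; lia.
have es : e_ok n p i s by rewrite /e_ok hi /s; lia.
have := d_e K d2 es; rewrite eqxx (_ : (i == i.+1) = false) ?subr0 ?mul1r; last by lia.
rewrite !big_ord_recr big_ord0 /= add0r d_ser0 mul1r => h.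
have -> : s.+1 = (2 + s - 0 - 1)%N by lia.
have -> : e i (2 + s - 0 - 1) = d i 2 * e i s - e i s * d i 2 - d i 1 * e i (2 + s - 1 - 1).
  by rewrite h [X in X - _ - _]addrC !addrK.
have -> : (2 + s - 1 - 1 = s)%N by lia.
rewrite !scalerBl -!scalerA IH d_zeta; last by lia.
by rewrite act_kscale IH kscaler0 !scaler0 !subr0.
Qed.

Definition delta (y0 : array) : array -> K := fun y => `[< y = y0 >]%:R.

(* Pairs obtained by applying the same combination of words of length k in the f's to the highest
   vector of V and to that of the model. *)
Inductive paired : nat -> V -> (array -> K) -> Prop :=
| paired_hw : paired 0 zeta (delta top)
| paired_f k j s v g of f_ok n j s & paired k v g : paired k.+1 (f j s *: v) (opF j s g)
| paired0 k : paired k 0 (fun=> 0)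
| paired_lin k c v v' g g' of paired k v g & paired k v' g' :
    paired k (c **: v + v') (fun y => c * g y + g' y).

Lemma paired_eq k v v' g g' : paired k v g -> v = v' -> g =1 g' -> paired k v' g'.
Proof. by move=> h <- /funext <-. Qed.

Lemma pairedZ k c v g : paired k v g -> paired k (c **: v) (fun y => c * g y).
Proof.
move=> h; apply: paired_eq (paired_lin c h (paired0 k)) _ _; first by rewrite addr0.
by move=> y; rewrite addr0.
Qed.

Lemma pairedD k v v' g g' : paired k v g -> paired k v' g' -> paired k (v + v') (fun y => g y + g'
  y).
Proof.
move=> h h'; apply: paired_eq (paired_lin 1 h h') _ _; first by rewrite kscale1.
by move=> y; rewrite mul1r.
Qed.

Lemma pairedB k v v' g g' : paired k v g -> paired k v' g' -> paired k (v - v') (fun y => g y - g'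
  y).
Proof.
move=> h h'; apply: paired_eq (paired_lin (- 1) h' h) _ _; first by rewrite kscaleNl kscale1 addrC.
by move=> y; rewrite mulN1r addrC.
Qed.

Lemma paired_sum k (I : Type) (r : seq I) (v : I -> V) (g : I -> array -> K) :
  (forall i, paired k (v i) (g i)) ->
  paired k (\sum_(i <- r) v i) (fun y => \sum_(i <- r) g i y).
Proof.
move=> h; elim: r => [|i r IH].
  by apply: paired_eq (paired0 k) _ _ => [|y]; rewrite big_nil.
by apply: paired_eq (pairedD (h i) IH) _ _ => [|y]; rewrite big_cons.
Qed.

Lemma paired_supp k v g : paired k v g -> forall y, ~~ pattern y -> g y = 0.
Proof.
elim=> [y ny|{}k j s {}v {}g _ _ _ y ny|//|{}k c {}v v' {}g g' _ IH _ IH' y ny].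
- by rewrite /delta; case: asboolP => // e1; rewrite e1 pattern_top in ny.
- exact: opF_supp.
- by rewrite IH ?IH' // mulr0 addr0.
Qed.

Lemma opE_lin j s c g g' y : opE j s (fun y => c * g y + g' y) y = c * opE j s g y + opE j s g' y.
Proof.
rewrite /opE mulr_sumr -big_split; apply: eq_bigr => a _ /=; ring.
Qed.

(** Moving d past an f uses [d, f], which [opD_opF] reproduces in the model. The relation involves
    all d_i^(t) with t < r, so the induction keeps r general. *)
Lemma paired_d i r k v g : (1 <= i <= n)%N -> paired k v g -> paired k (d i r *: v) (opD i r g).
Proof.
move=> hi h; have i0 : (0 < i)%N by case/andP: hi.
elim: h r => [|{}k j s {}v {}g hf h IH|{}k|{}k c {}v v' {}g g' _ IH _ IH'] r.
- apply: paired_eq (pairedZ (d_eigen top i r) paired_hw) _ _; first by rewrite d_zeta.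
  by move=> y; rewrite /opD /delta; case: asboolP => [->//|]; rewrite !mulr0.
- have [->|r0] := posnP r.
    apply: paired_eq (paired_f hf h) _ _; first by rewrite d_ser0 scale1r.
    by move=> y; rewrite /opD d_eigen0 // mul1r.
  have hd : d_ok n i r by rewrite /d_ok hi.
  rewrite scalerA d_f // scalerDl -scalerA -scalerA.
  have -> : ((i == j.+1)%:R - (i == j)%:R : W) *: ((\sum_(t < r) f j (r + s - t - 1) * d i t) *: v)
    =
     ((i == j.+1)%:R - (i == j)%:R : K) **: (\sum_(t < r) f j (r + s - t - 1) *: (d i t *: v)).
    rewrite scaler_suml /kscale; congr (_ *: _); first by rewrite [RHS]scalerBl !scaler_nat.
    by apply: eq_bigr => t _; rewrite scalerA.
  have hs : (0 < s)%N by case/andP: hf.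
  have hsum : paired k.+1 (\sum_(t < r) f j (r + s - t - 1) *: (d i t *: v))
      (fun y => \sum_(t < r) opF j (r + s - t - 1) (opD i t g) y).
    apply: paired_sum => t; apply: paired_f (IH t).
    by move: hf; rewrite /f_ok; have := ltn_ord t; lia.
  apply: paired_eq (pairedD (paired_f hf (IH r)) (pairedZ _ hsum)) _ _ => // y.
  by rewrite opD_opF.
- by apply: paired_eq (paired0 k) _ _ => [|y]; rewrite ?scaler0 // /opD mulr0.
- apply: paired_eq (paired_lin c (IH r) (IH' r)) _ _; first by rewrite scalerDr act_kscale.
  by move=> y; rewrite /opD; ring.
Qed.

Lemma paired_dinv i (r : nat) k v g : (1 <= i <= n)%N -> paired k v g ->
  paired k (dinv K n p i r *: v) (fun y => ser_inv (d_eigen y i) r * g y).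
Proof.
move=> hi h; have i0 : (0 < i)%N by case/andP: hi.
elim/ltn_ind: r => r IH; rewrite /dinv ser_inv_recl ?d_ser0 //.
have hsum : paired k (\sum_(t < r) d i t.+1 *: (ser_inv (d i) (r - t.+1) *: v))
    (fun y => \sum_(t < r) opD i t.+1 (fun y => ser_inv (d_eigen y i) (r - t.+1) * g y) y).
  by apply: paired_sum => t; apply: paired_d => //; apply: IH; have := ltn_ord t; lia.
apply: paired_eq (pairedB (pairedZ (r == 0%N)%:R h) hsum) _ _.
  rewrite scalerBl scaler_suml /kscale scaler_nat; congr (_ - _).
  by apply: eq_bigr => t _; rewrite scalerA.
move=> y; rewrite [in RHS]ser_inv_recl ?d_eigen0 // mulrBl mulr_suml; congr (_ - _).
by apply: eq_bigr => t _; rewrite /opD mulrA.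
Qed.

(** An e removes one f from a word, so the depth drops by one. At depth 0 there is nothing to remove
    and both components vanish. *)
Lemma paired_e i r k v g : e_ok n p i r -> paired k v g ->
  if k is k'.+1 then paired k' (e i r *: v) (opE i r g)
  else e i r *: v = 0 /\ opE i r g =1 fun=> 0.
Proof.
move=> hr h; have [hi hri] := andP hr.
elim: h => [|{}k j s {}v {}g hf h IH|{}k|{}k c {}v v' {}g g' _ IH _ IH'].
- split=> [|y]; first exact: e_zeta.
  rewrite /opE big1_seq // => b /andP[_ hb]; rewrite /delta.
  case: asboolP => [e1|]; last by rewrite mulr0.
  rewrite /cE e1; have ib : inner i b by rewrite /inner hb andbT; lia.
  (* In the top array every entry already equals its upper bound in the next row, so no raise is
     allowed. *)
  rewrite (_ : pattern (nudge 1 i b top) = false) ?andbF ?mulr0 ?mul0r //.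
  case: b hb ib {e1} => j m hb ib; rewrite pattern_raise ?pattern_top //.
  by rewrite /top_array /= ltxx.
- have [hj hs] := andP hf.
  have hsum : paired k (\sum_(t < r + s) dinv K n p i t *: (d i.+1 (r + s - t - 1) *: v))
      (fun y => \sum_(t < r + s) ser_inv (d_eigen y i) t * opD i.+1 (r + s - t - 1) g y).
    by apply: paired_sum => t; apply: paired_dinv; [lia|apply: paired_d => //; lia].
  have hfe : paired k (f j s *: (e i r *: v)) (opF j s (opE i r g)).
    case: k IH {h hsum} => [[-> h0]|k' IH]; last exact: paired_f IH.
    apply: paired_eq (paired0 0) _ _; first by rewrite scaler0.
    by move=> y; rewrite /opF big1 // => a _; rewrite h0 mulr0.
  apply: paired_eq (pairedB hfe (pairedZ (i == j)%:R hsum)) _ _.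
    rewrite [RHS]scalerA e_f // scalerBl -!scalerA scaler_suml /kscale; congr (_ - _ *: _).
      by rewrite scaler_nat.
    by apply: eq_bigr => t _; rewrite scalerA.
  by move=> y; rewrite (opE_opF) //; [exact: paired_supp h|lia|lia|rewrite /shift_gap; lia].
- case: k => [|k']; last first.
    apply: paired_eq (paired0 k') _ _; first by rewrite scaler0.
    by move=> y; rewrite /opE big1 // => b _; rewrite mulr0.
  by split=> [|y]; [rewrite scaler0|rewrite /opE big1 // => b _; rewrite mulr0].
case: k IH IH' => [[h1 h2] [h3 h4]|k' IH IH'].
  by split=> [|y]; rewrite ?opE_lin ?h2 ?h4 ?mulr0 ?addr0 // scalerDr act_kscale h1 h3 kscaler0
    addr0.
apply: paired_eq (paired_lin c IH IH') _ _; first by rewrite scalerDr act_kscale.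
by move=> y; rewrite opE_lin.
Qed.

Lemma paired_depth0 v g : paired 0 v g -> exists c, v = c **: zeta /\ g =1 fun y => c * delta top y.
Proof.
move E: 0%N => k h; elim: h E => {k v g} [_|//|k _|k c v v' g g' _ IH _ IH' k0].
- by exists 1; split=> [|y]; rewrite ?kscale1 ?mul1r.
- by exists 0; split=> [|y]; rewrite ?kscale0 ?mul0r.
have [c1 [-> h1]] := IH k0; have [c2 [-> h2]] := IH' k0.
exists (c * c1 + c2); split=> [|y]; first by rewrite kscaleA kscaleDl.
by rewrite h1 h2; ring.
Qed.

(** * Separation of depths and the radical *)

(** The coefficients n - i drop by one from i = j to i = j + 1, so each f_j^(s) lowers the
    eigenvalue by exactly 1 whatever j and s are. The eigenvalue thus records the depth. *)
Definition weight_elt : W := \sum_(1 <= i < n.+1) (n - i)%:R *: d i 1.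

Lemma sum_pick (F : nat -> K) j : (1 <= j <= n)%N ->
  \sum_(1 <= i < n.+1) F i * (i == j)%:R = F j.
Proof.
move=> hj; rewrite (bigD1_seq j) ?mem_index_iota ?iota_uniq //= eqxx mulr1 big1 ?addr0 //.
by move=> i /negPf->; rewrite mulr0.
Qed.

Lemma weight_f j s : f_ok n j s -> weight_elt * f j s = f j s * weight_elt - f j s.
Proof.
move=> hf; have [hj hs] := andP hf; rewrite /weight_elt mulr_suml mulr_sumr.
transitivity (\sum_(1 <= i < n.+1) ((n - i)%:R *: (f j s * d i 1) +
   ((n - i)%:R * ((i == j.+1)%:R - (i == j)%:R)) *: f j s)).
  rewrite big_seq [RHS]big_seq; apply: eq_bigr => i; rewrite mem_index_iota => hi.
  rewrite -scalerAl d_f //; last by rewrite /d_ok; lia.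
  rewrite big_ord1 d_ser0 mulr1 (_ : 1 + s - 0 - 1 = s)%N; last by lia.
  rewrite scalerDr -scalerA; congr (_ + _ *: _).
  by rewrite scalerBl mulrBl !scaler_nat !mulr_natl.
rewrite big_split /=; congr (_ + _); first by apply: eq_bigr => i _; rewrite scalerAr.
rewrite -scaler_suml; under eq_bigr do rewrite mulrBr.
rewrite sumrB !(@sum_pick (fun i => (n - i)%:R)); try lia.
have -> : (n - j = (n - j.+1).+1)%N by lia.
by rewrite -natr1 opprD addrA subrr add0r scaleN1r.
Qed.

Definition top_weight : K := \sum_(1 <= i < n.+1) (n - i)%:R * d_eigen top i 1.

Lemma paired_weight k v g : paired k v g -> weight_elt *: v = (top_weight - k%:R) **: v.
Proof.
elim=> [|{}k j s {}v {}g hf _ IH|{}k|{}k c {}v v' {}g g' _ IH _ IH'].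
- rewrite subr0 /weight_elt /top_weight scaler_suml /kscale !scaler_suml.
  rewrite big_seq [RHS]big_seq; apply: eq_bigr => i; rewrite mem_index_iota => hi.
  by rewrite scale_act d_zeta ?kscaleA; last by lia.
- rewrite scalerA weight_f // scalerBl -scalerA IH act_kscale -[X in _ - X]kscale1 -kscaleNl
  -kscaleDl.
  by rewrite -natr1; congr (_ **: _); ring.
- by rewrite scaler0 kscaler0.
by rewrite scalerDr act_kscale IH IH' kscaleDr !kscaleA mulrC.
Qed.

(** Sums over different depths are allowed because W does not preserve the depth. *)
Inductive radical : V -> Prop :=
| radical0 : radical 0
| radicalD k v v' of paired k v (fun=> 0) & radical v' : radical (v + v').

Lemma radical_add v v' : radical v -> radical v' -> radical (v + v').
Proof. by elim=> [|k u u' hu _ IH] hv; rewrite ?add0r // -addrA; apply: radicalD hu (IH hv). Qed.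

Lemma radical_paired k v g : paired k v g -> g =1 (fun=> 0) -> radical v.
Proof. by move=> h e0; rewrite -[v]addr0; apply: radicalD (paired_eq h _ e0) radical0. Qed.

Lemma radical_act (w : W) v : radical v -> radical (w *: v).
Proof.
have key (op : V -> V) (hop : {morph op : x y / x + y}) (op0 : op 0 = 0) :
    (forall k u, paired k u (fun=> 0) -> radical (op u)) -> forall u, radical u -> radical (op u).
  move=> h u; elim=> [|k u1 u2 h1 _ IH]; first by rewrite op0; apply: radical0.
  by rewrite hop; apply: radical_add IH; apply: h h1.
have actD (x : W) : {morph (fun u : V => x *: u) : a b / a + b} by move=> a b; rewrite scalerDr.
have act0 (x : W) : x *: (0 : V) = 0 by rewrite scaler0.
apply: act_closed w v => [|u u'|c u|i r u hi|i r u hi|i r u hi].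
- exact: radical0.
- exact: radical_add.
- apply: (key (fun u => c **: u)) => [x y||k u' h]; rewrite ?kscaleDr ?kscaler0 //.
  by apply: radical_paired (pairedZ c h) _ => y; rewrite mulr0.
- apply: (key (fun u => d i r *: u)) => // k u' h; case/andP: hi => hi _.
  by apply: radical_paired (paired_d r hi h) _ => y; rewrite /opD mulr0.
- apply: (key (fun u => f i r *: u)) => // k u' h.
  by apply: radical_paired (paired_f hi h) _ => y; rewrite /opF big1 // => a _; rewrite mulr0.
- apply: (key (fun u => e i r *: u)) => // k u' h; have := paired_e hi h; case: k {h} => [[-> _]|k
  h].
    exact: radical0.
  by apply: radical_paired h _ => y; rewrite /opE big1 // => a _; rewrite mulr0.
Qed.

(** Annihilates the depths 1 to N and multiplies [zeta] by N!. *)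
Definition depth_killer N : W := \prod_(1 <= k < N.+1) (weight_elt - (top_weight - k%:R)%:A).

Lemma depth_killer_eigen N (mu : K) v : weight_elt *: v = mu **: v ->
  depth_killer N *: v = (\prod_(1 <= k < N.+1) (mu - (top_weight - k%:R))) **: v.
Proof.
move=> h; elim: N => [|N IH]; first by rewrite /depth_killer !big_geq // scale1r kscale1.
have -> : depth_killer N.+1 = depth_killer N * (weight_elt - (top_weight - N.+1%:R)%:A).
  by rewrite /depth_killer big_nat_recr.
rewrite [in RHS]big_nat_recr //= -scalerA scalerBl h -/(kscale _ v).
by rewrite -kscaleNl -kscaleDl act_kscale IH kscaleA mulrC.
Qed.

Lemma radical_killed v : radical v -> exists N0, forall N, (N0 <= N)%N -> depth_killer N *: v = 0.
Proof.
elim=> [|k u u' hu _ [N0 h]]; first by exists 0%N => N _; rewrite scaler0.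
exists (maxn N0 k) => N; rewrite geq_max => /andP[h0 hk]; rewrite scalerDr h // addr0.
(* The product has no factor for depth 0, but there a zero function already forces the multiple of
   [zeta] to be 0. *)
case: k hu hk => [hu _|k hu hk].
  have [c [-> h0']] := paired_depth0 hu; have := h0' top.
  by rewrite /delta asboolT // mulr1 => <-; rewrite kscale0 scaler0.
rewrite (depth_killer_eigen N (paired_weight hu)).
suff -> : \prod_(1 <= k0 < N.+1) (top_weight - k.+1%:R - (top_weight - k0%:R)) = 0 by rewrite
  kscale0.
by rewrite (bigD1_seq k.+1) ?mem_index_iota ?iota_uniq //= subrr mul0r.
Qed.

Lemma paired_eq0 k v g : paired k v g -> g =1 (fun=> 0) -> v = 0.
Proof.
move=> h g0; have rv := radical_paired h g0; apply: contrapT => v0.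
have rz : radical zeta.
  have /(_ zeta)/asboolP // : forall u, `[< radical u >].
  apply: (hw_irreducible V_zeta (S := fun u => `[< radical u >])).
  - split; first by apply/asboolP/radical0.
    move=> a x y /asboolP hx /asboolP hy; apply/asboolP.
    by apply: radical_add hy; apply: radical_act.
  - by exists v; [apply/asboolP|apply/eqP].
(* The eigenvalue on [zeta] is N!, nonzero in characteristic 0, so [zeta] is not in the radical. *)
have [N /(_ N (leqnn N))] := radical_killed rz; rewrite (depth_killer_eigen N (paired_weight
  paired_hw)).
move/kscale_eq0 => hz; have /eqP := hw_neq0 V_zeta; apply; apply: hz.
rewrite prodf_seq_neq0; apply/allP => k' /=; rewrite mem_index_iota subr0 opprB addrC subrK => hk.
by rewrite pnatr_eq0; lia.
Qed.

Lemma paired_inj k v v' g g' : paired k v g -> paired k v' g' -> g =1 g' -> v = v'.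
Proof.
move=> h h' e1; apply/eqP; rewrite -subr_eq0; apply/eqP.
by apply: paired_eq0 (pairedB h h') _ => y; rewrite e1 subrr.
Qed.

(** * The action of A, B and C *)

Lemma paired_act_sum (I : Type) (r : seq I) (w : I -> W) k v (g : I -> array -> K) :
  (forall i, paired k (w i *: v) (g i)) ->
  paired k ((\sum_(i <- r) w i) *: v) (fun y => \sum_(i <- r) g i y).
Proof. by move=> h; rewrite scaler_suml; apply: paired_sum. Qed.

Lemma paired_ser_shift c (s : nat -> W) (G : nat -> array -> K) k v :
  (forall q, paired k (s q *: v) (G q)) ->
  forall q, paired k (ser_shift c s q *: v) (fun y => ser_shift c (fun r => G r y) q).
Proof.
move=> h q; apply: paired_act_sum => r; rewrite -mulr_natl -scalerA scaler_nat.
apply: paired_eq (pairedZ ('C(q.-1, q - r) * c ^ (q - r))%:R (h r)) _ _.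
  by rewrite /kscale scaler_nat scaler_nat.
by move=> y; rewrite mulr_natl.
Qed.

Definition a_eigen y i : nat -> K :=
  \big[@ser_mul K/@ser_one K]_(1 <= j < i.+1) ser_shift j.-1 (d_eigen y j).

Lemma paired_a i q k v g : (i <= n)%N -> paired k v g ->
  paired k (a_ser K n p i q *: v) (fun y => a_eigen y i q * g y).
Proof.
move=> hi; rewrite /a_ser /a_eigen.
have : all (fun j => 1 <= j <= n)%N (index_iota 1 i.+1).
  by apply/allP => j; rewrite mem_index_iota; lia.
elim: (index_iota _ _) q k v g => [|j r IH] q k v g /=.
  move=> _ h; apply: paired_eq (pairedZ (q == 0%N)%:R h) _ _ => [|y]; rewrite big_nil //.
  by rewrite /ser_one /kscale scaler_nat.
case/andP=> hj hr h; rewrite big_cons /ser_mul.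
set T := \big[_/_]_(_ <- r) _.
pose T' y := \big[@ser_mul K/@ser_one K]_(j <- r) ser_shift j.-1 (d_eigen y j).
have h' : paired k ((\sum_(t < q.+1) ser_shift j.-1 (d j) t * T (q - t)%N) *: v)
    (fun y => \sum_(t < q.+1) ser_shift j.-1 (fun t' => d_eigen y j t' * (T' y (q - t)%N * g y)) t).
  apply: paired_act_sum => t; rewrite -scalerA.
  apply: (@paired_ser_shift _ (d j) (fun t' y => d_eigen y j t' * (T' y (q - t)%N * g y))) => t'.
  exact: (paired_d _ hj (IH _ _ _ _ hr h)).
apply: paired_eq h' _ _ => // y; rewrite big_cons mulr_suml; apply: eq_bigr => t _.
by rewrite ser_shift_mulr mulrA.
Qed.

(** The factors d_j(u - j + 1) telescope: row j is the numerator of one factor and part of the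
    denominator of the next. Only row i and the powers of the u - j + 1 remain. *)
Lemma a_eigenP y i : expands (Pden i) (a_eigen y i) (alpha 0 y i).
Proof.
(* The iterated product is bracketed to the right, so the partial products are its tails and the
   induction goes down in j. *)
suff h j : (j <= i)%N -> expands ((\prod_(j.+1 <= m < i.+1) ulin K m ^+ p m) * alpha 0 y j)
    (\big[@ser_mul K/@ser_one K]_(j.+1 <= m < i.+1) ser_shift m.-1 (d_eigen y m)) (alpha 0 y i).
  have a0 : alpha 0 y 0 = 1 by rewrite /alpha big_nil.
  by have := h 0%N isT; rewrite a0 mulr1.
move=> hj; rewrite -(subKn hj); move: (i - j)%N (leq_subr j i) => m {hj j}.
elim: m => [|m IH] hm.
  by rewrite subn0 !big_geq // mul1r; apply/expands_one/alpha_neq0.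
have lt : ((i - m.+1).+1 < i.+1)%N by lia.
rewrite (big_ltn lt) (big_ltn lt).
have e : (i - m.+1).+1 = (i - m)%N by lia.
rewrite e; set j := (i - m)%N in e IH *.
have j0 : (0 < j)%N by lia.
have hd := expands_shift j.-1 (d_eigenP y j0).
rewrite comp_polyM comp_Xn_poly !alpha_comp subrr in hd.
have := expandsM hd (IH (ltnW hm)).
have -> : (i - m.+1)%N = j.-1 by lia.
have a0 : alpha 0 y j != 0 by exact: alpha_neq0.
move=> h; apply: (expands_cancel a0); rewrite [alpha 0 y i * _]mulrC.
suff -> : ulin K j ^+ p j * (\prod_(j.+1 <= m0 < i.+1) ulin K m0 ^+ p m0) * alpha 0 y j.-1 * alpha
  0 y j =
  ('X - (j.-1)%:R%:P) ^+ p j * alpha 0 y j.-1 * ((\prod_(j.+1 <= m0 < i.+1) ulin K m0 ^+ p m0) *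
    alpha 0 y j) by [].
by rewrite /ulin; ring.
Qed.

(** If the series by which s acts are fractions with denominator P, the truncation in P(u) s(u) is
    lossless and the product acts by the numerators. *)
Lemma paired_poly_times k (P : {poly K}) (s : nat -> W) v (I : eqType) (r : seq I)
  (sg : I -> nat -> K) (Q : I -> {poly K}) (g : I -> array -> K) (u : K) :
  (forall q, paired k (s q *: v) (fun y => \sum_(x <- r) sg x q * g x y)) ->
  (forall x, x \in r -> expands P (sg x) (Q x)) ->
  paired k ((poly_times_ser P s).[u%:A] *: v) (fun y => \sum_(x <- r) (Q x).[u] * g x y).
Proof.
move=> hs hQ; rewrite /poly_times_ser.
rewrite (horner_coef_wide _ (size_poly _ _)).
have h : paired k ((\sum_(m < size P) (u ^+ m) *: (\sum_(m <= k < size P) P`_k *: s (k - m)%N)) *: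
  v)
   (fun y => \sum_(m < size P) u ^+ m * (\sum_(m <= k < size P) P`_k * (\sum_(x <- r) sg x (k -
     m)%N * g x y))).
  apply: paired_act_sum => m; rewrite scale_act; apply: pairedZ; apply: paired_act_sum => j.
  by rewrite scale_act; apply: pairedZ.
apply: paired_eq h _ _.
  congr (_ *: _); apply: eq_bigr => m _; rewrite coef_poly ltn_ord.
  by rewrite exprZn expr1n mulr_algr.
move=> y; have -> : \sum_(x <- r) (Q x).[u] * g x y =
    \sum_(x <- r) \sum_(m < size P) (Q x)`_m * u ^+ m * g x y.
  rewrite big_seq [RHS]big_seq; apply: eq_bigr => x ha.
  by rewrite (horner_coef_wide _ (expands_size (hQ x ha))) mulr_suml.
rewrite exchange_big /=; apply: eq_bigr => m _.
transitivity (\sum_(x <- r) (\sum_(m <= k0 < size P) P`_k0 * sg x (k0 - m)%N) * u ^+ m * g x y).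
  rewrite mulr_sumr.
  under eq_bigr => j _ do rewrite mulr_sumr mulr_sumr.
  rewrite exchange_big; apply: eq_bigr => x _; rewrite !mulr_suml.
  by apply: eq_bigr => j _; ring.
rewrite [LHS]big_seq [RHS]big_seq; apply: eq_bigr => x ha; congr (_ * _ * _).
by rewrite -(expands_polypart (hQ x ha)) coef_poly ltn_ord.
Qed.

Lemma opF_delta c j s y0 y : opF j s (fun y => c * delta y0 y) y =
  \sum_(a <- idx j) geom 0 (pole y0 j a) s * (c * cF y0 j a * delta (nudge (- 1) j a y0) y).
Proof.
apply: eq_bigr => a _; rewrite /delta; case: asboolP => [<-|ne].
  by rewrite nudgeK asboolT // !mulr1 -mulrA [c * _]mulrC.
by rewrite asboolF ?mulr0 // => e1; apply: ne; rewrite e1 nudgeVK.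
Qed.

Lemma opE_delta c i s y0 y : opE i s (fun y => c * delta y0 y) y =
  \sum_(b <- idx i) geom (shift_gap i) (pole (nudge 1 i b y0) i b) s *
    (c * cE y0 i b * delta (nudge 1 i b y0) y).
Proof.
apply: eq_bigr => a _; rewrite /delta; case: asboolP => [<-|ne].
  by rewrite nudgeVK asboolT // !mulr1 -mulrA [c * _]mulrC.
by rewrite asboolF ?mulr0 // => e1; apply: ne; rewrite e1 nudgeK.
Qed.

Lemma paired_f_all j s k v g : (1 <= j <= n.-1)%N -> paired k v g ->
  paired k.+1 (f j s *: v) (opF j s g).
Proof.
move=> hj h; case: s => [|s]; last by apply: paired_f h; rewrite /f_ok hj.
apply: paired_eq (paired0 _) _ _; first by rewrite f_ser0 scale0r.
by move=> y; rewrite /opF big1 // => a _; rewrite /geom !mul0r.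
Qed.

Lemma paired_e_all i s k v g : (1 <= i <= n.-1)%N -> paired k.+1 v g ->
  paired k (e i s *: v) (opE i s g).
Proof.
move=> hi h; have [le|lt] := leqP s (shift_gap i).
  apply: paired_eq (paired0 _) _ _; first by rewrite e_ser_low // scale0r.
  by move=> y; rewrite /opE big1 // => a _; rewrite /geom le !mul0r.
have es : e_ok n p i s by rewrite /e_ok hi addn1.
exact: (paired_e es h).
Qed.

Lemma e_depth0 i s v g : (1 <= i <= n.-1)%N -> paired 0 v g -> e i s *: v = 0.
Proof.
move=> hi h; have [le|lt] := leqP s (shift_gap i); first by rewrite e_ser_low // scale0r.
have es : e_ok n p i s by rewrite /e_ok hi addn1.
by case: (paired_e es h).
Qed.

Lemma a_scalar i q k v c y0 : (i <= n)%N -> paired k v (fun y => c * delta y0 y) ->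
  a_ser K n p i q *: v = a_eigen y0 i q **: v.
Proof.
move=> hi h.
apply: (paired_inj (paired_a q hi h) (pairedZ _ h)).
by move=> y; rewrite /delta; case: asboolP => [->//|]; rewrite !mulr0.
Qed.

Lemma A_act i u k v c y0 : (1 <= i <= n)%N -> paired k v (fun y => c * delta y0 y) ->
  A_at n p i u *: v = (alpha 0 y0 i).[u] **: v.
Proof.
move=> /andP[_ hi] h.
have hs q : paired k (a_ser K n p i q *: v) (fun y => \sum_(x <- [:: tt]) a_eigen y0 i q * (c *
  delta y0 y)).
  apply: paired_eq (pairedZ (a_eigen y0 i q) h) _ _; first by rewrite (a_scalar _ hi h).
  by move=> y; rewrite big_seq1.
have hQ x : x \in [:: tt] -> expands (Pden i) (a_eigen y0 i) (alpha 0 y0 i).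
  by move=> _; apply: a_eigenP.
have h' := paired_poly_times u hs hQ.
apply: (paired_inj h' (pairedZ _ h)).
by move=> y; rewrite big_seq1.
Qed.

Lemma comp_XaddC (x c : K) : ('X + x%:P) \Po ('X - c%:P) = 'X + (x - c)%:P.
Proof. by rewrite comp_polyD comp_polyX comp_polyC -addrA -polyCN -polyCD [- c + x]addrC. Qed.

Lemma XsubpoleE j y a : (0 < j)%N ->
  ('X - (pole y j a)%:P) \Po ('X - (j.-1)%:R%:P) = 'X + (ell_ y j a)%:P.
Proof.
move=> j0; rewrite -[- (pole _ _ _)%:P]polyCN comp_XaddC; congr (_ + _%:P).
by rewrite /pole -[in j%:R](prednK j0) -natr1; ring.
Qed.

Lemma alpha_rem j y a : a \in idx j ->
  alpha 0 y j = ('X + (ell_ y j a)%:P) * \prod_(c <- rem a (idx j)) ('X + (ell_ y j c)%:P).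
Proof.
move=> ha; rewrite /alpha (perm_big _ (perm_to_rem ha)) big_cons addr0; congr (_ * _).
by apply: eq_bigr => c _; rewrite addr0.
Qed.

Lemma Xell_neq0 (x : K) : 'X + x%:P != 0 :> {poly K}.
Proof. by rewrite -[x]opprK polyCN polyXsubC_eq0. Qed.

(** The point -l_b is a root of each of these products except the one that omits b. *)
Lemma sum_root_rem j y b (F : nat * nat -> K) : b \in idx j ->
  \sum_(a <- idx j) (\prod_(c <- rem a (idx j)) ('X + (ell_ y j c)%:P)).[- ell_ y j b] * F a =
  \prod_(c <- rem b (idx j)) (ell_ y j c - ell_ y j b) * F b.
Proof.
move=> hb; rewrite (bigD1_seq b) ?uniq_idx //= [X in _ + X]big1_seq ?addr0.
  rewrite horner_prod; congr (_ * _); apply: eq_bigr => c _.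
  by rewrite hornerD hornerX hornerC addrC.
move=> a /andP[ab ha]; rewrite horner_prod (perm_big _ (perm_to_rem (x := b) _)) ?big_cons /=.
  by rewrite hornerD hornerX hornerC addNr !mul0r.
by rewrite mem_rem_uniq ?uniq_idx // inE hb andbT eq_sym.
Qed.

Lemma rem_prod_neq0 j y b : pattern y -> inner j b ->
  \prod_(c <- rem b (idx j)) (ell_ y j c - ell_ y j b) != 0.
Proof.
move=> py hb; rewrite prodf_seq_neq0; apply/allP => c /=.
rewrite mem_rem_uniq ?uniq_idx // inE => /andP[cb hc]; rewrite subr_eq0; apply: contra cb => /eqP.
move=> e1; apply/eqP; apply: (ell_inj py _ hc (inner_idx hb) e1).
by apply: ltnW; case/andP: (inner_ltn hb).
Qed.

(** In c_j(u) the series a_j(u) acts before f_j, hence by its eigenvalue at the source [y0]. Its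
    linear factor at the moved entry cancels the pole of f_j. *)
Lemma C_act j b k v c y0 : inner j b -> pattern y0 -> paired k v (fun y => c * delta y0 y) ->
  paired k.+1 (C_at n p j (- ell_ y0 j b) *: v)
    (fun y => (if pattern (nudge (- 1) j b y0)
               then c * \prod_(b' <- idx j.-1) (ell_ y0 j.-1 b' - ell_ y0 j b) else 0)
              * delta (nudge (- 1) j b y0) y).
Proof.
move=> ib py h; have hjn := inner_ltn ib; have j0 : (0 < j)%N by case/andP: hjn.
pose sg a := ser_mul (ser_shift j.-1 (geom 0 (pole y0 j a))) (a_eigen y0 j).
pose g a y := c * cF y0 j a * delta (nudge (- 1) j a y0) y.
have hs q : paired k.+1 (c_ser K n p j q *: v) (fun y => \sum_(a <- idx j) sg a q * g a y).
  have h' : paired k.+1 (c_ser K n p j q *: v) (fun y => \sum_(r < q.+1) a_eigen y0 j (q - r) *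
      ser_shift j.-1 (fun t => opF j t (fun y => c * delta y0 y) y) r).
    apply: paired_act_sum => r; rewrite -scalerA (a_scalar _ _ h); last by lia.
    rewrite act_kscale; apply: pairedZ; apply: (@paired_ser_shift _ (f j) (fun t => opF j t _)) =>
      t.
    by apply: paired_f_all h; lia.
  apply: paired_eq h' _ _ => // y; under eq_bigr => r _.
    rewrite (ser_shift_ext _ _ (fun t => opF_delta c j t y0 y)) ser_shift_sum mulr_sumr; over.
  rewrite exchange_big; apply: eq_bigr => a _; rewrite /sg /ser_mul mulr_suml.
  by apply: eq_bigr => r _; rewrite ser_shift_mulr mulrA [a_eigen _ _ _ * _]mulrC.
have hQ a : a \in idx j -> expands (Pden j) (sg a) (\prod_(c <- rem a (idx j)) ('X + (ell_ y0 j
  c)%:P)).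
  move=> ha; apply: (expands_cancel (Xell_neq0 (ell_ y0 j a))).
  have := expandsM (expands_shift j.-1 (expands_geom 0 (pole y0 j a))) (a_eigenP y0 j).
  rewrite expr0 mul1r XsubpoleE // rmorph1 mul1r (alpha_rem _ ha).
  by rewrite [Pden _ * _]mulrC [\prod_(c <- rem a (idx j)) _ * _]mulrC.
apply: paired_eq (paired_poly_times (- ell_ y0 j b) hs hQ) _ _ => // y.
rewrite sum_root_rem ?(inner_idx ib) // /g /cF py /=.
case: ifP => _; last by rewrite mulr0 !mul0r mulr0.
by rewrite /cF_val; have := rem_prod_neq0 py ib; set x := \prod_(c <- rem _ _) _ => x0; field.
Qed.

Lemma poly_times_act0 (P : {poly K}) (s : nat -> W) (u : K) v :
  (forall q, s q *: v = 0) -> (poly_times_ser P s).[u%:A] *: v = 0.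
Proof.
move=> h; rewrite horner_act big1 // => m _; rewrite coef_poly.
case: ifP => _; last by rewrite scale0r kscaler0.
by rewrite scaler_suml big1 ?kscaler0 // => q _; rewrite scale_act h kscaler0.
Qed.

Lemma B_act_depth0 i u v g : (1 <= i <= n.-1)%N -> paired 0 v g -> B_at n p i u *: v = 0.
Proof.
move=> hi h; apply: poly_times_act0 => q; rewrite scaler_suml big1 // => r _; rewrite -scalerA.
suff -> : ser_shift i.-1 (e i) (q - r) *: v = 0 by rewrite scaler0.
rewrite /ser_shift scaler_suml big1 // => t _.
by rewrite -mulr_natl -scalerA (e_depth0 _ hi h) scaler0.
Qed.

Lemma B_act i b k v c y0 : inner i b -> pattern y0 -> paired k.+1 v (fun y => c * delta y0 y) ->
  paired k (B_at n p i (- ell_ y0 i b) *: v)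
    (fun y => (if pattern (nudge 1 i b y0)
               then - (c * \prod_(b' <- idx i.+1) (ell_ y0 i.+1 b' - ell_ y0 i b)) else 0)
              * delta (nudge 1 i b y0) y).
Proof.
move=> ib py h; have hin := inner_ltn ib; have i0 : (0 < i)%N by case/andP: hin.
pose y1 a := nudge 1 i a y0.
(* In b_i(u) the series a_i(u) acts after e_i, hence by its eigenvalue at the raised array. The
   factor at the raised entry cancels the pole; the others are the same as at [y0]. *)
pose sg a := ser_mul (a_eigen (y1 a) i) (ser_shift i.-1 (geom (shift_gap i) (pole (y1 a) i a))).
pose g a y := c * cE y0 i a * delta (nudge 1 i a y0) y.
have hs q : paired k (b_ser K n p i q *: v) (fun y => \sum_(a <- idx i) sg a q * g a y).
  have h' : paired k (b_ser K n p i q *: v) (fun y => \sum_(r < q.+1) a_eigen y i r *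
      ser_shift i.-1 (fun t => opE i t (fun y => c * delta y0 y) y) (q - r)).
    apply: paired_act_sum => r; rewrite -scalerA; apply: (paired_a); first by lia.
    apply: (@paired_ser_shift _ (e i) (fun t => opE i t _)) => t.
    by apply: paired_e_all h; lia.
  apply: paired_eq h' _ _ => // y; under eq_bigr => r _.
    rewrite (ser_shift_ext _ _ (fun t => opE_delta c i t y0 y)) ser_shift_sum mulr_sumr; over.
  rewrite exchange_big; apply: eq_bigr => a _; rewrite /sg /ser_mul mulr_suml.
  apply: eq_bigr => r _; rewrite ser_shift_mulr /g /delta -/(y1 a).
  by case: asboolP => [->|_]; rewrite ?mulr0 // mulrA.
have hQ a : a \in idx i -> expands (Pden i.-1 * ulin K i ^+ p i.+1) (sg a)
    (\prod_(c <- rem a (idx i)) ('X + (ell_ y0 i c)%:P)).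
  move=> ha; apply: (expands_cancel (Xell_neq0 (ell_ (y1 a) i a))).
  have := expandsM (a_eigenP (y1 a) i) (expands_shift i.-1 (expands_geom (shift_gap i) (pole (y1 a)
    i a))).
  rewrite comp_polyM comp_Xn_poly XsubpoleE // rmorph1 mulr1 (alpha_rem _ ha) [X in expands _ _
    X]mulrC.
  have -> : \prod_(c <- rem a (idx i)) ('X + (ell_ (y1 a) i c)%:P) =
      \prod_(c <- rem a (idx i)) ('X + (ell_ y0 i c)%:P).
    rewrite big_seq [RHS]big_seq; apply: eq_bigr => c'.
    rewrite mem_rem_uniq ?uniq_idx // inE => /andP[ca _].
    by rewrite ell_nudge_neq // xpair_eqE eqxx.
  (* The p_i factors u - i + 1 from a_i(u) and the [shift_gap i] ones from e_i(u) give the exponent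
     p_(i+1) in B_i(u). *)
  have -> // : Pden i * (('X - (i.-1)%:R%:P) ^+ shift_gap i * ('X + (ell_ (y1 a) i a)%:P)) =
    Pden i.-1 * ulin K i ^+ p i.+1 * ('X + (ell_ (y1 a) i a)%:P).
  rewrite mulrA; congr (_ * _); rewrite -{1}(prednK i0) /Pden big_nat_recr //= prednK // -mulrA
    -exprD.
  by congr (_ * _ ^+ _); rewrite /shift_gap subnKC // p_mono //; lia.
apply: paired_eq (paired_poly_times (- ell_ y0 i b) hs hQ) _ _.
  congr ((poly_times_ser _ _).[_] *: _).
  by rewrite /Pden prednK.
move=> y; rewrite sum_root_rem ?(inner_idx ib) // /g /cE py /=.
case: ifP => _; last by rewrite mulr0 !mul0r mulr0.
by rewrite /cE_val; have := rem_prod_neq0 py ib; set x := \prod_(c <- rem _ _) _ => x0; field.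
Qed.

(** * The vectors zeta and xi of a pattern *)

(** The number of lowerings from the top array to y. It recovers the depth of a pair from any array
    at which its function is nonzero. *)
Definition depth y : int := \sum_(1 <= r < n) \sum_(a <- idx r) (z a.1 a.2 - y r a).

Lemma depth_nudge c r a y : inner r a -> depth (nudge c r a y) = depth y - c.
Proof.
case/andP=> hr ha; rewrite /depth.
transitivity (\sum_(1 <= s < n) (\sum_(b <- idx s) (z b.1 b.2 - y s b) -
    \sum_(b <- idx s) (if (s == r) && (b == a) then c else 0))).
  apply: eq_bigr => s _; rewrite -sumrB; apply: eq_bigr => b _.
  by rewrite /nudge opprD addrA.
rewrite sumrB; congr (_ - _).
rewrite (bigD1_seq r) ?mem_index_iota ?iota_uniq //= [X in _ + X]big1 ?addr0; last first.
  by move=> s /negPf->; rewrite big1.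
rewrite (bigD1_seq a) ?uniq_idx //= !eqxx [X in _ + X]big1 ?addr0 // => b /negPf->.
by rewrite andbF.
Qed.

Lemma paired_depth k v g : paired k v g -> forall y, g y <> 0 -> depth y = k%:Z.
Proof.
elim=> [y|{}k j s {}v {}g hf _ IH y|{}k y []|{}k c {}v v' {}g g' _ IH _ IH' y] //.
- rewrite /delta; case: asboolP => // -> _; rewrite /depth big1 // => r _.
  by rewrite big1 // => a _; rewrite subrr.
- move=> hy; have [a ha ga] : exists2 a, a \in idx j & g (nudge 1 j a y) <> 0.
    apply: contrapT => h; apply: hy; rewrite /opF big1_seq // => a /andP[_ ha].
    have [->|ne] := pselect (g (nudge 1 j a y) = 0); first by rewrite mulr0.
    by case: h; exists a.
  have ja : inner j a by rewrite /inner ha andbT; case/andP: hf; lia.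
  by have := IH _ ga; rewrite depth_nudge //; lia.
- move=> hy; have [g0|/IH //] := pselect (g y = 0).
  by apply: IH' => g0'; apply: hy; rewrite g0 g0' mulr0 addr0.
Qed.

Lemma pattern_le_top y r i k : pattern y -> (1 <= i <= r)%N -> (r <= n)%N -> (1 <= k <= p i)%N ->
  y r (i, k) <= z i k.
Proof.
case/patternP=> h0 h1 _ hi hr hk; rewrite -(subKn hr).
move: (n - r)%N (leq_subr r n) (subKn hr) => m; elim: m r hi hr => [|m IH] r hi hr hm e.
  by rewrite subn0 h0 //= /inner ltnn andbF.
have e1 : (n - m = (n - m.+1).+1)%N by lia.
apply: le_trans (h1 _ _ _ _) _; first by rewrite /inner mem_idx; lia.
by rewrite -e1; apply: (IH r.+1); lia.
Qed.

(** Genericity gives an equal entry of row r - 1 the same k, and interlacing puts it in the same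
    column; the lowering would then break the inequality between the two. This is the source of the
    nonvanishing of N_Lambda. *)
Lemma ell_prev_neq y r a b : pattern y -> inner r a -> b \in idx r.-1 ->
  pattern (nudge (- 1) r a y) -> ell_ y r.-1 b - ell_ y r a != 0.
Proof.
case: a b => i k [j m] py hin hb; rewrite pattern_lower // => /andP[/implyP h1 h2].
have := hin; rewrite /inner mem_idx => hin'.
rewrite subr_eq0; apply/negP => /eqP e1.
have := @ell_sub_int y y r.-1 r (j, m) (i, k) 0 hb (inner_idx hin).
rewrite !addr0 => /(_ _ _ e1)[||/= km e2]; [lia|lia|].
subst m; move: hb; rewrite mem_idx => hb; case/patternP: (py) => g0 g1 g2.
have ij : inner r.-1 (j, k) by rewrite /inner mem_idx; lia.
have := g1 _ _ _ ij; have := g2 _ _ _ ij; rewrite prednK; last by lia.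
move=> e3 e4; have [lt|lt|eq] := ltngtP i j.
- have : y r (j, k) < y r (i, k) by apply: (pattern_lt py); lia.
  lia.
- have [lt'|lt'|eq'] := ltngtP i j.+1.
  + lia.
  + have : y r (i, k) < y r (j.+1, k).
      apply: (pattern_lt py); try lia.
      by have := @p_mono j; lia.
    lia.
  + by move: e3; rewrite -eq'; lia.
- by subst j; have := h1 _; lia.
Qed.

(* The rows r < r0 of column block i0, the entries (r0, i0, k >= k0) and all blocks i > i0 are
   those of y, the other entries are those of the highest vector. *)
Definition stage (i0 r0 k0 : nat) y : array := fun r a =>
  if inner r a && ((i0 < a.1)%N || (a.1 == i0) && ((r < r0)%N || (r == r0) && (k0 <= a.2)%N))
  then y r a else z a.1 a.2.

Lemma stage_pattern y r i k (t : int) : pattern y -> inner r (i, k) ->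
  0 <= t -> t <= z i k - y r (i, k) -> pattern (nudge (- t) r (i, k) (stage i r k.+1 y)).
Proof.
move=> py hin t0 ht; have := hin; rewrite /inner mem_idx => hin'.
have le_top := pattern_le_top py.
case/patternP: (py) => h0 h1 h2.
apply/patternP; split=> [s b hb|s j m hb|s j m hb].
- rewrite /nudge ifF; last by apply: contraNF hb => /andP[/eqP-> /eqP->].
  by rewrite addr0 /stage (negPf hb).
- have := hb; rewrite /inner mem_idx => hb'; have := h1 _ _ _ hb.
  have t1 : y s (j, m) <= z j m by apply: le_top; lia.
  rewrite /nudge /stage hb /= !xpair_eqE.
  have [hb1|nb1] := boolP (inner s.+1 (j, m)); rewrite /=.
    have t2 : y s.+1 (j, m) <= z j m by apply: le_top; lia.
    have [e1|] := eqVneq s r; have [e2|] := eqVneq s.+1 r; have [e3|] := eqVneq j i;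
      have [e4|] := eqVneq m k; rewrite /= ?andbT ?andbF; try subst;
      do ?[case: ifP => ?]; try lia.
  have e0 : s.+1 = n by apply/eqP; move: nb1; rewrite /inner mem_idx; lia.
  rewrite (h0 _ _ nb1) /= => _.
  have [e1|] := eqVneq s r; have [e2|] := eqVneq s.+1 r; have [e3|] := eqVneq j i;
      have [e4|] := eqVneq m k; rewrite /= ?andbT ?andbF; try subst;
      do ?[case: ifP => ?]; try lia.
- have := hb; rewrite /inner mem_idx => hb'; have := h2 _ _ _ hb.
  have t1 : y s (j, m) <= z j m by apply: le_top; lia.
  have zd : z j.+1 m < z j m by apply: z_decr; lia.
  have pj : (p j <= p j.+1)%N by apply: p_mono; lia.
  have t2 : y s.+1 (j.+1, m) <= z j.+1 m by apply: le_top; lia.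
  have e0 : ~~ inner s.+1 (j.+1, m) -> y s.+1 (j.+1, m) = z j.+1 m by apply: h0.
  rewrite /nudge /stage hb /= !xpair_eqE.
  move: e0; case: (inner s.+1 (j.+1, m)) => [_|/(_ isT)->] /=;
  have [e1|] := eqVneq s r; have [e2|] := eqVneq s.+1 r; have [e3|] := eqVneq j i;
    have [e4|] := eqVneq m k; have [e5|] := eqVneq j.+1 i; rewrite /= ?andbT ?andbF; try subst;
    do ?[case: ifP => ?]; try lia.
Qed.

Lemma stage_step y r i k : inner r (i, k) ->
  nudge (- (z i k - y r (i, k))) r (i, k) (stage i r k.+1 y) = stage i r k y.
Proof.
move=> hin; apply/funext => s; apply/funext => -[j m]; rewrite /nudge /stage /= xpair_eqE.
case E: (inner s (j, m)) => /=; last first.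
  rewrite ifF ?addr0 //; apply/negP => /and3P[/eqP e1 /eqP e2 /eqP e3].
  by rewrite e1 e2 e3 hin in E.
have [e1|] := eqVneq s r; have [e2|] := eqVneq j i; have [e3|] := eqVneq m k; rewrite /= ?andbT
  ?andbF ?addr0;
  try subst; do ?[case: ifP => ?]; lia.
Qed.

Lemma stage_next_row y r i : stage i r 1 y = stage i r.+1 (p i).+1 y.
Proof.
apply/funext => s; apply/funext => -[j m]; rewrite /stage /inner mem_idx /=.
congr (if _ then _ else _).
have [->|ne] := eqVneq j i; rewrite ?andbF //=.
by rewrite !ltnn /=; apply/idP/idP; lia.
Qed.

Lemma stage_next_block y i k : (0 < i)%N -> stage i n k y = stage i.-1 i.-1 (p i.-1).+1 y.
Proof.
move=> i0; apply/funext => s; apply/funext => -[j m]; rewrite /stage /inner mem_idx /=.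
congr (if _ then _ else _); have [->|ne] := eqVneq j i.-1; apply/idP/idP; lia.
Qed.

Lemma stage_top y : (0 < n)%N -> stage n.-1 n.-1 (p n.-1).+1 y = top.
Proof.
move=> n0; apply/funext => s; apply/funext => -[j m]; rewrite /stage /inner mem_idx /=.
by rewrite ifF //; apply/negbTE; have [->|ne] := eqVneq j n.-1; lia.
Qed.

Lemma stage_all y : pattern y -> stage 0 0 (p 0).+1 y = y.
Proof.
move=> /patternP[h0 _ _]; apply/funext => s; apply/funext => -[j m]; rewrite /stage.
case: ifP => // /negbT h; rewrite h0 //; apply: contra h => h; rewrite h /=.
by move: h; rewrite /inner mem_idx; lia.
Qed.

Definition proportional c y v := c != 0 /\ exists k, paired k v (fun y' => c * delta y y').

Lemma C_step r a c y v : inner r a -> pattern y -> pattern (nudge (- 1) r a y) ->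
  proportional c y v ->
  proportional (c * \prod_(b <- idx r.-1) (ell_ y r.-1 b - ell_ y r a)) (nudge (- 1) r a y)
    (C_at n p r (- ell_ y r a) *: v).
Proof.
move=> ia py py' [c0 [k h]]; split.
  rewrite mulf_neq0 // prodf_seq_neq0; apply/allP => b hb /=.
  exact: ell_prev_neq.
exists k.+1; have := C_act ia py h.
by rewrite py'.
Qed.

Section Target.
Variables (L : nat -> nat -> nat -> K) (y : array).
Hypothesis y_pattern : pattern y.
Hypothesis L_ell : forall r i k, (1 <= i <= r)%N -> (r <= n)%N -> (1 <= k <= p i)%N ->
  ell (L r) i k = ell_ y r (i, k).

Lemma stepsE r i k : inner r (i, k) -> (steps lam L r i k)%:Z = z i k - y r (i, k).
Proof.
rewrite /inner mem_idx => hin; have le : y r (i, k) <= z i k by apply: pattern_le_top; lia.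
rewrite /steps lam_ell ?L_ell /ell_; try lia.
have -> : rho k + (z i k)%:~R - (rho (i, k).2 + (y r (i, k))%:~R) = (z i k - y r (i, k))%:~R :> K.
  by rewrite rmorphB /=; ring.
case: (z i k - y r (i, k)) (subr_ge0 (y r (i, k)) (z i k)) => // [m _|m].
  by rewrite -pmulrn nat_value_nat.
by rewrite le.
Qed.

Definition string_const r i k : K := \prod_(t < steps lam L r i k)
  \prod_(b <- idx r.-1) (ell_ (stage i r k.+1 y) r.-1 b - ell lam i k + t%:R).

Lemma C_string r i k c v : inner r (i, k) -> proportional c (stage i r k.+1 y) v ->
  proportional (c * string_const r i k) (stage i r k y)
    ((\prod_(t < steps lam L r i k) C_at n p r (- ell (L r) i k - 1 - t%:R)) *: v).
Proof.
move=> hin hv; have := hin; rewrite /inner mem_idx => hin'.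
have es := stepsE hin.
have lE : ell lam i k = rho k + (z i k)%:~R by apply: lam_ell; lia.
set S := stage i r k.+1 y.
(* q counts the rightmost factors, those applied so far. At q = [steps lam L r i k] the base point
   l_i^(k) - q becomes l_(ri)^(k). *)
have hq q : (q <= steps lam L r i k)%N ->
    proportional (c * \prod_(t < q) \prod_(b <- idx r.-1) (ell_ S r.-1 b - ell lam i k + t%:R))
      (nudge (- q%:Z) r (i, k) S)
      ((\prod_(t < q) C_at n p r (- (ell lam i k - q%:R) - 1 - t%:R)) *: v).
  elim: q => [_|q IH lt].
    rewrite !big_ord0 mulr1 scale1r (_ : nudge _ _ _ _ = S) //.
    apply/funext => s; apply/funext => a; rewrite /nudge oppr0.
    by case: ifP; rewrite addr0.
  rewrite [X in proportional (c * X)]big_ord_recr [X in X *: v]big_ord_recl /= mulrA -scalerA.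
  have eS : nudge (- q.+1%:Z) r (i, k) S = nudge (- 1) r (i, k) (nudge (- q%:Z) r (i, k) S).
    apply/funext => s; apply/funext => a; rewrite /nudge -addrA; congr (_ + _).
    by case: ifP; lia.
  have eell : ell_ (nudge (- q%:Z) r (i, k) S) r (i, k) = ell lam i k - q%:R.
    rewrite ell_nudge lE /ell_ /= /S /stage hin /= !ltnn eqxx /=.
    by rewrite andbF rmorphN /= -pmulrn.
  have px (t : nat) : (t <= steps lam L r i k)%N -> pattern (nudge (- t%:Z) r (i, k) S).
    by move=> ht; apply: stage_pattern => //; lia.
  rewrite eS; have := C_step hin (px q (ltnW lt)) _ (IH (ltnW lt)).
  rewrite -eS eell => /(_ (px _ lt)) {}IH.
  have -> : - (ell lam i k - q.+1%:R) - 1 - 0%:R = - (ell lam i k - q%:R).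
    by rewrite -natr1; ring.
  have -> : \prod_(i0 < q) C_at n p r (- (ell lam i k - q.+1%:R) - 1 - (lift ord0 i0)%:R) =
      \prod_(t < q) C_at n p r (- (ell lam i k - q%:R) - 1 - t%:R).
    apply: eq_bigr => t _; congr (C_at _ _ _ _); rewrite /= /fintype.bump add1n -!natr1; ring.
  have -> : \prod_(b <- idx r.-1) (ell_ S r.-1 b - ell lam i k + q%:R) =
      \prod_(b <- idx r.-1) (ell_ (nudge (- q%:Z) r (i, k) S) r.-1 b - (ell lam i k - q%:R)).
    apply: eq_bigr => b _; rewrite ell_nudge_row; first by ring.
    by rewrite neq_ltn; lia.
  exact: IH.
have := hq _ (leqnn _); rewrite es stage_step //.
have -> // : ell lam i k - (steps lam L r i k)%:R = ell (L r) i k.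
have -> : (steps lam L r i k)%:R = (z i k - y r (i, k))%:~R :> K by rewrite -es.
by rewrite L_ell ?lE /ell_ /= ?rmorphB /=; [ring|lia..].
Qed.

Lemma P_elt_stage r i c v : (1 <= i <= r)%N -> (r < n)%N ->
  proportional c (stage i r (p i).+1 y) v ->
  proportional (c * \prod_(1 <= k < (p i).+1) string_const r i k) (stage i r 1 y)
    (P_elt n p lam L r i *: v).
Proof.
move=> hi hr hv; rewrite /P_elt.
suff h q : (q <= p i)%N ->
  proportional (c * \prod_((p i).+1 - q <= k < (p i).+1) string_const r i k)
    (stage i r ((p i).+1 - q)%N y)
    ((\prod_((p i).+1 - q <= k < (p i).+1) \prod_(t < steps lam L r i k)
        C_at n p r (- ell (L r) i k - 1 - t%:R)) *: v).
  by have := h _ (leqnn _); rewrite subSnn.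
elim: q => [|q IH] hq; first by rewrite subn0 !big_geq // mulr1 scale1r.
have lt : ((p i).+1 - q.+1 < (p i).+1)%N by lia.
rewrite (big_ltn lt) (big_ltn lt).
have e : ((p i).+1 - q.+1).+1 = ((p i).+1 - q)%N by lia.
rewrite e -scalerA mulrC -mulrA mulrC -mulrA mulrC.
rewrite [_ * string_const _ _ _]mulrC.
set k := ((p i).+1 - q.+1)%N in e lt *.
have hin : inner r (i, k) by rewrite /inner mem_idx /k; lia.
rewrite -mulrA [_ * (c * _)]mulrC.
apply: (C_string hin).
rewrite e; apply: IH; lia.
Qed.

Lemma column_stage i r0 c v : (1 <= i <= r0)%N -> (r0 <= n)%N -> (i < n)%N ->
  proportional c (stage i i (p i).+1 y) v ->
  proportional (c * \prod_(i <= r < r0) \prod_(1 <= k < (p i).+1) string_const r i k)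
    (stage i r0 (p i).+1 y)
    ((\prod_(r <- rev (index_iota i r0)) P_elt n p lam L r i) *: v).
Proof.
move=> /andP[i0 hr] hn hi hv; rewrite -(subnKC hr) in hn *.
elim: (r0 - i)%N hn => [|q IH] hn.
  by rewrite addn0 big_geq // /index_iota subnn big_nil mulr1 scale1r.
rewrite addnS in hn *; rewrite big_nat_recr ?leq_addr //=.
have -> : rev (index_iota i (i + q).+1) = (i + q)%N :: rev (index_iota i (i + q)).
  by rewrite /index_iota subSn ?leq_addr // addKn -addn1 iotaD rev_cat.
rewrite big_cons -scalerA -stage_next_row mulrA.
by apply: P_elt_stage; [lia|lia|apply: IH; lia].
Qed.

Lemma zeta_stage i0 : (1 <= i0 <= n)%N ->
  proportional (\prod_(i0 <= i < n) \prod_(i <= r < n) \prod_(1 <= k < (p i).+1) string_const r i k)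
    (stage i0.-1 i0.-1 (p i0.-1).+1 y)
    ((\prod_(i0 <= i < n) \prod_(r <- rev (index_iota i n)) P_elt n p lam L r i) *: zeta).
Proof.
move=> /andP[h1 h2]; rewrite -(subKn h2); have := leq_subr i0 n; move: (n - i0)%N (subKn h2) => q e
  _.
have hq : (q < n)%N by lia.
elim: q hq {e} => [|q IH] hq.
  rewrite subn0 !big_geq // scale1r stage_top; last by lia.
  split; first exact: oner_neq0.
  exists 0%N; apply: paired_eq (paired_hw) _ _ => // y'; by rewrite mul1r.
have lt : (n - q.+1 < n)%N by lia.
rewrite (big_ltn lt) [X in X *: _](big_ltn lt).
have e : (n - q.+1).+1 = (n - q)%N by lia.
rewrite e -scalerA [X in proportional X]mulrC -(@stage_next_block y (n - q.+1)%N (p (n -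
  q.+1)).+1); last by lia.
apply: column_stage; try lia.
by have := IH (ltnW hq); rewrite -e /=.
Qed.

(** While column i is lowered in row r, the columns j < i of row r - 1 are still at the top and the
    columns j >= i already at the target. These are the two products in N_Lambda. *)
Lemma string_constE r i : (1 <= i <= r)%N -> (r < n)%N ->
  \prod_(1 <= k < (p i).+1) string_const r i k =
  (\prod_(1 <= j < i) \prod_(1 <= m < (p j).+1) \prod_(1 <= k < (p i).+1)
        string lam L (ell lam j m) r i k) *
  (\prod_(i <= j < r) \prod_(1 <= m < (p j).+1) \prod_(1 <= k < (p i).+1)
        string lam L (ell (L r.-1) j m) r i k).
Proof.
move=> hi hr; have r0 : (0 < r)%N by lia.
transitivity (\prod_(b <- idx r.-1) \prod_(1 <= k < (p i).+1)
    \prod_(t < steps lam L r i k) (ell_ (stage i r k.+1 y) r.-1 b - ell lam i k + t%:R)).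
  rewrite exchange_big; apply: eq_bigr => k _; rewrite exchange_big; exact: eq_bigr.
rewrite /idx big_allpairs_dep /= prednK //.
rewrite (@big_cat_nat _ _ _ i) /=; [|lia|lia].
congr (_ * _); rewrite big_seq [RHS]big_seq; apply: eq_bigr => j; rewrite mem_index_iota => hj;
  rewrite big_seq [RHS]big_seq; apply: eq_bigr => m; rewrite mem_index_iota => hm;
  apply: eq_bigr => k _; rewrite /string; apply: eq_bigr => t _; congr (_ - _ + _).
  rewrite /ell_ /stage ifF; last by apply/negbTE; rewrite /=; lia.
  by rewrite lam_ell //=; lia.
rewrite L_ell; [|lia|lia|lia].
rewrite /ell_ /stage ifT //= /inner mem_idx; lia.
Qed.

Lemma N_patE : N_pat n p lam L =
  \prod_(1 <= i < n) \prod_(i <= r < n) \prod_(1 <= k < (p i).+1) string_const r i k.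
Proof.
pose F r i := (\prod_(1 <= j < i) \prod_(1 <= m < (p j).+1) \prod_(1 <= k < (p i).+1)
        string lam L (ell lam j m) r i k) *
  (\prod_(i <= j < r) \prod_(1 <= m < (p j).+1) \prod_(1 <= k < (p i).+1)
        string lam L (ell (L r.-1) j m) r i k).
transitivity (\prod_(1 <= r < n) \prod_(1 <= i < n | (i < r.+1)%N) F r i).
  rewrite /N_pat big_seq [RHS]big_seq; apply: eq_bigr => r; rewrite mem_index_iota => hr.
  by rewrite (big_nat_widen _ _ n) //; lia.
rewrite (exchange_big_dep_nat xpredT) //=; rewrite big_seq [RHS]big_seq; apply: eq_bigr => i.
rewrite mem_index_iota => hi; rewrite [RHS](big_nat_widenl _ 1); last by lia.
rewrite big_seq_cond [RHS]big_seq_cond; apply: eq_big => r.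
  by rewrite ltnS.
rewrite mem_index_iota => /andP[hr hir]; rewrite string_constE //; lia.
Qed.

Lemma zeta_pat_proportional : (0 < n)%N ->
  proportional (N_pat n p lam L) y (zeta_pat lam L zeta).
Proof.
move=> n0; have := @zeta_stage 1; rewrite n0 /= stage_all // -N_patE; exact.
Qed.

Lemma xi_pat_paired : (0 < n)%N ->
  exists k, paired k (xi_pat lam L zeta) (fun y' => 1 * delta y y').
Proof.
move=> n0; have [N0 [k h]] := zeta_pat_proportional n0; exists k.
apply: paired_eq (pairedZ (N_pat n p lam L)^-1 h) _ _ => // y'.
by rewrite mulrA mulVf.
Qed.

End Target.
End Model.

(** * The theorem *)

Section Zplus.
Variable K : numFieldType.

Lemma in_Zplus_int (m : int) : in_Zplus (m%:~R : K) <-> 0 <= m.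
Proof.
split=> [[q /eqP]|m0]; last by exists `|m|%N; rewrite pmulrn gez0_abs.
by rewrite pmulrn eqr_int => /eqP->.
Qed.

Lemma in_ZplusD (x x' : K) : in_Zplus x -> in_Zplus x' -> in_Zplus (x + x').
Proof. by case=> a ->; case=> b ->; exists (a + b)%N; rewrite natrD. Qed.

Lemma in_Zplus0 : in_Zplus (0 : K).
Proof. by exists 0%N. Qed.

Lemma nat_valueE (x : K) : in_Zplus x -> x = (nat_value x)%:R.
Proof. by case=> m ->; rewrite nat_value_nat. Qed.

End Zplus.

Section Main.
Variables (K : numFieldType) (n : nat) (p : nat -> nat).
Hypothesis p_pos : forall i, (1 <= i <= n)%N -> (0 < p i)%N.
Hypothesis p_mono : forall i, (1 <= i <= n.-1)%N -> (p i <= p i.+1)%N.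
Variable lam : nat -> nat -> K.
Hypothesis lam_dominant : forall i k, (1 <= i <= n.-1)%N -> (1 <= k <= p i)%N ->
  in_Zplus (lam i k - lam i.+1 k).
Hypothesis lam_generic : forall i j k m, (1 <= i <= n)%N -> (1 <= j <= n)%N ->
  (1 <= k <= p i)%N -> (1 <= m <= p j)%N -> k <> m -> ~ in_Z (lam i k - lam j m).
Variables (V : lmodType (finite_W K n p)) (zeta : V).
Hypothesis V_zeta : highest_weight_irr lam zeta.
Hypothesis n_pos : (0 < n)%N.

Let rho k := ell lam n k.
(** The summand n - i is the difference of the shifts -i + 1 and -n + 1 contained in l_i^(k) and
    l_n^(k). *)
Let z i k : int := (nat_value (lam i k - lam n k) + (n - i))%:Z.

Lemma lam_top_Zplus i k : (1 <= i <= n)%N -> (1 <= k <= p i)%N -> in_Zplus (lam i k - lam n k).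
Proof.
move=> /andP[i1 hi]; rewrite -(subKn hi); have := leq_subr i n; move: (n - i)%N (subKn hi) => q e
  hq.
rewrite -e in i1 => {e hi}.
elim: q hq i1 => [|q IH] hq i1 hk; first by rewrite subn0 subrr; apply: in_Zplus0.
have e : (n - q = (n - q.+1).+1)%N by lia.
have -> : lam (n - q.+1) k - lam n k =
  lam (n - q.+1) k - lam (n - q.+1).+1 k + (lam (n - q.+1).+1 k - lam n k) by ring.
apply: in_ZplusD; first by apply: lam_dominant; lia.
rewrite -e; apply: IH; try lia.
have := @p_mono (n - q.+1); rewrite -e; lia.
Qed.

Let rho_generic k m : (1 <= k <= p n)%N -> (1 <= m <= p n)%N -> k != m ->
  forall w : int, rho k - rho m != w%:~R.
Proof.
move=> hk hm /eqP km w; apply/eqP => e.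
apply: (@lam_generic n n k m _ _ hk hm km); rewrite ?n_pos ?leqnn //.
by exists w; rewrite -e /rho /ell; ring.
Qed.

Let z_decr i k : (1 <= i <= n.-1)%N -> (1 <= k <= p i)%N -> z i.+1 k < z i k.
Proof.
move=> hi hk; have [m hm] := lam_dominant hi hk.
have hk1 : (1 <= k <= p i.+1)%N by have := p_mono hi; lia.
have hi1 : (1 <= i.+1 <= n)%N by lia.
have h1 := nat_valueE (lam_top_Zplus hi1 hk1).
rewrite /z; suff -> : nat_value (lam i k - lam n k) = (m + nat_value (lam i.+1 k - lam n k))%N by
  lia.
rewrite -[RHS](@nat_value_nat K); congr nat_value; rewrite natrD -h1 -hm; ring.
Qed.

Let lam_ell i k : (1 <= i <= n)%N -> (1 <= k <= p i)%N -> ell lam i k = rho k + (z i k)%:~R.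
Proof.
move=> hi hk; rewrite /z -pmulrn natrD -(nat_valueE (lam_top_Zplus hi hk)) natrB; last by lia.
by rewrite /rho /ell; ring.
Qed.

Local Notation pattern := (pattern n p z).
Local Notation inner := (inner n p).
Local Notation idx := (idx p).

Definition encodes (L : nat -> nat -> nat -> K) (y : array) :=
  (forall r i k, (1 <= i <= r)%N -> (r <= n)%N -> (1 <= k <= p i)%N ->
     ell (L r) i k = ell_ rho y r (i, k)) /\
  (forall r a, ~~ inner r a -> y r a = z a.1 a.2).

Lemma encodes_pattern L y : encodes L y -> GT_pattern n p lam L <-> pattern y.
Proof.
case=> hL h0.
have up r i k : inner r (i, k) -> L r.+1 i k - L r i k = (y r.+1 (i, k) - y r (i, k))%:~R.
  rewrite /inner mem_idx => hin; have e1 := hL r i k; have e2 := hL r.+1 i k.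
  transitivity (ell (L r.+1) i k - ell (L r) i k); first by rewrite /ell; ring.
  by rewrite e1 ?e2 /ell_ /= ?rmorphB /=; [ring|lia..].
have down r i k : inner r (i, k) ->
    L r i k - L r.+1 i.+1 k = (y r (i, k) - y r.+1 (i.+1, k) - 1)%:~R.
  rewrite /inner mem_idx => hin; have e1 := hL r i k; have e2 := hL r.+1 i.+1 k.
  have pi := @p_mono i.
  transitivity (ell (L r) i k - ell (L r.+1) i.+1 k - 1); first by rewrite /ell -natr1; ring.
  by rewrite e1 ?e2 /ell_ /= ?rmorphB /=; [ring|lia..].
split=> [[g0 g1 g2]|/patternP[_ h1 h2]].
  apply/patternP; split=> // r i k hin; have := hin; rewrite /inner mem_idx => hin'.
    have /in_Zplus_int : in_Zplus ((y r.+1 (i, k) - y r (i, k))%:~R : K).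
      by rewrite -up //; apply: g1; lia.
    lia.
  have /in_Zplus_int : in_Zplus ((y r (i, k) - y r.+1 (i.+1, k) - 1)%:~R : K).
    by rewrite -down //; apply: g2; lia.
  lia.
split=> [i k hi hk|r i k hi hr hk|r i k hi hr hk].
- have ni : ~~ inner n (i, k) by rewrite /inner ltnn andbF.
  have := hL n i k hi (leqnn n) hk; rewrite /ell_ h0 // /= -lam_ell //.
  by rewrite /ell => /addIr/addIr.
- have hin : inner r (i, k) by rewrite /inner mem_idx; lia.
  by rewrite up // in_Zplus_int subr_ge0 h1.
- have hin : inner r (i, k) by rewrite /inner mem_idx; lia.
  by rewrite down // in_Zplus_int; have := h2 _ _ _ hin; lia.
Qed.

Lemma encodes_exists L : GT_pattern n p lam L -> exists y, encodes L y.
Proof.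
case=> g0 g1 g2; pose y r a := if inner r a then z a.1 a.2 - (steps lam L r a.1 a.2)%:Z else z a.1
  a.2.
exists y; split=> [r i k hi hr hk|r a /negPf h]; last by rewrite /y h.
have hz : in_Zplus (lam i k - L r i k).
  rewrite -(subKn hr); have := leq_subr r n; move: (n - r)%N (subKn hr) => q e hq.
  have hi' : (1 <= i <= n - q)%N by rewrite e.
  elim: q hq hi' {e} => [|q IH] hq hi'; first by rewrite subn0 g0 ?subrr; [apply:
    in_Zplus0|lia|lia].
  have e : (n - q = (n - q.+1).+1)%N by lia.
  have -> : lam i k - L (n - q.+1)%N i k =
    lam i k - L (n - q.+1).+1 i k + (L (n - q.+1).+1 i k - L (n - q.+1)%N i k) by ring.
  apply: in_ZplusD; first by rewrite -e; apply: IH; lia.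
  by apply: g1; lia.
have hl : ell lam i k = rho k + (z i k)%:~R by apply: lam_ell; lia.
have hs : (steps lam L r i k)%:R = ell lam i k - ell (L r) i k.
  rewrite /steps -nat_valueE //; have -> // : ell lam i k - ell (L r) i k = lam i k - L r i k.
  by rewrite /ell; ring.
rewrite /ell_ /y /=; case: ifP => [_|ni].
  by rewrite rmorphB /= -pmulrn hs hl; ring.
have e : r = n by move: ni; rewrite /inner mem_idx; lia.
by rewrite -hl /ell e g0 //; lia.
Qed.

Lemma encodes_shift L y r i k (c : int) : encodes L y -> inner r (i, k) ->
  encodes (shift_entry L r i k c%:~R) (nudge c r (i, k) y).
Proof.
case=> hL h0 hin; split=> [s j m hj hs hm|s a ha]; last first.
  rewrite /nudge ifF ?addr0 ?h0 //; apply: contraNF ha => /andP[/eqP-> /eqP->] //.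
rewrite /ell /shift_entry /ell_ /nudge xpair_eqE /=.
have := hL s j m hj hs hm; rewrite /ell /ell_ /=.
case: ifP => [/and3P[/eqP-> /eqP-> /eqP->]|_]; last by rewrite addr0.
by rewrite rmorphD /= addrA => <-; ring.
Qed.

Lemma root_poly_prod L y s (u : K) : (s <= n)%N -> encodes L y ->
  \prod_(1 <= j < s.+1) (root_poly (p j) (L s j)).[u - j%:R + 1] =
  \prod_(a <- idx s) (u + ell_ rho y s a).
Proof.
move=> hs [hL _]; rewrite /idx big_allpairs_dep /=.
rewrite big_seq [RHS]big_seq; apply: eq_bigr => j; rewrite mem_index_iota => hj.
rewrite /root_poly horner_prod big_seq [RHS]big_seq; apply: eq_bigr => k.
rewrite mem_index_iota => hk; rewrite -hL; try lia.
by rewrite hornerD hornerX hornerC /ell; ring.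
Qed.

Theorem gelfand_tsetlin_action L : GT_pattern n p lam L ->
  (forall r (u : K), (1 <= r <= n)%N ->
     A_at n p r u *: xi_pat lam L zeta =
     (\prod_(1 <= j < r.+1) (root_poly (p j) (L r j)).[u - j%:R + 1])%:A
       *: xi_pat lam L zeta) /\
  (forall r i k, (1 <= r <= n.-1)%N -> (1 <= i <= r)%N -> (1 <= k <= p i)%N ->
     let l := ell (L r) i k in
     B_at n p r (- l) *: xi_pat lam L zeta =
     (- \prod_(1 <= j < r.+2) (root_poly (p j) (L r.+1 j)).[- l - j%:R + 1])%:A
       *: xi_or0 lam (shift_entry L r i k 1) zeta /\
     C_at n p r (- l) *: xi_pat lam L zeta =
     (\prod_(1 <= j < r) (root_poly (p j) (L r.-1 j)).[- l - j%:R + 1])%:A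
       *: xi_or0 lam (shift_entry L r i k (- 1)) zeta).
Proof.
move=> LP; have [y hy] := encodes_exists LP; have py : pattern y by apply/(encodes_pattern hy).
have xiP L' y' : encodes L' y' -> pattern y' ->
    exists k, paired rho z zeta k (xi_pat lam L' zeta) (fun y0 => 1 * delta K y' y0).
  move=> [hL _] py'.
  exact: (xi_pat_paired p_mono rho_generic z_decr p_pos V_zeta lam_ell py' hL n_pos).
have [d hd] := xiP _ _ hy py.
have inj := paired_inj p_mono rho_generic z_decr p_pos V_zeta lam_ell.
split=> [r u hr|r i k hr hi hk l].
  rewrite (A_act p_mono rho_generic z_decr p_pos V_zeta lam_ell u hr hd) /kscale.
  rewrite (root_poly_prod _ _ hy); last by lia.
  congr (_%:A *: _); rewrite /alpha horner_prod; apply: eq_bigr => a _.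
  by rewrite hornerD hornerX hornerC addr0.
have hin : inner r (i, k) by rewrite /inner mem_idx; lia.
have el : l = ell_ rho y r (i, k) by apply: (proj1 hy); lia.
(* One statement for B and C. If the moved array is not a pattern, the function is 0 and so is v;
   otherwise v is compared with the pair of the shifted xi. *)
have xi0 (c : int) v (k0 : nat) (x : K) :
    paired rho z zeta k0 v (fun y0 => (if pattern (nudge c r (i, k) y) then x else 0) *
      delta K (nudge c r (i, k) y) y0) ->
    v = x%:A *: xi_or0 lam (shift_entry L r i k c%:~R) zeta.
  move=> hv; have hy' := encodes_shift c hy hin; rewrite /xi_or0.
  case: asboolP => [/(encodes_pattern hy') py'|np].
    have [k1 h1] := xiP _ _ hy' py'; rewrite py' in hv.
    (* The depth can be read off only where the function is nonzero, so a zero coefficient is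
       settled separately. *)
    have [x0|x0] := eqVneq x 0.
      rewrite x0 !scale0r.
      apply: (inj _ _ _ _ _ hv (paired0 _ _ _ _)) => y0; by rewrite x0 mul0r.
    have dl1 : delta K (nudge c r (i, k) y) (nudge c r (i, k) y) = 1 by rewrite /delta asboolT.
    have e1 := paired_depth h1 (y := nudge c r (i, k) y).
    have e2 := paired_depth hv (y := nudge c r (i, k) y).
    have ek : k0 = k1.
      move: e1 e2; rewrite dl1 !mulr1 => e1 e2; apply: succn_inj.
      have := e1 (elimN eqP (oner_neq0 K)); have := e2 (elimN eqP x0) => ->.
      by case=> ->.
    rewrite -ek in h1; apply: (inj _ _ _ _ _ hv (pairedZ x h1)) => y0.
    by rewrite mul1r.
  rewrite scaler0; have nP : pattern (nudge c r (i, k) y) = false.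
    by apply/negP => /(encodes_pattern hy').
  apply: (inj _ _ _ _ _ hv (paired0 _ _ _ _)) => y0; by rewrite nP mul0r.
have n1 : (-1 : K) = (- 1)%:~R by rewrite rmorphN.
split.
(* At depth 0 a raised pattern would have depth -1, which is impossible, so both sides vanish. *)
- case: d hd => [|d] hd.
    have rn : (1 <= r <= n.-1)%N by [].
    rewrite (B_act_depth0 p_mono rho_generic z_decr p_pos V_zeta lam_ell _ hr hd).
    rewrite /xi_or0; case: asboolP => [|_]; last by rewrite scaler0.
    have hy' := encodes_shift 1 hy hin => /(encodes_pattern hy') py'.
    have [k1 h1] := xiP _ _ hy' py'.
    have e1 : depth n p z (nudge 1 r (i, k) y) = k1%:Z.
      by apply: (paired_depth h1); rewrite /delta asboolT // mul1r; apply/eqP/oner_neq0.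
    have e2 : depth n p z y = 0%:Z.
      by apply: (paired_depth hd); rewrite /delta asboolT // mul1r; apply/eqP/oner_neq0.
    by move: e1; rewrite depth_nudge // e2.
  have := B_act p_mono rho_generic z_decr p_pos V_zeta lam_ell hin py hd.
  rewrite mul1r -el => /xi0 ->; congr (_%:A *: _); congr (- _).
  rewrite (root_poly_prod _ _ hy); last by lia.
  by apply: eq_bigr => a _; rewrite addrC el.
- have := C_act p_mono rho_generic z_decr p_pos V_zeta lam_ell hin py hd.
  rewrite mul1r -el n1 => /xi0 ->; congr (_%:A *: _).
  have hr1 : (r.-1 <= n)%N by lia.
  have := root_poly_prod (- l) hr1 hy; rewrite prednK; last by lia.
  move=> ->.
  by apply: eq_bigr => a _; rewrite addrC el.
Qed.

End Main.

Theorem theorem4p1 (R : realType) (n : nat) (p : nat -> nat)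
    (p_pos : forall i, (1 <= i <= n)%N -> (0 < p i)%N)
    (p_nondecr : forall i, (1 <= i <= n.-1)%N -> (p i <= p i.+1)%N)
    (lam : nat -> nat -> R[i])
    (lam_dominant : forall i k, (1 <= i <= n.-1)%N -> (1 <= k <= p i)%N ->
       in_Zplus (lam i k - lam i.+1 k))
    (lam_generic : forall i j k m, (1 <= i <= n)%N -> (1 <= j <= n)%N ->
       (1 <= k <= p i)%N -> (1 <= m <= p j)%N -> k <> m ->
       ~ in_Z (lam i k - lam j m))
    (V : lmodType (finite_W R[i] n p)) (zeta : V)
    (V_zeta : highest_weight_irr lam zeta)
    (L : nat -> nat -> nat -> R[i]) (L_pattern : GT_pattern n p lam L) :
  (forall r (u : R[i]), (1 <= r <= n)%N ->
     A_at n p r u *: xi_pat lam L zeta =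
     (\prod_(1 <= j < r.+1) (root_poly (p j) (L r j)).[u - j%:R + 1])%:A
       *: xi_pat lam L zeta) /\
  (forall r i k, (1 <= r <= n.-1)%N -> (1 <= i <= r)%N -> (1 <= k <= p i)%N ->
     let l := ell (L r) i k in
     B_at n p r (- l) *: xi_pat lam L zeta =
     (- \prod_(1 <= j < r.+2) (root_poly (p j) (L r.+1 j)).[- l - j%:R + 1])%:A
       *: xi_or0 lam (shift_entry L r i k 1) zeta /\
     C_at n p r (- l) *: xi_pat lam L zeta =
     (\prod_(1 <= j < r) (root_poly (p j) (L r.-1 j)).[- l - j%:R + 1])%:A
       *: xi_or0 lam (shift_entry L r i k (- 1)) zeta).
Proof.
have [n0|n_pos] := posnP n; first by split=> [r u|r i k]; lia.
exact: (gelfand_tsetlin_action p_pos p_nondecr lam_dominant lam_generic V_zeta n_pos L_pattern).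
Qed.
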